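(* For any $f\in\mathrm{Bound}(k,n)$ and any $\mathbf m\in B(k,n,d)$, we have $\mathbf m\in B_f(k,n,d)$ if and only if $\mathrm{prom}(\mathbf m)\in B_{\chi(f)}(k,n,d)$. In particular, promotion gives a bijection between $B_f(k,n,d)$ and $B_{\chi(f)}(k,n,d)$ for all $k,n,d$ and all $f\in\mathrm{Bound}(k,n)$.
   Context: Let $\Bbbk$ be algebraically closed of characteristic $0$, $1\le k<n$, $d\ge1$. $\mathrm{Gr}(k,n)$ is the Grassmannian; a point $V$ is represented by a $k\times n$ matrix with columns $v_1,\dots,v_n$, extended by $v_{i+n}=v_i$. $\mathrm{Bound}(k,n)$ is the set of bijections $f:\mathbb Z\to\mathbb Z$ with $f(i+n)=f(i)+n$, $\sum_{i=1}^n(f(i)-i)=kn$, $i\le f(i)\le i+n$. For $V$, $f_V(i)=\min\{j\ge i:v_i\in\operatorname{span}(v_{i+1},\dots,v_j)\}$; the positroid variety $\Pi_f$ is the closure of $\{V:f_V=f\}$. Define $\chi(f)(i)=f(i-1)+1$. $R(k,n)$ is the polynomial ring in Plücker variables $[\mathbf a]$, $\mathbf a\in\binom{[n]}{k}$; $\mathcal J_f\subseteq R(k,n)$ is the defining ideal of $\Pi_f$ under the Plücker embedding. The Plücker poset: $\mathbf a\le\mathbf b$ iff $a_i\le b_i$ for all $i$. $<_\omega$ is the degree reverse lexicographic order for a variable ordering that is a fixed linear extension of the Plücker poset (poset-larger variables larger), and $\operatorname{In}(\cdot)$ denotes initial ideal w.r.t. $<_\omega$. $B(k,n,d)$ is the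 set of semistandard tableaux of rectangular shape with $k$ rows and $d$ columns and entries in $[n]$ (strictly increasing down columns, weakly increasing along rows), identified with the monomial $\prod_{i=1}^d[\mathbf a^{(i)}]$ where $\mathbf a^{(i)}$ is the set of entries of column $i$. $B_f(k,n,d)=\{\mathbf m\in B(k,n,d):\mathbf m\notin\operatorname{In}(\mathcal J_f)\}$. Promotion $\mathrm{prom}:B(k,n,d)\to B(k,n,d)$: if $\mathbf m$ has no entry $n$, add $1$ to every entry. Otherwise replace each entry $n$ by an empty cell $\bullet$ and perform reverse jeu de taquin slides: an empty cell exchanges with its left neighbor $b$ or upper neighbor $c$ — with $c$ if $b\le c$ or $b$ does not exist, with $b$ if $b>c$ or $c$ does not exist — until the empty cells occupy a straight (top-left justified) shape; then fill the empty cells with $0$ and add $1$ to every entry. *)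

(* Defs.v *)
From HB Require Import structures.
From mathcomp Require Import all_boot all_order all_algebra.
From mathcomp Require Import mpoly.
Set Implicit Arguments. Unset Strict Implicit. Unset Printing Implicit Defensive.
Import Order.TTheory GRing.Theory Num.Theory.

(* CONVENTION: everything is 0-indexed.  The paper's label i in [n] (or in Z)
   corresponds here to i-1.  So columns v_0..v_{n-1}, v_{i+n} = v_i,
   tableau entries / Plücker indices live in 'I_n (value e = paper label e+1).
   This relabelling i |-> i-1 is uniform and all notions (Bound, chi, f_V,
   Plücker poset, promotion) are invariant under it. *)

Local Open Scope ring_scope.

Definition is_bound (k n : nat) (f : int -> int) : Prop :=
  [/\ bijective f,
      (forall i : int, f (i + n%:Z) = f i + n%:Z),
      (\sum_(i < n) (f i%:Z - i%:Z)) = (k * n)%N%:Z &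
      (forall i : int, i <= f i <= i + n%:Z)].

Definition chi (f : int -> int) : int -> int := fun i => f (i - 1) + 1.

Section Grass.
Variable K : fieldType.
Variables k n : nat.

Definition vcol (M : 'M[K]_(k, n)) (l : int) : 'cV[K]_k :=
  nth 0 [seq col j M | j <- enum 'I_n] (absz (l %% n%:Z)%Z).

Definition in_span_next (M : 'M[K]_(k, n)) (i : int) (t : nat) : bool :=
  ((vcol M i)^T <= \matrix_(s < t) ((vcol M (i + 1 + s%:Z))^T))%MS.

(* f_V(i) = min { j >= i : v_i in span(v_{i+1},...,v_j) }; for a rank-k
   matrix this minimum is at most i+n, so a search over t = j - i in [0,n]
   is exact. *)
Definition fV (M : 'M[K]_(k, n)) (i : int) : int :=
  i + (find (in_span_next M i) (iota 0 n.+1))%:Z.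
End Grass.

Definition ksub (k n : nat) := {A : {set 'I_n} | #|A| == k}.

(* t-th smallest element of the k-subset a *)
Definition kth (k n : nat) (a : ksub k n) (t : 'I_k) : 'I_n :=
  @enum_val _ (mem (val a)) (cast_ord (esym (eqP (valP a))) t).

Definition pleq (k n : nat) (a b : ksub k n) : bool :=
  [forall t : 'I_k, (kth a t <= kth b t)%N].

Definition nvars (k n : nat) : nat := #|{: ksub k n}|.

Definition pvar (k n : nat) (i : 'I_(nvars k n)) : ksub k n := enum_val i.

Definition pluck (K : fieldType) (k n : nat) (M : 'M[K]_(k, n)) (a : ksub k n) : K :=
  \det (\matrix_(i < k, j < k) M i (kth a j)).

Definition plvec (K : fieldType) (k n : nat) (M : 'M[K]_(k, n)) :
  'I_(nvars k n) -> K := fun i => pluck M (pvar i).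

Definition Rkn (K : fieldType) (k n : nat) := {mpoly K[nvars k n]}.

(* J_f: the vanishing ideal of Pi_f = closure of {V : f_V = f}, i.e. the
   polynomials vanishing at the Plücker vectors of all V with f_V = f
   (vanishing on a set = vanishing on its Zariski closure; every nonzero
   point of the affine cone is the Plücker vector of some representing
   matrix). *)
Definition Jf (K : fieldType) (k n : nat) (f : int -> int) (p : Rkn K k n) : Prop :=
  forall M : 'M[K]_(k, n), \rank M = k -> (forall i : int, fV M i = f i) ->
    p.@[plvec M] = 0.

(* rk is a linear extension of the Plücker poset, given as an injective
   ranking of the variables (larger rank = larger variable) *)
Definition lin_ext (k n : nat) (rk : 'I_(nvars k n) -> nat) : Prop :=
  injective rk /\ forall i j, pleq (pvar i) (pvar j) -> (rk i <= rk j)%N.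

Definition grevlex_lt (N : nat) (rk : 'I_N -> nat) (m1 m2 : 'X_{1..N}) : Prop :=
  (mdeg m1 < mdeg m2)%N \/
  (mdeg m1 = mdeg m2 /\
   exists i, (m2 i < m1 i)%N /\ forall j, (rk j < rk i)%N -> m1 j = m2 j).

Definition is_lead (K : fieldType) (N : nat) (rk : 'I_N -> nat)
    (p : {mpoly K[N]}) (m : 'X_{1..N}) : Prop :=
  m \in msupp p /\ forall m', m' \in msupp p -> m' = m \/ grevlex_lt rk m' m.

Definition initial_ideal (K : fieldType) (N : nat) (rk : 'I_N -> nat)
    (J : {mpoly K[N]} -> Prop) (q : {mpoly K[N]}) : Prop :=
  exists s : seq ({mpoly K[N]} * ({mpoly K[N]} * 'X_{1..N})),
    (forall t, t \in s -> J t.2.1 /\ is_lead rk t.2.1 t.2.2) /\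
    q = \sum_(t <- s) t.1 * 'X_[t.2.2].

Definition tab (k n d : nat) := {ffun 'I_k * 'I_d -> 'I_n}.

Definition ssyt (k n d : nat) (T : tab k n d) : bool :=
  [forall i : 'I_k, forall j : 'I_d, forall j' : 'I_d,
      (j <= j')%N ==> (T (i, j) <= T (i, j'))%N] &&
  [forall i : 'I_k, forall i' : 'I_k, forall j : 'I_d,
      (i < i')%N ==> (T (i, j) < T (i', j))%N].

Definition colset (k n d : nat) (T : tab k n d) (j : 'I_d) : {set 'I_n} :=
  [set T (i, j) | i : 'I_k].

Definition tmono (k n d : nat) (T : tab k n d) : 'X_{1..nvars k n} :=
  [multinom #|[set j : 'I_d | val (pvar i) == colset T j]| | i < nvars k n].

Definition inBf (K : fieldType) (k n d : nat) (rk : 'I_(nvars k n) -> nat)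
    (f : int -> int) (T : tab k n d) : Prop :=
  ssyt T /\ ~ initial_ideal rk (@Jf K k n f) 'X_[tmono T].

(* working grid: (row, column) -> Some entry, or None for an empty cell /
   outside the rectangle *)
Definition grid := nat -> nat -> option nat.

Definition gset (g : grid) (r c : nat) (v : option nat) : grid :=
  fun r' c' => if (r' == r) && (c' == c) then v else g r' c'.

Definition left_of (g : grid) (r c : nat) : option nat :=
  if c is c'.+1 then g r c' else None.
Definition up_of (g : grid) (r c : nat) : option nat :=
  if r is r'.+1 then g r' c else None.

Fixpoint slide (fuel : nat) (g : grid) (r c : nat) : grid :=
  match fuel with
  | 0 => g
  | fuel'.+1 =>
    match left_of g r c, up_of g r c with
    | None, None => g
    | Some b, Some u =>
        if (b <= u)%N then slide fuel' (gset (gset g r c (Some u)) r.-1 c None) r.-1 c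
        else slide fuel' (gset (gset g r c (Some b)) r c.-1 None) r c.-1
    | None, Some u => slide fuel' (gset (gset g r c (Some u)) r.-1 c None) r.-1 c
    | Some b, None => slide fuel' (gset (gset g r c (Some b)) r c.-1 None) r c.-1
    end
  end.

Definition tgrid (k n d : nat) (T : tab k n d) : grid :=
  fun r c => match @insub _ (fun x => (x < k)%N) 'I_k r,
                   @insub _ (fun x => (x < d)%N) 'I_d c with
             | Some i, Some j => Some (val (T (i, j)))
             | _, _ => None
             end.

(* the maximal label n is the value n.-1 here *)
Definition has_top (k n d : nat) (T : tab k n d) : bool :=
  [exists ij, val (T ij) == n.-1].

Definition prom (k n d : nat) (T : tab k n d) : tab k n d :=
  if ~~ has_top T then [ffun ij => insubd (T ij) (val (T ij)).+1]
  else
    let g0 := tgrid T in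
    let holes := [seq (r, c) | c <- iota 0 d,
                               r <- [seq r <- iota 0 k | g0 r c == Some n.-1]] in
    let g1 : grid := fun r c => if g0 r c == Some n.-1 then None else g0 r c in
    let g2 := foldl (fun g rc => slide (k + d) g rc.1 rc.2) g1 holes in
    [ffun ij => insubd (T ij)
       (match g2 (val ij.1) (val ij.2) with Some e => e.+1 | None => 0%N end)].

(* Main.v *)
Require Import Defs.
From HB Require Import structures.
From mathcomp Require Import all_boot all_order all_algebra all_fingroup.
From mathcomp Require Import mpoly.
From mathcomp Require Import zify ring.
From Stdlib Require Import FunctionalExtensionality.
Set Implicit Arguments. Unset Strict Implicit. Unset Printing Implicit Defensive.
Import Order.TTheory GRing.Theory Num.Theory.

(** Attach to a semistandard tableau T a cyclic rank function rho: on an ordinary interval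
    [u, v) it is the maximum, over chains u <= x_d <= ... <= x_0 = v, of the number of entries
    of the j-th column in [x_(j+1), x_j); on a cyclically wrapped interval it is obtained from
    the same statistic of the complemented columns in reverse order. Both statistics are
    invariant under jeu de taquin slides, so promotion rotates rho by one step.

    The claim is that T is standard for J_f iff rho is bounded by the rank function of f.
    If rho exceeds it on some interval, then antisymmetrising the product of the brackets of T
    over the entries counted by an optimal chain gives a polynomial vanishing on Pi_f whose
    leading monomial is T (for wrapped intervals one uses the complementary minors of the
    kernel). Conversely, if rho is bounded by the rank function of f, a sequence of exchanges
    degenerates f to a g with J_f contained in J_g whose rank function is exactly rho. Then the
    bracket of the first column of T is nonzero on Pi_g, and every bracket not above it in the
    Pluecker poset vanishes there, so the first column can be cancelled from a homogeneous
    element of J_g led by T, and one concludes by induction on the number of columns.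

    Promotion is injective on the finite set of semistandard tableaux, hence bijective. *)

(** * Chain maxima *)

(** A wrapped interval cannot be read off chains of columns, since the linear order of the labels
    breaks between the last label and the first. Matroid duality, rank(I) = k - |I^c| + dual
    rank(I^c), trades it for an ordinary interval of the complementary columns; complementation
    reverses the Pluecker order, hence the reversed list. Both readings agree on intervals touching
    either end, which makes rho cyclic.

    The descent is purely combinatorial: it works with the periodicity of rho, its values 0 and k on
    an empty and a full turn, its unit steps and its submodularity on intervals. No point with rank
    function rho has to be exhibited in advance; a point is needed only when a single column is
    left, and there the coordinate subspace of that column serves. Closure relations come from
    explicit lines M + t D: a polynomial vanishing for all but finitely many t vanishes at t = 0.
    Characteristic 0 enters there, in the splitting into homogeneous components, and in the leading
    coefficient of the antisymmetrised product, which is a number of permutations up to a nonzero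
    factor. *)

Section Cmx.
Variable A : eqType.
Implicit Types (F G : A -> nat -> nat) (s : seq A).

(* The maximum over chains u <= x_d <= ... <= x_0 = v of the sum over j of
   F a_j x_j - F a_j x_(j+1), where s = [:: a_0; ...; a_(d-1)]. *)
Fixpoint cmx F s u v : nat :=
  if s is a :: s' then \max_(w < v.+1 | u <= w) (F a v - F a w + cmx F s' u w)
  else 0.

Lemma cmx_ge F a s u v w : u <= w <= v ->
  F a v - F a w + cmx F s u w <= cmx F (a :: s) u v.
Proof.
move=> /andP[uw wv] /=.
have wv' : w < v.+1 by [].
exact: (@leq_bigmax_cond _ (fun i : 'I_v.+1 => u <= i)
  (fun i : 'I_v.+1 => F a v - F a i + cmx F s u i) (Ordinal wv') uw).
Qed.

Lemma cmx_ex F a s u v : u <= v ->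
  exists2 w, u <= w <= v & cmx F (a :: s) u v = F a v - F a w + cmx F s u w.
Proof.
move=> uv /=.
have c0 : 0 < #|[pred i : 'I_v.+1 | u <= i]|.
  by apply/card_gt0P; exists ord_max; rewrite inE.
have [i ui ->] := eq_bigmax_cond (fun i : 'I_v.+1 => F a v - F a i + cmx F s u i) c0.
by exists i => //; rewrite inE in ui; rewrite ui -ltnS ltn_ord.
Qed.

Lemma cmx_le F a s u v B :
  (forall w, u <= w <= v -> F a v - F a w + cmx F s u w <= B) ->
  cmx F (a :: s) u v <= B.
Proof.
by move=> h /=; apply/bigmax_leqP => i ui; apply: h; rewrite ui -ltnS ltn_ord.
Qed.

Lemma cmxnn F s u : cmx F s u u = 0.
Proof.
elim: s => [//|a s IH]; have [w hw ->] := cmx_ex F a s (leqnn u).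
have -> : w = u by lia.
by rewrite IH; lia.
Qed.

Lemma eq_cmx F G s u v :
  (forall a x y, a \in s -> u <= x -> x <= y -> y <= v ->
     F a y - F a x = G a y - G a x) ->
  cmx F s u v = cmx G s u v.
Proof.
elim: s v => [//|a s IH] v h.
have H w : u <= w <= v -> F a v - F a w + cmx F s u w = G a v - G a w + cmx G s u w.
  move=> /andP[uw wv]; rewrite h ?mem_head // (IH w) // => b x y bs ux xy yw.
  by apply: h => //; [rewrite inE bs orbT | exact: leq_trans yw wv].
apply/eqP; rewrite eqn_leq; apply/andP; split; apply: cmx_le => w hw.
  by rewrite H //; apply: cmx_ge.
by rewrite -H //; apply: cmx_ge.
Qed.

Definition cmono F s := forall a, a \in s -> {homo F a : x y / x <= y}.
Definition clip F s := forall a, a \in s -> forall x, F a x.+1 <= (F a x).+1.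

Lemma cmono_cons F a s : cmono F (a :: s) -> {homo F a : x y / x <= y} /\ cmono F s.
Proof.
move=> h; split; first by apply: h; rewrite mem_head.
by move=> b bs; apply: h; rewrite inE bs orbT.
Qed.

Lemma clip_cons F a s : clip F (a :: s) ->
  (forall x, F a x.+1 <= (F a x).+1) /\ clip F s.
Proof.
move=> h; split; first by apply: h; rewrite mem_head.
by move=> b bs; apply: h; rewrite inE bs orbT.
Qed.

(** Uncrossing of the optimal first cuts [w1] of [u, v') and [w2] of [u', v). If [w1 <= w2], the two
    cuts can be exchanged between the intervals at no cost; otherwise the remaining chains cross in
    the same way and the induction hypothesis applies to them. *)
Lemma cmx_submod F s u u' v v' : cmono F s -> u <= u' -> u' <= v -> v <= v' ->
  cmx F s u v' + cmx F s u' v <= cmx F s u v + cmx F s u' v'.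
Proof.
elim: s v v' => [//|a s IH] v v' /cmono_cons[ma ms] uu uv vv.
have uv' : u <= v' by lia.
have [w1 h1 ->] := cmx_ex F a s uv'.
have [w2 h2 ->] := cmx_ex F a s uv.
have [le12|lt21] := leqP w1 w2.
  have := @cmx_ge F a s u v w1; have := @cmx_ge F a s u' v' w2.
  have := ma w1 w2 le12; have : F a w2 <= F a v by apply: ma; lia.
  have : F a v <= F a v' by apply: ma.
  by lia.
have := @cmx_ge F a s u v w2; have := @cmx_ge F a s u' v' w1.
have := IH w2 w1 ms uu; lia.
Qed.

Lemma cmx_monol F s u v : cmono F s -> cmx F s u.+1 v <= cmx F s u v.
Proof.
elim: s v => [//|a s IH] v /cmono_cons[ma ms].
apply: cmx_le => w hw; have := IH w ms.
by have := @cmx_ge F a s u v w; lia.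
Qed.

Lemma cmx_monor F s u v : cmono F s -> u <= v -> cmx F s u v <= cmx F s u v.+1.
Proof.
case: s => [//|a s] /cmono_cons[ma ms] uv.
apply: cmx_le => w hw; have := @cmx_ge F a s u v.+1 w.
by have : F a v <= F a v.+1 by [apply: ma]; lia.
Qed.

Lemma cmx_lipl F s u v : cmono F s -> clip F s -> u < v ->
  cmx F s u v <= (cmx F s u.+1 v).+1.
Proof.
elim: s v => [//|a s IH] v /cmono_cons[ma ms] /clip_cons[la ls] uv.
have [|w hw ->] := cmx_ex F a s (_ : u <= v); first by lia.
have [wu|uw] := leqP w u.
  have -> : w = u by lia.
  rewrite cmxnn; have := @cmx_ge F a s u.+1 v u.+1; have := la u.
  by rewrite cmxnn; lia.
have := IH w ms ls uw; have := @cmx_ge F a s u.+1 v w; lia.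
Qed.

Lemma cmx_lipr F s u v : cmono F s -> clip F s -> u <= v ->
  cmx F s u v.+1 <= (cmx F s u v).+1.
Proof.
elim: s => [//|a s IH] /cmono_cons[ma ms] /clip_cons[la ls] uv.
have [|w hw ->] := cmx_ex F a s (_ : u <= v.+1); first by lia.
have [wv|vw] := leqP w v.
  by have := @cmx_ge F a s u v w; have := la v; lia.
have -> : w = v.+1 by lia.
by have := IH ms ls uv; have := @cmx_ge F a s u v v; lia.
Qed.

Lemma cmx_mem F a s u v : cmono F s -> a \in s -> u <= v ->
  F a v - F a u <= cmx F s u v.
Proof.
elim: s => [//|b s IH] /cmono_cons[mb ms]; rewrite inE => /orP[/eqP<-|as_] uv.
  by have := @cmx_ge F a s u v u; rewrite cmxnn; lia.
have := IH ms as_ uv; have := @cmx_ge F b s u v v; lia.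
Qed.

(** Telescoping: the ordering gives [F] of the next column at most [F] of the current one at their
    common cut, so only the two ends survive. *)
Lemma cmx_bound F a s u v : cmono F (a :: s) -> u <= v ->
  sorted (fun b c => [forall x : 'I_v.+1, F c x <= F b x]) (a :: s) ->
  cmx F (a :: s) u v <= F a v - F (last a s) u.
Proof.
have main : forall s a w, w <= v -> u <= w -> cmono F (a :: s) ->
  sorted (fun b c => [forall x : 'I_v.+1, F c x <= F b x]) (a :: s) ->
  cmx F (a :: s) u w <= F a w - F (last a s) u /\ F (last a s) u <= F a w.
  elim=> [|b s' IH] {}a w wv uw mF srt.
    have [ma _] := cmono_cons mF.
    split; last by apply: ma.
    by apply: cmx_le => x hx /=; have : F a u <= F a x by [apply: ma; lia]; lia.
  have [ma mb] := cmono_cons mF.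
  have /andP[/forallP ab {}srt] := srt.
  have ab' x : x <= v -> F b x <= F a x.
    by move=> xv; have := ab (Ordinal (xv : x < v.+1)).
  split.
    apply: cmx_le => x hx.
    have [] := IH b x _ _ mb srt; [lia|lia|].
    have := ab' x; have : F a x <= F a w by apply: ma; lia.
    rewrite /=; lia.
  have [] := IH b w wv uw mb srt.
  by have := ab' w wv; rewrite /=; lia.
by move=> mF uv srt; have [] := main s a v (leqnn v) uv mF srt.
Qed.

Lemma cmx_last F a s u v : u <= v -> F (last a s) v - F (last a s) u <= cmx F (a :: s) u v.
Proof.
elim: s a => [|b s IH] a uv.
  by have := @cmx_ge F a [::] u v u; rewrite cmxnn /=; lia.
have := IH b uv; have := @cmx_ge F a (b :: s) u v v; rewrite /=; lia.
Qed.

Lemma cmx_thresholds F s u v : u <= v ->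
  exists x : nat -> nat, [/\ x 0 = v, forall j, x j.+1 <= x j, forall j, u <= x j &
   cmx F s u v = \sum_(j < size s) (F (tnth (in_tuple s) j) (x j) - F (tnth (in_tuple s) j) (x j.+1))].
Proof.
elim: s v => [|a s IH] v uv.
  exists (fun=> v); split => //=; by rewrite big_ord0.
have [w /andP[uw wv] ->] := cmx_ex F a s uv.
have [x [x0 xd xu ->]] := IH w uw.
exists (fun j => if j is j'.+1 then x j' else v); split => //.
- by case=> [|j]; rewrite ?x0.
- by case.
rewrite big_ord_recl /= (tnth_nth a) /= x0; congr addn.
by apply: eq_bigr => j _; rewrite !(tnth_nth a).
Qed.

(** Models a horizontal slide in which the label e leaves column a for its neighbour b. The last two
    hypotheses say that below e column b gains at least as much as a, and above e at most as much.
    So the cut between the two columns may be moved next to e: to e + 1 if b is to count e, to e if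
    a is. When e lies outside the range shared by the two columns, [F] and [G] differ there by
    constants and the cut stays. *)
Lemma cmx_exch2 F G s a b e u v :
  u <= v ->
  (forall x, F a x = G a x + (e < x)) -> (forall x, G b x = F b x + (e < x)) ->
  (forall c x, c \in s -> F c x = G c x) ->
  {homo F a : x y / x <= y} -> {homo G a : x y / x <= y} ->
  {homo F b : x y / x <= y} -> {homo G b : x y / x <= y} ->
  F a e.+1 <= (F a e).+1 -> F b e.+1 <= F b e ->
  (forall w, w <= e -> F b w + F a e <= F a w + F b e) ->
  (forall w, e < w -> F b w + F a e.+1 <= F a w + F b e.+1) ->
  cmx F [:: a, b & s] u v = cmx G [:: a, b & s] u v.
Proof.
move=> uv hA hB hs mFa mGa mFb mGb l1 l2 lo hi.
have es w : cmx F s u w = cmx G s u w.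
  by apply: eq_cmx => c x y cs _ _ _; rewrite !hs.
have H z w w' : u <= z -> z <= w' <= v ->
    F a v - F a w + (F b w - F b z) <= G a v - G a w' + (G b w' - G b z) ->
    F a v - F a w + (F b w - F b z + cmx F s u z) <= cmx G [:: a, b & s] u v.
  move=> uz hw' le; have := @cmx_ge G b s u w' z; have := @cmx_ge G a (b :: s) u v w'.
  by rewrite es; lia.
have H' z w w' : u <= z -> z <= w' <= v ->
    G a v - G a w + (G b w - G b z) <= F a v - F a w' + (F b w' - F b z) ->
    G a v - G a w + (G b w - G b z + cmx G s u z) <= cmx F [:: a, b & s] u v.
  move=> uz hw' le; have := @cmx_ge F b s u w' z; have := @cmx_ge F a (b :: s) u v w'.
  by rewrite es; lia.
apply/eqP; rewrite eqn_leq; apply/andP; split; apply: cmx_le => w /andP[uw wv].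
  have [z /andP[uz zw] ->] := cmx_ex F b s uw.
  have [ze|ez] := leqP z e; last first.
    by apply: (H _ _ w) => //; [lia | have := hA v; have := hA w; have := hB w; have := hB z; lia].
  have [ve|ev] := leqP v e.
    by apply: (H _ _ w) => //; [lia | have := hA v; have := hA w; have := hB w; have := hB z; lia].
  apply: (H _ _ e.+1) => //; first by lia.
  have := hA v; have := hA e.+1; have := hA e; have := hB e.+1; have := hB e; have := hB z.
  have := mGa e.+1 v ev; have := mFb z e ze; have := mGb z e ze; have := mFb e e.+1 (leqnSn e).
  have := mFb z w zw; have := mFa w v wv; have := mGa e e.+1 (leqnSn e); have := mGb e e.+1 (leqnSn e).
  by have [we|ew] := leqP w e; [have := lo w we | have := hi w ew]; lia.
have [z /andP[uz zw] ->] := cmx_ex G b s uw.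
have [ze|ez] := leqP z e; last first.
  by apply: (H' _ _ w) => //; [lia | have := hA v; have := hA w; have := hB w; have := hB z; lia].
have [ve|ev] := leqP v e.
  by apply: (H' _ _ w) => //; [lia | have := hA v; have := hA w; have := hB w; have := hB z; lia].
apply: (H' _ _ e) => //; first by lia.
have := hA v; have := hA e.+1; have := hA e; have := hB e.+1; have := hB e; have := hB z.
have := mFb z e ze; have := mFa e v (ltnW ev); have := hA w; have := hB w.
have := mGb z w zw; have := mGa w v wv; have := mFa e e.+1 (leqnSn e); have := mFb e e.+1 (leqnSn e).
have := mGa e e.+1 (leqnSn e); have := mGb e e.+1 (leqnSn e).
by have [we|ew] := leqP w e; [have := lo w we | have := hi w ew]; lia.
Qed.

End Cmx.

(** * Jeu de taquin slides and promotion *)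

Section Slide.
Variables k n d : nat.
Implicit Types (X : nat -> nat -> nat).

(** The value 0 marks a hole, so it is excluded; for x at most n the value n of a hole still to be
    slid is not counted either. *)
Definition colc X j x : nat := \sum_(i < k) (0 < X i j < x).
Definition coldc X j x : nat := x - colc X j x.

Definition xset X r c v : nat -> nat -> nat :=
  fun i j => if (i == r) && (j == c) then v else X i j.

Definition xleft X r c : nat := if c is c'.+1 then X r c' else 0.
Definition xup X r c : nat := if r is r'.+1 then X r' c else 0.

Definition moveup X r c := xset (xset X r c (xup X r c)) r.-1 c 0.
Definition moveleft X r c := xset (xset X r c (xleft X r c)) r c.-1 0.

(** A neighbour off the grid and an empty neighbour both read as 0, while labels are positive. Once
    the case of two zeros is set apart, the single comparison therefore covers all remaining cases
    of [slide]. *)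
Fixpoint xslide fuel X r c : nat -> nat -> nat :=
  if fuel is fuel'.+1 then
    if (xleft X r c == 0) && (xup X r c == 0) then X
    else if xleft X r c <= xup X r c then xslide fuel' (moveup X r c) r.-1 c
    else xslide fuel' (moveleft X r c) r c.-1
  else X.

Definition toG X : grid := fun r c =>
  if [&& r < k, c < d, 0 < X r c & X r c < n] then Some (X r c).-1 else None.

Definition hol (r c i j : nat) : bool := (i == r) && (j == c).

(* The hole at (r, c) carries the junk value 0; the cells (0, 0) .. (0, j - 1) hold
   the holes already slid, and the value n at (k - 1, c') with c' > c0 marks the
   holes still to be slid. *)
Record vconf X r c j c0 : Prop := Vconf {
  vc_r : r < k; vc_c : c < d; vc_c0 : c <= c0;
  vc_hole : X r c = 0;
  vc_out : ~~ ((r == 0) && (c < j));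
  vc_row : forall i c1 c2, i < k -> c1 <= c2 -> c2 < d ->
    ~~ hol r c i c1 -> ~~ hol r c i c2 -> X i c1 <= X i c2;
  vc_col : forall i1 i2 c1, i1 < i2 -> i2 < k -> c1 < d ->
    ~~ hol r c i1 c1 -> ~~ hol r c i2 c1 -> X i1 c1 < X i2 c1;
  vc_zero : forall i c1, i < k -> c1 < d -> ~~ hol r c i c1 ->
    (X i c1 == 0) = (i == 0) && (c1 < j);
  vc_top : forall i c1, i < k -> c1 < d -> ~~ hol r c i c1 ->
    X i c1 <= n /\ (X i c1 == n) = (i == k.-1) && (c0 < c1)
}.

Record vstate X j c0 : Prop := Vstate {
  vs_row : forall i c1 c2, i < k -> c1 <= c2 -> c2 < d -> X i c1 <= X i c2;
  vs_col : forall i1 i2 c1, i1 < i2 -> i2 < k -> c1 < d -> X i1 c1 < X i2 c1;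
  vs_zero : forall i c1, i < k -> c1 < d -> (X i c1 == 0) = (i == 0) && (c1 < j);
  vs_top : forall i c1, i < k -> c1 < d ->
    X i c1 <= n /\ (X i c1 == n) = (i == k.-1) && (c0 <= c1)
}.

Lemma xsetE X r c v i j : xset X r c v i j = if hol r c i j then v else X i j.
Proof. by []. Qed.

Lemma colc_xset X r c v j x : r < k ->
  colc (xset X r c v) j x + (j == c) * (0 < X r c < x) =
  colc X j x + (j == c) * (0 < v < x).
Proof.
move=> rk; rewrite /colc (bigD1 (Ordinal rk)) //= [in RHS](bigD1 (Ordinal rk)) //=.
rewrite xsetE /hol eqxx /=.
rewrite (eq_bigr (fun i : 'I_k => (0 < X i j < x : nat))); last first.
  by move=> i ir; rewrite xsetE /hol -[i == r :> nat]/(i == Ordinal rk) (negPf ir).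
by case: eqP => [->|_]; lia.
Qed.

Lemma colc_mono X j : {homo colc X j : x y / x <= y}.
Proof. by move=> x y xy; apply: leq_sum => i _; lia. Qed.

Lemma colc_lip X j x :
  (forall i1 i2, i1 < i2 -> i2 < k -> 0 < X i1 j -> 0 < X i2 j -> X i1 j != X i2 j) ->
  colc X j x.+1 <= (colc X j x).+1.
Proof.
move=> inj.
have -> : colc X j x.+1 = colc X j x + \sum_(i < k) ((0 < X i j) && (X i j == x)).
  rewrite /colc -big_split; apply: eq_bigr => i _ /=; lia.
rewrite -[X in _ <= X]addn1 leq_add2l.
case: (boolP [exists i : 'I_k, (0 < X i j) && (X i j == x)]); last first.
  rewrite negb_exists => /forallP h; rewrite big1 // => i _.
  by rewrite (negPf (h i)).
move=> /existsP[i hi]; rewrite (bigD1 i) //= hi big1 // => i' ii'.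
case: (ltngtP i i') => [lt|lt|e]; last by move/ord_inj: e ii' => ->; rewrite eqxx.
  by have := inj i i' lt (ltn_ord i'); lia.
by have := inj i' i lt (ltn_ord i); lia.
Qed.

Lemma vconf_lip X r c j c0 c1 x : vconf X r c j c0 -> c1 < d ->
  colc X c1 x.+1 <= (colc X c1 x).+1.
Proof.
move=> V c1d; apply: colc_lip => i1 i2 lt i2k p1 p2.
suff : X i1 c1 < X i2 c1 by lia.
by apply: (vc_col V) => //; apply/negP => /andP[/eqP e1 /eqP e2]; move: p1 p2;
   rewrite e1 e2 (vc_hole V).
Qed.

Lemma colc_le X j x : (forall x, colc X j x.+1 <= (colc X j x).+1) -> colc X j x <= x.
Proof.
move=> h; elim: x => [|x IH]; last by have := h x; lia.
by rewrite /colc big1 // => i _; lia.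
Qed.

Lemma coldc_mono X j : (forall x, colc X j x.+1 <= (colc X j x).+1) ->
  {homo coldc X j : x y / x <= y}.
Proof.
move=> h x y xy; rewrite -(subnK xy) addnC; elim: (y - x) => [|m IH]; first by rewrite addn0.
rewrite addnS; apply: leq_trans IH _; rewrite /coldc.
by have := h (x + m); lia.
Qed.

Lemma cmx_cat (A : eqType) (F G : A -> nat -> nat) s0 s u v :
  (forall a x, a \in s0 -> F a x = G a x) ->
  (forall w, u <= w -> cmx F s u w = cmx G s u w) -> u <= v ->
  cmx F (s0 ++ s) u v = cmx G (s0 ++ s) u v.
Proof.
elim: s0 v => [|a s0 IH] v h0 h uv; first exact: h.
have H w : u <= w -> cmx F (s0 ++ s) u w = cmx G (s0 ++ s) u w.
  by move=> uw; apply: IH => // b x bs; apply: h0; rewrite inE bs orbT.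
rewrite !cat_cons; apply/eqP; rewrite eqn_leq; apply/andP; split; apply: cmx_le => w /andP[uw wv].
  by rewrite !h0 ?mem_head // H //; apply: cmx_ge; rewrite uw.
by rewrite -!h0 ?mem_head // -H //; apply: cmx_ge; rewrite uw.
Qed.

Section LeftStep.
Variables (X : nat -> nat -> nat) (r c j c0 : nat).
Hypothesis V : vconf X r c.+1 j c0.
Hypothesis lt_ub : xup X r c.+1 < X r c.
Let Y := moveleft X r c.+1.
Let e := X r c.

Let cd : c < d. Proof. by have := vc_c V; lia. Qed.

Let YE i j' : Y i j' = if hol r c i j' then 0 else if hol r c.+1 i j' then e else X i j'.
Proof. by []. Qed.

Let colY j' x : colc Y j' x + (j' == c) * (e < x) = colc X j' x + (j' == c.+1) * (e < x).
Proof.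
have rk := vc_r V.
have := colc_xset (xset X r c.+1 e) c 0 j' x rk.
have := colc_xset X c.+1 e j' x rk.
have -> : colc (xset (xset X r c.+1 e) r c 0) j' x = colc Y j' x by [].
rewrite xsetE /hol (vc_hole V) eqxx -/e.
have -> : (c == c.+1) = false by lia.
by move: lt_ub; rewrite -/e /=; case: eqP => ?; case: eqP => ?; lia.
Qed.

(** Above the hole both columns hold labels below e, beneath it labels above e. The preference of
    the slide for the larger neighbour, [lt_ub], is what bounds column c + 1 above the hole.
    Counting row by row then yields the hypotheses of [cmx_exch2]. *)
Let rowfacts i : i < k ->
  [/\ i < r -> [/\ X i c <= X i c.+1, X i c < e & X i c.+1 < e] &
      r < i -> X i c <= X i c.+1 /\ e < X i c].
Proof.
move=> ik; have rk := vc_r V; have cd' := vc_c V; split=> lt.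
  have H1 : X i c <= X i c.+1 by apply: (vc_row V) => //; rewrite /hol; lia.
  have H2 : X i c < e by apply: (vc_col V) => //; rewrite /hol; lia.
  split=> //; move: lt_ub; rewrite -/e; case: r lt rk V => [//|r'] lt rk V' /= ub.
  apply: leq_ltn_trans ub; case: (ltngtP i r') => [lt'|lt'|->//]; last by lia.
  by apply: ltnW; apply: (vc_col V') => //; rewrite /hol; lia.
split; first by apply: (vc_row V) => //; rewrite /hol; lia.
by apply: (vc_col V) => //; rewrite /hol; lia.
Qed.

Let e0 : 0 < e. Proof. by move: lt_ub; rewrite -/e; lia. Qed.

Let lo w : w <= e -> colc X c.+1 w + colc X c e <= colc X c w + colc X c.+1 e.
Proof.
move=> we; rewrite /colc -!big_split; apply: leq_sum => i _ /=.
have [h1 h2] := rowfacts (ltn_ord i).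
case: (ltngtP i r) => [lt|lt|ir].
- by have [] := h1 lt; lia.
- by have [] := h2 lt; lia.
- by rewrite ir (vc_hole V) -/e; lia.
Qed.

Let hi w : e < w -> colc X c.+1 w + colc X c e.+1 <= colc X c w + colc X c.+1 e.+1.
Proof.
move=> we; rewrite /colc -!big_split; apply: leq_sum => i _ /=.
have [h1 h2] := rowfacts (ltn_ord i).
case: (ltngtP i r) => [lt|lt|ir].
- by have [] := h1 lt; lia.
- by have [] := h2 lt; lia.
- by rewrite ir (vc_hole V) -/e; lia.
Qed.

Let flat : colc X c.+1 e.+1 <= colc X c.+1 e.
Proof.
rewrite /colc; apply: leq_sum => i _ /=.
have [h1 h2] := rowfacts (ltn_ord i).
case: (ltngtP i r) => [lt|lt|ir].
- by have [] := h1 lt; lia.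
- by have [] := h2 lt; lia.
- by rewrite ir (vc_hole V) -/e; lia.
Qed.

Lemma moveleft_vconf : vconf Y r c j c0.
Proof.
have rk := vc_r V; have cd' := vc_c V; have c0' := vc_c0 V.
have hr : hol r c.+1 r c = false by rewrite /hol; lia.
have ez : (e == 0) = (r == 0) && (c < j) by apply: (vc_zero V) => //; rewrite hr.
have [et1 et2] : e <= n /\ (e == n) = (r == k.-1) && (c0 < c).
  by apply: (vc_top V) => //; rewrite hr.
constructor => //.
- by lia.
- by rewrite YE /hol !eqxx.
- by have := e0; lia.
- move=> i c1 c2 ik le12 c2d h1 h2; rewrite !YE (negPf h1) (negPf h2).
  case: (boolP (hol r c.+1 i c1)) => g1; case: (boolP (hol r c.+1 i c2)) => g2 //.
  + have -> : i = r by move: g1; rewrite /hol; lia.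
    apply: (vc_row V) => //; rewrite ?hr //; first by move: g1; rewrite /hol; lia.
    by move: g1 h2 g2; rewrite /hol; lia.
  + have -> : i = r by move: g2; rewrite /hol; lia.
    apply: (vc_row V) => //; rewrite ?hr //; last by move: g1 g2 h1; rewrite /hol; lia.
    by move: g2 h1 g1; rewrite /hol; lia.
  + by apply: (vc_row V).
- move=> i1 i2 c1 lt12 i2k c1d h1 h2; rewrite !YE (negPf h1) (negPf h2).
  case: (boolP (hol r c.+1 i1 c1)) => g1; case: (boolP (hol r c.+1 i2 c1)) => g2 //.
  + by move: g1 g2; rewrite /hol; lia.
  + have [_ /(_ _)[]] := rowfacts i2k; first by move: g1; rewrite /hol; lia.
    have -> : c1 = c.+1 by move: g1; rewrite /hol; lia.
    by lia.
  + have [/(_ _)[]] := @rowfacts i1 (ltn_trans lt12 i2k); first by move: g2; rewrite /hol; lia.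
    by have -> : c1 = c.+1 by move: g2; rewrite /hol; lia.
  + by apply: (vc_col V).
- move=> i c1 ik c1d h1; rewrite !YE (negPf h1).
  case: (boolP (hol r c.+1 i c1)) => g1; last by apply: (vc_zero V).
  have := vc_out V; move: g1; rewrite /hol => /andP[/eqP-> /eqP->].
  by have := e0; lia.
- move=> i c1 ik c1d h1; rewrite !YE (negPf h1).
  case: (boolP (hol r c.+1 i c1)) => g1; last by apply: (vc_top V).
  by move: g1; rewrite /hol => /andP[/eqP-> /eqP->]; split=> //; lia.
Qed.

Let iotaE : iota 0 d = iota 0 c ++ [:: c, c.+1 & iota c.+2 (d - c.+2)].
Proof.
have cd' := vc_c V.
have {1}-> : d = c + (2 + (d - c.+2)) by lia.
by rewrite iotaD iotaD /= !add0n addn2.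
Qed.

(** Column c hands e to column c + 1. Among the complements e travels the other way, and the
    reversed list puts c + 1 before c, so the same exchange lemma settles both statistics. *)
Lemma moveleft_cmx u v : u <= v ->
  cmx (colc X) (iota 0 d) u v = cmx (colc Y) (iota 0 d) u v /\
  cmx (coldc X) (rev (iota 0 d)) u v = cmx (coldc Y) (rev (iota 0 d)) u v.
Proof.
move=> uv; have cd' := vc_c V.
have lipX c1 x : c1 < d -> colc X c1 x.+1 <= (colc X c1 x).+1 by apply: (vconf_lip x V).
have lipY c1 x : c1 < d -> colc Y c1 x.+1 <= (colc Y c1 x).+1 by apply: (vconf_lip x moveleft_vconf).
have leX c1 x : c1 < d -> colc X c1 x <= x by move=> h; apply: colc_le => y; apply: lipX.
have leY c1 x : c1 < d -> colc Y c1 x <= x by move=> h; apply: colc_le => y; apply: lipY.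
have same c1 x : c1 != c -> c1 != c.+1 -> colc X c1 x = colc Y c1 x.
  by move=> h1 h2; have := colY c1 x; rewrite (negPf h1) (negPf h2); lia.
have c1E x : colc X c x = colc Y c x + (e < x).
  by have := colY c x; rewrite eqxx (ltn_eqF (ltnSn c)); lia.
have c2E x : colc Y c.+1 x = colc X c.+1 x + (e < x).
  by have := colY c.+1 x; rewrite eqxx (gtn_eqF (ltnSn c)); lia.
rewrite iotaE; split.
  apply: cmx_cat => // [b x|w uw].
    by rewrite mem_iota => hb; apply: same; lia.
  apply: (@cmx_exch2 _ _ _ _ _ _ e) => //; try exact: colc_mono.
  + by move=> b x; rewrite mem_iota => hb; apply: same; lia.
  + exact: lipX.
rewrite rev_cat !rev_cons -!cats1 -!catA /=.
apply: cmx_cat => // [b x|w uw].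
  by rewrite mem_rev mem_iota => hb; rewrite /coldc same; lia.
apply: (@cmx_exch2 _ _ _ _ _ _ e) => //; rewrite /coldc.
+ by move=> x; rewrite c2E; have := leY c.+1 x cd'; rewrite c2E; lia.
+ by move=> x; rewrite c1E; have := leX c x cd; rewrite c1E; lia.
+ by move=> b x; rewrite mem_rev mem_iota => hb; rewrite same; lia.
+ by apply: coldc_mono => x; apply: lipX.
+ by apply: coldc_mono => x; apply: lipY.
+ by apply: coldc_mono => x; apply: lipX.
+ by apply: coldc_mono => x; apply: lipY.
+ by have := flat; have := colc_mono X c.+1 (leqnSn e); lia.
+ by have := c1E e; have := c1E e.+1; have := colc_mono Y c (leqnSn e); have := leX c e.+1 cd; lia.
+ move=> w' h; have := lo h; have := leX c w' cd; have := leX c e cd.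
  by have := leX c.+1 w' cd'; have := leX c.+1 e cd'; lia.
+ move=> w' h; have := hi h; have := leX c w' cd; have := leX c e.+1 cd.
  by have := leX c.+1 w' cd'; have := leX c.+1 e.+1 cd'; lia.
Qed.
End LeftStep.

End Slide.

Section Slide2.
Variables k n d : nat.
Hypothesis n0 : 0 < n.
Implicit Types (X Y : nat -> nat -> nat).
Local Notation vconf := (@vconf k n d).
Local Notation vstate := (@vstate k n d).
Local Notation toG := (toG k n d).

Section UpStep.
Variables (X : nat -> nat -> nat) (r c j c0 : nat).
Hypothesis V : vconf X r.+1 c j c0.
Hypothesis le_bu : xleft X r.+1 c <= X r c.
Hypothesis u0 : 0 < X r c.
Let Y := moveup X r.+1 c.
Let e := X r c.

Let rk : r < k. Proof. by have := vc_r V; lia. Qed.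

Let YE i j' : Y i j' = if hol r c i j' then 0 else if hol r.+1 c i j' then e else X i j'.
Proof. by []. Qed.

Lemma moveup_colc j' x : colc k Y j' x = colc k X j' x.
Proof.
have := colc_xset (xset X r.+1 c e) c 0 j' x rk.
have := colc_xset X c e j' x (vc_r V).
have -> : colc k (xset (xset X r.+1 c e) r c 0) j' x = colc k Y j' x by [].
rewrite xsetE /hol (vc_hole V) (ltn_eqF (ltnSn r)) -/e.
by move: u0; rewrite -/e /=; case: eqP => ?; lia.
Qed.

Let hr : hol r.+1 c r c = false. Proof. by rewrite /hol; lia. Qed.

Lemma moveup_vconf : vconf Y r c j c0.
Proof.
have rk' := vc_r V; have cd' := vc_c V; have c0' := vc_c0 V.
have ez : (e == 0) = (r == 0) && (c < j) by apply: (vc_zero V) => //; rewrite hr.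
have [et1 et2] : e <= n /\ (e == n) = (r == k.-1) && (c0 < c).
  by apply: (vc_top V) => //; rewrite hr.
constructor => //.
- by rewrite YE /hol !eqxx.
- by have := u0; rewrite -/e; lia.
- move=> i c1 c2 ik le12 c2d h1 h2; rewrite !YE (negPf h1) (negPf h2).
  case: (boolP (hol r.+1 c i c1)) => g1; case: (boolP (hol r.+1 c i c2)) => g2 //.
  + have [ei ec] : i = r.+1 /\ c1 = c by move: g1; rewrite /hol; lia.
    subst i c1; have lt2 : c < c2 by move: g2; rewrite /hol; lia.
    have H1 : X r c <= X r c2 by apply: (vc_row V) => //; rewrite /hol; lia.
    have H2 : X r c2 < X r.+1 c2 by apply: (vc_col V) => //; rewrite /hol; lia.
    by rewrite /e; lia.
  + have [ei ec] : i = r.+1 /\ c2 = c by move: g2; rewrite /hol; lia.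
    subst i c2; have lt2 : c1 < c by move: g1; rewrite /hol; lia.
    apply: leq_trans le_bu; case: c lt2 V g1 g2 {h1 h2 le12 c2d} => [//|c'] lt2 V' g1 g2 /=.
    by apply: (vc_row V') => //; [have := vc_c V'; lia | rewrite /hol; lia].
  + by apply: (vc_row V).
- move=> i1 i2 c1 lt12 i2k c1d h1 h2; rewrite !YE (negPf h1) (negPf h2).
  case: (boolP (hol r.+1 c i1 c1)) => g1; case: (boolP (hol r.+1 c i2 c1)) => g2 //.
  + by move: g1 g2; rewrite /hol; lia.
  + have [ei ec] : i1 = r.+1 /\ c1 = c by move: g1; rewrite /hol; lia.
    subst i1 c1; apply: (vc_col V) => //; rewrite ?hr //; by lia.
  + have [ei ec] : i2 = r.+1 /\ c1 = c by move: g2; rewrite /hol; lia.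
    subst i2 c1; apply: (vc_col V) => //; first by move: h1; rewrite /hol; lia.
    by rewrite hr.
  + by apply: (vc_col V).
- move=> i c1 ik c1d h1; rewrite !YE (negPf h1).
  case: (boolP (hol r.+1 c i c1)) => g1; last by apply: (vc_zero V).
  have := vc_out V; move: g1; rewrite /hol => /andP[/eqP-> /eqP->].
  by have := u0; rewrite -/e; lia.
- move=> i c1 ik c1d h1; rewrite !YE (negPf h1).
  case: (boolP (hol r.+1 c i c1)) => g1; last by apply: (vc_top V).
  by move: g1; rewrite /hol => /andP[/eqP-> /eqP->]; split=> //; lia.
Qed.
End UpStep.

(* If a hole came to rest below a slid hole, its column would keep only k - 2
   entries, against the invariance of the complementary statistic. *)
Definition unstuck X := cmx (coldc k X) (rev (iota 0 d)) 1 n <= n - k.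

Lemma unstuckP X r c j c0 : vconf X r.+1 c j c0 -> k <= n -> unstuck X -> X r c != 0.
Proof.
move=> V kn us; apply/negP => /eqP z.
have rk := vc_r V; have cd := vc_c V.
have mono : cmono (coldc k X) (rev (iota 0 d)).
  move=> a; rewrite mem_rev mem_iota => ad; apply: coldc_mono => x.
  by apply: (vconf_lip x V); lia.
have := @cmx_mem _ (coldc k X) c (rev (iota 0 d)) 1 n mono.
rewrite mem_rev mem_iota => /(_ _ n0) H.
have {H}H : coldc k X c n - coldc k X c 1 <= n - k by apply: leq_trans us; apply: H; lia.
have H1 : colc k X c 1 = 0 by rewrite /colc big1 // => i _; lia.
have rk' : r < k by lia.
(* Neither the hole nor the zero above it is counted, so [coldc] grows by at least n - (k - 2) - 1,
   more than n - k, between 1 and n. *)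
have H2 : (colc k X c n).+2 <= k.
  rewrite /colc (bigD1 (Ordinal rk)) //= (bigD1 (Ordinal rk')) /=; last first.
    by rewrite -val_eqE /=; lia.
  rewrite (vc_hole V) z /= !add0n.
  rewrite -[X in _ <= X]card_ord -sum1_card [X in _ <= X](bigD1 (Ordinal rk)) //=.
  rewrite [X in _ <= X + _]/=  [X in _ <= _ + X](bigD1 (Ordinal rk')) /=; last first.
    by rewrite -val_eqE /=; lia.
  by rewrite !add1n !ltnS; apply: leq_sum => i _; case: (_ && _).
by move: H; rewrite /coldc H1; lia.
Qed.

Lemma slide_toG fuel X r c j c0 : vconf X r c j c0 ->
  slide fuel.+1 (toG X) r c =
    if (xleft X r c == 0) && (xup X r c == 0) then toG X
    else if xleft X r c <= xup X r c then slide fuel (toG (moveup X r c)) r.-1 c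
    else slide fuel (toG (moveleft X r c)) r c.-1.
Proof.
move=> V; have rk := vc_r V; have cd := vc_c V; have c0c := vc_c0 V.
have L : left_of (toG X) r c = if xleft X r c == 0 then None else Some (xleft X r c).-1.
  case: c V cd c0c => [//|c] V cd c0c /=; rewrite /toG.
  have [h1 h2] : X r c <= n /\ (X r c == n) = (r == k.-1) && (c0 < c).
    by apply: (vc_top V) => //; rewrite /hol; lia.
  by case: eqP => [->|h]; [rewrite ltnn !andbF | have -> : [&& r < k, c < d, 0 < X r c & X r c < n] by lia].
have U : up_of (toG X) r c = if xup X r c == 0 then None else Some (xup X r c).-1.
  case: r V rk {L} => [//|r] V rk /=; rewrite /toG.
  have [h1 h2] : X r c <= n /\ (X r c == n) = (r == k.-1) && (c0 < c).
    by apply: (vc_top V) => //; rewrite /hol; lia.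
  by case: eqP => [->|h]; [rewrite ltnn !andbF | have -> : [&& r < k, c < d, 0 < X r c & X r c < n] by lia].
have XL : xleft X r c != 0 ->
  gset (gset (toG X) r c (Some (xleft X r c).-1)) r c.-1 None = toG (moveleft X r c).
  case: c V cd c0c L U => [//|c] V cd c0c L U /= x0.
  have [h1 h2] : X r c <= n /\ (X r c == n) = (r == k.-1) && (c0 < c).
    by apply: (vc_top V) => //; rewrite /hol; lia.
  apply: functional_extensionality => i; apply: functional_extensionality => i'.
  rewrite /gset /toG /moveleft /= !xsetE /hol.
  case: ifP => [/andP[/eqP-> /eqP->]|_]; first by rewrite ltnn !andbF.
  by case: ifP => [/andP[/eqP-> /eqP->]|_ //]; have -> : [&& r < k, c.+1 < d, 0 < X r c & X r c < n] by lia.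
have XU : xup X r c != 0 ->
  gset (gset (toG X) r c (Some (xup X r c).-1)) r.-1 c None = toG (moveup X r c).
  case: r V rk L U {XL} => [//|r] V rk L U /= x0.
  have [h1 h2] : X r c <= n /\ (X r c == n) = (r == k.-1) && (c0 < c).
    by apply: (vc_top V) => //; rewrite /hol; lia.
  apply: functional_extensionality => i; apply: functional_extensionality => i'.
  rewrite /gset /toG /moveup /= !xsetE /hol.
  case: ifP => [/andP[/eqP-> /eqP->]|_]; first by rewrite ltnn !andbF.
  by case: ifP => [/andP[/eqP-> /eqP->]|_ //]; have -> : [&& r.+1 < k, c < d, 0 < X r c & X r c < n] by lia.
rewrite /= L U; case: (eqVneq (xleft X r c) 0) => [eL|nL]; case: (eqVneq (xup X r c) 0) => [eU|nU] //=.
- by rewrite eL /= XU.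
- by rewrite XL // eU leqNgt lt0n nL.
rewrite XL // XU //; congr (if _ then _ else _); lia.
Qed.

Definition same_cmx X Y := forall u v, u <= v ->
  cmx (colc k X) (iota 0 d) u v = cmx (colc k Y) (iota 0 d) u v /\
  cmx (coldc k X) (rev (iota 0 d)) u v = cmx (coldc k Y) (rev (iota 0 d)) u v.

Lemma same_cmx_trans X Y Z : same_cmx X Y -> same_cmx Y Z -> same_cmx X Z.
Proof. by move=> h1 h2 u v uv; have [-> ->] := h1 u v uv; exact: h2. Qed.

Variant xstep_spec X r c j c0 : (nat -> nat -> nat) -> nat -> nat -> Prop :=
| XUp r' of r = r'.+1 & xleft X r c <= X r' c & 0 < X r' c &
   vconf (moveup X r c) r' c j c0 & same_cmx X (moveup X r c) :
   xstep_spec X r c j c0 (moveup X r c) r' c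
| XLeft c' of c = c'.+1 & xup X r c < X r c' &
   vconf (moveleft X r c) r c' j c0 & same_cmx X (moveleft X r c) :
   xstep_spec X r c j c0 (moveleft X r c) r c'.

Definition xstopped X r c := (xleft X r c == 0) && (xup X r c == 0).
Definition xstepX X r c := if xleft X r c <= xup X r c then moveup X r c else moveleft X r c.
Definition xstepr X r c := if xleft X r c <= xup X r c then r.-1 else r.
Definition xstepc X r c := if xleft X r c <= xup X r c then c else c.-1.

Lemma xstepP X r c j c0 : vconf X r c j c0 -> ~~ xstopped X r c ->
  xstep_spec X r c j c0 (xstepX X r c) (xstepr X r c) (xstepc X r c).
Proof.
move=> V; rewrite /xstopped /xstepX /xstepr /xstepc negb_and => ns.
case: leqP => h.
  case: r V ns h => [|r] V ns h; first by move: ns h; rewrite /= orbF; lia.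
  have u0 : 0 < X r c by move: ns h; rewrite /=; lia.
  apply: XUp => //; first exact: (moveup_vconf V h u0).
  move=> u v uv; rewrite /coldc.
  by split; apply: eq_cmx => a x y _ _ _ _; rewrite !(moveup_colc V h u0).
case: c V ns h => [//|c] V ns h.
by apply: XLeft => //; [exact: (moveleft_vconf V h) | exact: (moveleft_cmx V h)].
Qed.

Lemma xslideS fuel X r c : xslide fuel.+1 X r c =
  if xstopped X r c then X
  else xslide fuel (xstepX X r c) (xstepr X r c) (xstepc X r c).
Proof.
by rewrite /= /xstopped /xstepX /xstepr /xstepc; case: ifP => // _; case: ifP.
Qed.

Lemma stopped_pos X r c j c0 : k <= n -> vconf X r c j c0 -> unstuck X ->
  xstopped X r c -> r = 0 /\ c = j.
Proof.
move=> kn V us /andP[/eqP l0 /eqP u0].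
case: r V l0 u0 => [|r] V l0 u0; last first.
  by have := unstuckP V kn us; rewrite -[X r c]/(xup X r.+1 c) u0.
split=> //; have := vc_out V; have k0 := vc_r V; have cd := vc_c V.
case: c V l0 u0 cd => [|c] V l0 u0 cd /=; first by lia.
have : (X 0 c == 0) = (0 == 0) && (c < j).
  by apply: (vc_zero V) => //; [lia | rewrite /hol; lia].
by move: l0 => /= ->; rewrite /=; lia.
Qed.

Lemma xslideP fuel X r c j c0 : k <= n -> r + c <= fuel -> vconf X r c j c0 -> unstuck X ->
  [/\ vconf (xslide fuel X r c) 0 j j c0, same_cmx X (xslide fuel X r c),
      slide fuel (toG X) r c = toG (xslide fuel X r c) & j <= r + c].
Proof.
move=> kn; elim: fuel X r c => [|fuel IH] X r c le V us.
  have [r0 c0'] : r = 0 /\ c = 0 by lia.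
  subst r c; have st : xstopped X 0 0 by [].
  by have [_ j0] := stopped_pos kn V us st; move: V; rewrite -j0 => V; split.
rewrite xslideS (slide_toG _ V) -/(xstopped X r c).
case: (boolP (xstopped X r c)) => st.
  by have [r0 c0'] := stopped_pos kn V us st; subst r c; split=> //; rewrite addnC addn0.
have S := xstepP V st.
have -> : (if xleft X r c <= xup X r c then slide fuel (toG (moveup X r c)) r.-1 c
  else slide fuel (toG (moveleft X r c)) r c.-1) =
  slide fuel (toG (xstepX X r c)) (xstepr X r c) (xstepc X r c).
  by rewrite /xstepX /xstepr /xstepc; case: leqP.
case: S => [r' er lu p VU sU|c' ec lt VL sL].
  have us' : unstuck (moveup X r c) by have [_ e] := sU 1 n n0; rewrite /unstuck -e.
  have [|v1 s1 -> jl] := IH _ _ _ _ VU us'; first by lia.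
  by split=> //; [exact: same_cmx_trans s1 | lia].
have us' : unstuck (moveleft X r c) by have [_ e] := sL 1 n n0; rewrite /unstuck -e.
have [|v1 s1 -> jl] := IH _ _ _ _ VL us'; first by lia.
by split=> //; [exact: same_cmx_trans s1 | lia].
Qed.

Definition eqX X Y := forall i c, i < k -> c < d -> X i c = Y i c.

Lemma xstep_inv X r c j c0 Y r' c' : xstep_spec X r c j c0 Y r' c' ->
  [/\ r = r'.+1, c = c' & Y = moveup X r c] \/ [/\ r = r', c = c'.+1 & Y = moveleft X r c].
Proof. by case; [left | right]. Qed.

(** A step can be undone because the result tells where the hole came from: if from below, the cell
    under the hole is at most the cell to its right; if from the right, it is strictly larger. The
    local claim [neq] is this contradiction. *)
Lemma xstep_inj X1 r1 c1 X2 r2 c2 Y1 Y2 r c j c0 : vconf X1 r1 c1 j c0 -> vconf X2 r2 c2 j c0 ->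
  xstep_spec X1 r1 c1 j c0 Y1 r c -> xstep_spec X2 r2 c2 j c0 Y2 r c -> eqX Y1 Y2 ->
  [/\ r1 = r2, c1 = c2 & eqX X1 X2].
Proof.
have neq : forall X1 r1 c1 X2 r2 c2 j c0 r c, vconf X1 r1 c1 j c0 -> vconf X2 r2 c2 j c0 ->
   r1 = r.+1 -> c1 = c -> r2 = r -> c2 = c.+1 ->
   eqX (moveup X1 r1 c1) (moveleft X2 r2 c2) -> False.
  move=> {}X1 {}r1 {}c1 {}X2 {}r2 {}c2 {}j {}c0 {}r {}c V1 V2 e1 e2 e3 e4 eq; subst r1 c1 r2 c2.
  have rk := vc_r V1; have cd := vc_c V2.
  have := eq r.+1 c rk (vc_c V1); have := eq r c.+1 (vc_r V2) cd.
  rewrite /moveup /moveleft !xsetE /hol /= !eqxx /=.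
  rewrite (gtn_eqF (ltnSn c)) (gtn_eqF (ltnSn r)) (ltn_eqF (ltnSn r)) /=.
  have H1 : X1 r c <= X1 r c.+1.
    by apply: (vc_row V1) => //; [exact: (vc_r V2) | rewrite /hol; lia | rewrite /hol; lia].
  have H2 : X2 r c < X2 r.+1 c.
    by apply: (vc_col V2) => //; [exact: (vc_c V1) | rewrite /hol; lia | rewrite /hol; lia].
  by lia.
move=> V1 V2 /xstep_inv S1 /xstep_inv S2.
case: S1 => -[e1 f1 g1]; case: S2 => -[e2 f2 g2] eq; subst Y1 Y2.
- subst r1 r2 c1 c2; split=> // i c' ik cd.
  have := eq i c' ik cd; have := eq r.+1 c (vc_r V1) (vc_c V1).
  rewrite /moveup !xsetE /hol /= eqxx (gtn_eqF (ltnSn r)) /= eqxx => E.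
  case: (boolP ((i == r) && (c' == c))) => [/andP[/eqP-> /eqP->] //|_].
  case: (boolP ((i == r.+1) && (c' == c))) => [/andP[/eqP-> /eqP->] _|//].
  by rewrite (vc_hole V1) (vc_hole V2).
- by case: (neq _ _ _ _ _ _ _ _ _ _ V1 V2 e1 f1 e2 f2 eq).
- have eq' : eqX (moveup X2 r2 c2) (moveleft X1 r1 c1) by move=> i c' ik cd; rewrite eq.
  by case: (neq _ _ _ _ _ _ _ _ _ _ V2 V1 e2 f2 e1 f1 eq').
- subst r1 r2 c1 c2; split=> // i c' ik cd.
  have := eq i c' ik cd; have := eq r c.+1 (vc_r V1) (vc_c V1).
  rewrite /moveleft !xsetE /hol /= eqxx (gtn_eqF (ltnSn c)) /= eqxx => E.
  case: (boolP ((i == r) && (c' == c))) => [/andP[/eqP-> /eqP->] //|_].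
  case: (boolP ((i == r) && (c' == c.+1))) => [/andP[/eqP-> /eqP->] _|//].
  by rewrite (vc_hole V1) (vc_hole V2).
Qed.

(** Each step lowers r + c by one and a slide halts only at (0, j). Two slides from the same
    antidiagonal thus take equally many steps and are reversed in lockstep. *)
Lemma xslide_inj fuel X1 r1 c1 X2 r2 c2 j c0 : k <= n -> r1 + c1 <= fuel ->
  vconf X1 r1 c1 j c0 -> unstuck X1 -> vconf X2 r2 c2 j c0 -> unstuck X2 ->
  r1 + c1 = r2 + c2 -> eqX (xslide fuel X1 r1 c1) (xslide fuel X2 r2 c2) ->
  [/\ r1 = r2, c1 = c2 & eqX X1 X2].
Proof.
move=> kn; elim: fuel X1 r1 c1 X2 r2 c2 => [|fuel IH] X1 r1 c1 X2 r2 c2 le V1 u1 V2 u2 es.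
  by move=> /= eq; split=> //; lia.
rewrite !xslideS.
have step X r c (V : vconf X r c j c0) (u : unstuck X) : r + c <= fuel.+1 -> ~~ xstopped X r c ->
    [/\ vconf (xstepX X r c) (xstepr X r c) (xstepc X r c) j c0,
        unstuck (xstepX X r c), j < r + c & (xstepr X r c + xstepc X r c).+1 = r + c].
  move=> lrc ns.
  have [VV uu e] : [/\ vconf (xstepX X r c) (xstepr X r c) (xstepc X r c) j c0,
        unstuck (xstepX X r c) & (xstepr X r c + xstepc X r c).+1 = r + c].
    case: (xstepP V ns) => [r' er lu p VU sU|c' ec lt VL sL]; split=> //; try lia.
      by have [_ e] := sU 1 n n0; rewrite /unstuck -e.
    by have [_ e] := sL 1 n n0; rewrite /unstuck -e.
  split=> //; have [|_ _ _] := @xslideP fuel _ _ _ _ _ kn _ VV uu; lia.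
case: (boolP (xstopped X1 r1 c1)) => st1; case: (boolP (xstopped X2 r2 c2)) => st2 eq.
- have [-> ->] := stopped_pos kn V1 u1 st1.
  by have [-> ->] := stopped_pos kn V2 u2 st2.
- have [a1 a2] := stopped_pos kn V1 u1 st1; have [|_ _ l _] := step _ _ _ V2 u2 _ st2; lia.
- have [a1 a2] := stopped_pos kn V2 u2 st2; have [|_ _ l _] := step _ _ _ V1 u1 _ st1; lia.
have [|W1 w1 l1 e1] := step _ _ _ V1 u1 _ st1; first by [].
have [|W2 w2 l2 e2] := step _ _ _ V2 u2 _ st2; first by lia.
have [||er ec eX] := IH _ _ _ _ _ _ _ W1 w1 W2 w2 _ eq; try lia.
have S1 := xstepP V1 st1; have S2 := xstepP V2 st2.
rewrite -er -ec in S2.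
exact: (xstep_inj V1 V2 S1 S2 eX).
Qed.
End Slide2.

Lemma cmx_map (A B : eqType) (h : A -> B) (F : B -> nat -> nat) s u v :
  cmx F (map h s) u v = cmx (fun a => F (h a)) s u v.
Proof.
by elim: s v => [//|a s IH] v /=; apply: eq_bigr => w _; rewrite IH.
Qed.

Lemma cmx_shift (A : eqType) (F : A -> nat -> nat) s u v :
  cmx (fun a x => F a x.+1) s u v = cmx F s u.+1 v.+1.
Proof.
elim: s v => [//|a s IH] v /=; rewrite [RHS]big_mkcond big_ord_recl /= max0n.
rewrite -big_mkcond [RHS]big_mkcond [LHS]big_mkcond /=; apply: eq_bigr => w _.
by rewrite /bump /= add1n ltnS IH.
Qed.

(** * Promotion as a run of slides *)

Section Prom.
Variables k n d : nat.
Hypotheses (k0 : 0 < k) (kn : k < n).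
Implicit Types (X Y : nat -> nat -> nat).
Local Notation vconf := (@vconf k n d).
Local Notation vstate := (@vstate k n d).
Local Notation toG := (toG k n d).
Local Notation unstuck := (@unstuck k n d).
Local Notation eqX := (@eqX k d).

Let n0 : 0 < n. Proof. by lia. Qed.

(** For v up to n, a cell holding n and a cell holding 0 are equally invisible to [colc], so turning
    a pending hole into the active one changes nothing. *)
Definition same_n X Y := forall u v, u <= v -> v <= n ->
  cmx (colc k X) (iota 0 d) u v = cmx (colc k Y) (iota 0 d) u v /\
  cmx (coldc k X) (rev (iota 0 d)) u v = cmx (coldc k Y) (rev (iota 0 d)) u v.

Lemma same_n_trans X Y Z : same_n X Y -> same_n Y Z -> same_n X Z.
Proof. by move=> h1 h2 u v uv vn; have [-> ->] := h1 u v uv vn; exact: h2. Qed.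

Lemma unstuck_same X Y : same_n X Y -> unstuck X -> unstuck Y.
Proof. by move=> /(_ 1 n n0 (leqnn _))[_ e]; rewrite /unstuck e. Qed.

Definition slide1 X c0 := xslide (k + d) (xset X k.-1 c0 0) k.-1 c0.

Lemma vstate_start X j c0 : vstate X j c0 -> c0 < d ->
  vconf (xset X k.-1 c0 0) k.-1 c0 j c0 /\ X k.-1 c0 = n.
Proof.
move=> V cd.
have k1 : k.-1 < k by lia.
have [_ t] := vs_top V k1 cd.
have Xn : X k.-1 c0 = n by move: t; rewrite eqxx leqnn => /eqP.
split=> //; have z := vs_zero V k1 cd.
have hh i c : ~~ hol k.-1 c0 i c -> xset X k.-1 c0 0 i c = X i c by rewrite xsetE => /negPf->.
constructor => //.
- by rewrite xsetE /hol !eqxx.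
- by move: z; rewrite Xn; lia.
- by move=> i c1 c2 ik le c2d h1 h2; rewrite !hh //; apply: (vs_row V).
- by move=> i1 i2 c1 lt ik c1d h1 h2; rewrite !hh //; apply: (vs_col V).
- by move=> i c1 ik c1d h; rewrite hh //; apply: (vs_zero V).
- move=> i c1 ik c1d h; rewrite hh //; have [h1 ->] := vs_top V ik c1d; split=> //.
  by move: h; rewrite /hol; lia.
Qed.

Lemma vconf_end X j c0 : vconf X 0 j j c0 -> vstate X j.+1 c0.+1.
Proof.
move=> V; have jd := vc_c V; have jc := vc_c0 V.
have z i c1 : i < k -> c1 < d -> (X i c1 == 0) = (i == 0) && (c1 < j.+1).
  move=> ik cd; case: (boolP (hol 0 j i c1)) => h; last first.
    by rewrite (vc_zero V) //; move: h; rewrite /hol; lia.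
  by move: h; rewrite /hol => /andP[/eqP-> /eqP->]; rewrite (vc_hole V) ltnSn.
constructor=> //.
- move=> i c1 c2 ik le c2d; case: (boolP (hol 0 j i c1)) => h1.
    by move: h1; rewrite /hol => /andP[/eqP-> /eqP->]; rewrite (vc_hole V).
  case: (boolP (hol 0 j i c2)) => h2; last by apply: (vc_row V).
  move: h2; rewrite /hol => /andP[/eqP ei /eqP ec]; subst i c2.
  have := z 0 c1 k0; rewrite ltnS le eqxx /= => /(_ (leq_ltn_trans le c2d)) /eqP->.
  by [].
- move=> i1 i2 c1 lt ik cd; case: (boolP (hol 0 j i1 c1)) => h1.
    move: h1; rewrite /hol => /andP[/eqP ei /eqP ec]; subst i1 c1; rewrite (vc_hole V).
    by rewrite lt0n z //; lia.
  case: (boolP (hol 0 j i2 c1)) => h2; last by apply: (vc_col V).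
  by move: h2; rewrite /hol; lia.
- move=> i c1 ik cd; case: (boolP (hol 0 j i c1)) => h; last first.
    by have [? ->] := vc_top V ik cd h; split=> //; lia.
  by move: h; rewrite /hol => /andP[/eqP-> /eqP->]; rewrite (vc_hole V); split; lia.
Qed.

Lemma same_start X c0 : X k.-1 c0 = n -> same_n X (xset X k.-1 c0 0).
Proof.
move=> Xn u v uv vn.
have H a x : x <= n -> colc k X a x = colc k (xset X k.-1 c0 0) a x.
  move=> xn; have := @colc_xset k X k.-1 c0 0 a x; rewrite Xn.
  have k1 : k.-1 < k by lia.
  by move=> /(_ k1); case: eqP; lia.
by split; apply: eq_cmx => a x y _ _ xy yv; rewrite /coldc !H //; lia.
Qed.

Lemma same_cmx_n X Y : same_cmx k d X Y -> same_n X Y.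
Proof. by move=> h u v uv _; apply: h. Qed.

Lemma slide1P X j c0 : vstate X j c0 -> c0 < d -> unstuck X ->
  [/\ vstate (slide1 X c0) j.+1 c0.+1, same_n X (slide1 X c0) &
      slide (k + d) (toG X) k.-1 c0 = toG (slide1 X c0)].
Proof.
move=> V cd us; have [VC Xn] := vstate_start V cd.
have us' := unstuck_same (same_start Xn) us.
have le : k.-1 + c0 <= k + d by lia.
have [VE sE gE _] := xslideP n0 (ltnW kn) le VC us'.
split; first exact: vconf_end.
  exact: same_n_trans (same_start Xn) (same_cmx_n sE).
rewrite -[RHS]gE; congr (slide _ _ _ _).
apply: functional_extensionality => i; apply: functional_extensionality => c.
rewrite /toG xsetE /hol; case h: ((i == k.-1) && (c == c0)) => //.
by move/andP: h => [/eqP-> /eqP->]; rewrite Xn !ltnn !andbF.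
Qed.

Lemma slide1_inj X1 X2 j c0 : vstate X1 j c0 -> vstate X2 j c0 -> c0 < d ->
  unstuck X1 -> unstuck X2 -> eqX (slide1 X1 c0) (slide1 X2 c0) -> eqX X1 X2.
Proof.
move=> V1 V2 cd u1 u2 eq.
have [VC1 Xn1] := vstate_start V1 cd; have [VC2 Xn2] := vstate_start V2 cd.
have us1 := unstuck_same (same_start Xn1) u1.
have us2 := unstuck_same (same_start Xn2) u2.
have le : k.-1 + c0 <= k + d by lia.
have [_ _ E] := xslide_inj n0 (ltnW kn) le VC1 us1 VC2 us2 erefl eq.
move=> i c ik cd'; have := E i c ik cd'; rewrite !xsetE /hol.
by case: ifP => // /andP[/eqP-> /eqP->]; rewrite Xn1 Xn2.
Qed.

Fixpoint run m X c0 := if m is m'.+1 then run m' (slide1 X c0) c0.+1 else X.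

Lemma runP m X j c0 : vstate X j c0 -> c0 + m = d -> unstuck X ->
  [/\ vstate (run m X c0) (j + m) d, same_n X (run m X c0) &
      foldl (fun g rc => slide (k + d) g rc.1 rc.2) (toG X) [seq (k.-1, c) | c <- iota c0 m]
      = toG (run m X c0)].
Proof.
elim: m X j c0 => [|m IH] X j c0 V e us /=.
  by move: V; rewrite addn0 (_ : c0 = d) //; lia.
have [|VE sE gE] := slide1P V _ us; first by lia.
have [|V' s' g'] := IH _ _ _ VE _ (unstuck_same sE us); first by lia.
split; first by rewrite addnS -addSn.
  exact: same_n_trans s'.
by rewrite -g' gE.
Qed.

Lemma run_inj m X1 X2 j c0 : vstate X1 j c0 -> vstate X2 j c0 -> c0 + m = d ->
  unstuck X1 -> unstuck X2 -> eqX (run m X1 c0) (run m X2 c0) -> eqX X1 X2.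
Proof.
elim: m X1 X2 j c0 => [//|m IH] X1 X2 j c0 V1 V2 e u1 u2 /= eq.
have cd : c0 < d by lia.
have [W1 s1 _] := slide1P V1 cd u1; have [W2 s2 _] := slide1P V2 cd u2.
apply: (slide1_inj V1 V2 cd u1 u2).
by apply: (IH _ _ _ _ W1 W2 _ (unstuck_same s1 u1) (unstuck_same s2 u2) eq); lia.
Qed.

(** The shift by one frees 0 for empty cells and anticipates the increment of promotion: after all
    slides the value in a cell is the promoted label itself, filled cells included. *)
Definition XT (T : tab k n d) : nat -> nat -> nat :=
  fun r c => if tgrid T r c is Some e then e.+1 else 0.

Lemma tgridE (T : tab k n d) (i : 'I_k) (j : 'I_d) : tgrid T i j = Some (val (T (i, j))).
Proof. by rewrite /tgrid !valK. Qed.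

Lemma XTE (T : tab k n d) (i : 'I_k) (j : 'I_d) : XT T i j = (T (i, j)).+1.
Proof. by rewrite /XT tgridE. Qed.

Lemma ssytP (T : tab k n d) : reflect
  ((forall i (j j' : 'I_d), j <= j' -> T (i, j) <= T (i, j')) /\
   (forall (i i' : 'I_k) j, i < i' -> T (i, j) < T (i', j))) (ssyt T).
Proof.
apply: (iffP andP) => -[h1 h2]; split.
- by move=> i j j' le; have /forallP/(_ i)/forallP/(_ j)/forallP/(_ j')/implyP := h1; apply.
- by move=> i i' j le; have /forallP/(_ i)/forallP/(_ i')/forallP/(_ j)/implyP := h2; apply.
- by apply/forallP => i; apply/forallP => j; apply/forallP => j'; apply/implyP; apply: h1.
- by apply/forallP => i; apply/forallP => i'; apply/forallP => j; apply/implyP; apply: h2.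
Qed.

(** In a semistandard tableau the largest label occurs only in the last row, and there in a final
    run of columns, so this count determines all the holes. *)
Definition ntop (T : tab k n d) := count (fun c => XT T k.-1 c == n) (iota 0 d).

Lemma ssyt_vstate T : ssyt T -> ntop T <= d /\ vstate (XT T) 0 (d - ntop T).
Proof.
move=> /ssytP[hr hc].
have nd : ntop T <= d by rewrite /ntop; apply: leq_trans (count_size _ _) _; rewrite size_iota.
have row i c1 c2 : i < k -> c1 <= c2 -> c2 < d -> XT T i c1 <= XT T i c2.
  move=> ik le c2d; have c1d : c1 < d by lia.
  by rewrite -[i]/(val (Ordinal ik)) -[c1]/(val (Ordinal c1d)) -[c2]/(val (Ordinal c2d)) !XTE ltnS hr.
have col i1 i2 c1 : i1 < i2 -> i2 < k -> c1 < d -> XT T i1 c1 < XT T i2 c1.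
  move=> lt i2k c1d; have i1k : i1 < k by lia.
  by rewrite -[i1]/(val (Ordinal i1k)) -[i2]/(val (Ordinal i2k)) -[c1]/(val (Ordinal c1d)) !XTE ltnS hc.
have bnd i c : i < k -> c < d -> 0 < XT T i c <= n.
  move=> ik cd; rewrite -[i]/(val (Ordinal ik)) -[c]/(val (Ordinal cd)) XTE /=.
  by have := ltn_ord (T (Ordinal ik, Ordinal cd)).
have k1 : k.-1 < k by lia.
have top c : c < d -> (XT T k.-1 c == n) = (d - ntop T <= c).
  have gen m : m <= d ->
     forall c, c < d -> c < m -> (XT T k.-1 c == n) = (m - count (fun c => XT T k.-1 c == n) (iota 0 m) <= c).
    elim: m => [//|m IH] md {}c cd cm.
    have -> : iota 0 m.+1 = iota 0 m ++ [:: m] by rewrite -addn1 iotaD.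
    rewrite count_cat /= addn0.
    have cl : count (fun c => XT T k.-1 c == n) (iota 0 m) <= m.
      by apply: leq_trans (count_size _ _) _; rewrite size_iota.
    have [lt|ge] := ltnP c m.
      rewrite IH //; last by lia.
      case: (eqVneq (XT T k.-1 m) n) => [e|ne]; first by rewrite /= addn1 subSS.
      rewrite /= addn0.
      have c0 : count (fun c => XT T k.-1 c == n) (iota 0 m) = 0.
        apply/eqP; rewrite -leqn0 leqNgt -has_count; apply/hasPn => c'.
        rewrite mem_iota => hc'; apply/negP => /eqP e.
        have : XT T k.-1 c' <= XT T k.-1 m by apply: row => //; lia.
        by have := bnd k.-1 m k1 md; lia.
      by rewrite c0; lia.
    have -> : c = m by lia.
    case: (eqVneq (XT T k.-1 m) n) => [e|ne]; first by rewrite /= addn1 subSS; lia.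
    rewrite /= addn0.
    have c0 : count (fun c => XT T k.-1 c == n) (iota 0 m) = 0.
      apply/eqP; rewrite -leqn0 leqNgt -has_count; apply/hasPn => c'.
      rewrite mem_iota => hc'; apply/negP => /eqP e.
      have : XT T k.-1 c' <= XT T k.-1 m by apply: row => //; lia.
      by have := bnd k.-1 m k1 md; lia.
    by rewrite c0; lia.
  by move=> cd; apply: gen.
split=> //; constructor => //.
- by move=> i c ik cd; have := bnd i c ik cd; lia.
- move=> i c ik cd; split; first by have := bnd i c ik cd; lia.
  have [e|ne] := eqVneq i k.-1; first by rewrite e top.
  have lt : i < k.-1 by lia.
  by have := col i k.-1 c lt k1 cd; have := bnd k.-1 c k1 cd; lia.
Qed.

(** The complementary counts of the columns are ordered, so the telescoping bound leaves only the
    last column at n and the first at 1. At most the bottom cell of the last column holds n, which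
    gives n - (k - 1) - 1. *)
Lemma ssyt_unstuck T : 0 < d -> ssyt T -> unstuck (XT T).
Proof.
move=> d0 sT; have [_ V] := ssyt_vstate sT.
have lip c x : c < d -> colc k (XT T) c x.+1 <= (colc k (XT T) c x).+1.
  move=> cd; apply: colc_lip => i1 i2 lt i2k _ _.
  by have := vs_col V lt i2k cd; lia.
have le c x : c < d -> colc k (XT T) c x <= x by move=> cd; apply: colc_le => y; apply: lip.
have mono : cmono (coldc k (XT T)) (rev (iota 0 d)).
  by move=> c; rewrite mem_rev mem_iota => cd; apply: coldc_mono => x; apply: lip; lia.
have srt : sorted (fun b c => [forall x : 'I_n.+1, coldc k (XT T) c x <= coldc k (XT T) b x])
   (rev (iota 0 d)).
  rewrite rev_sorted.
  apply: (@sub_in_sorted _ (fun c => c < d) ltn) (iota_ltn_sorted 0 d).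
    move=> b c; rewrite !unfold_in => bd cd bc; apply/forallP => x; rewrite /coldc.
    apply: leq_sub2l; apply: leq_sum => i _.
    have := vs_row V (ltn_ord i) (ltnW bc) cd; have := vs_zero V (ltn_ord i) bd; lia.
  by apply/allP => c; rewrite mem_iota.
have [d' ed] : exists d', d = d'.+1 by exists d.-1; lia.
move: mono srt; rewrite /unstuck.
have -> : rev (iota 0 d) = d' :: rev (iota 0 d').
  by rewrite ed -addn1 iotaD rev_cat.
move=> mono srt; apply: leq_trans (cmx_bound mono _ srt) _; first by lia.
have -> : last d' (rev (iota 0 d')) = 0.
  by case: d' {ed mono srt} => [//|m]; rewrite /= rev_cons last_rcons.
rewrite /coldc.
have -> : colc k (XT T) 0 1 = 0 by rewrite /colc big1 // => i _; lia.
suff : k <= (colc k (XT T) d' n).+1 by lia.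
have k1 : k.-1 < k by lia.
rewrite /colc (bigD1 (Ordinal k1)) //=.
rewrite (eq_bigr (fun=> 1)); last first.
  move=> i ik; have d'd : d' < d by lia.
  have := vs_zero V (ltn_ord i) d'd; have := vs_top V (ltn_ord i) d'd.
  have : val i != k.-1 by rewrite -[k.-1]/(val (Ordinal k1)) val_eqE.
  by move=> /negPf -> [] /=; lia.
rewrite sum1_card; have := cardC1 (Ordinal k1); rewrite card_ord /predC1.
rewrite -[X in X = _]/(#|fun i => i != Ordinal k1|) => ->; lia.
Qed.

Lemma prom_run T : 0 < d -> ssyt T ->
  forall i j, val (prom T (i, j)) = run (ntop T) (XT T) (d - ntop T) i j.
Proof.
move=> d0 sT i j.
have [nd V] := ssyt_vstate sT; have us := ssyt_unstuck d0 sT.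
have [VR sR gR] := runP V (subnK nd) us.
have vlt : run (ntop T) (XT T) (d - ntop T) i j < n.
  by have := vs_top VR (ltn_ord i) (ltn_ord j); have := ltn_ord j; lia.
have k1 : k.-1 < k by lia.
rewrite /prom; case: ifP => [nt|/negbFE ht].
  rewrite ffunE.
  have z : ntop T = 0.
    apply/eqP; rewrite -leqn0 leqNgt -has_count; apply/hasPn => c; rewrite mem_iota add0n => /= cd.
    move: nt; rewrite /has_top negb_exists => /forallP/(_ (Ordinal k1, Ordinal cd)).
    have := XTE T (Ordinal k1) (Ordinal cd) => /= ->.
    by move=> h; apply: contraNN h => /eqP/= e; apply/eqP; exact: (congr1 predn e).
  by move: vlt; rewrite z /= XTE => vlt; rewrite insubdK.
have g0E r c : r < k -> c < d -> (tgrid T r c == Some n.-1) = (XT T r c == n).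
  move=> rk cd; rewrite -[r]/(val (Ordinal rk)) -[c]/(val (Ordinal cd)) tgridE XTE.
  by case: (T _) => t /= tn; apply/eqP/eqP => [[]|?]; [lia | congr Some; lia].
rewrite ffunE.
have -> : [seq (r, c) | c <- iota 0 d, r <- [seq r <- iota 0 k | tgrid T r c == Some n.-1]]
   = [seq (k.-1, c) | c <- iota (d - ntop T) (ntop T)].
  have E c : c < d -> [seq r <- iota 0 k | tgrid T r c == Some n.-1] =
     if d - ntop T <= c then [:: k.-1] else [::].
    move=> cd.
    have -> : iota 0 k = rcons (iota 0 k.-1) k.-1.
      by rewrite -cats1 -[in LHS](prednK k0) -addn1 iotaD.
    rewrite filter_rcons g0E //; have [_ ->] := vs_top V k1 cd; rewrite eqxx /=.
    have -> : [seq r <- iota 0 k.-1 | tgrid T r c == Some n.-1] = [::]; last by [].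
    apply/eqP; rewrite -size_eq0 size_filter -leqn0 leqNgt -has_count; apply/hasPn => r.
    rewrite mem_iota => rk; rewrite g0E //; last by lia.
    have rk' : r < k by lia.
    by have [_ ->] := vs_top V rk' cd; lia.
  have -> : [seq (r, c) | c <- iota 0 d, r <- [seq r <- iota 0 k | tgrid T r c == Some n.-1]]
    = flatten [seq (if d - ntop T <= c then [:: (k.-1, c)] else [::]) | c <- iota 0 d].
    congr flatten; apply/eq_in_map => c; rewrite mem_iota => cd; rewrite E //.
    by case: ifP.
  have -> : iota 0 d = iota 0 (d - ntop T) ++ iota (d - ntop T) (ntop T).
    by rewrite -{1}(subnK nd) iotaD.
  rewrite map_cat flatten_cat.
  set F := (fun c => if _ then _ else _).
  have -> : [seq F c | c <- iota 0 (d - ntop T)] = [seq [::] | _ <- iota 0 (d - ntop T)].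
    by apply/eq_in_map => c; rewrite mem_iota /F; case: ifP => //; lia.
  have -> : [seq F c | c <- iota (d - ntop T) (ntop T)] =
            [seq [:: (k.-1, c)] | c <- iota (d - ntop T) (ntop T)].
    by apply/eq_in_map => c; rewrite mem_iota /F; case: ifP => //; lia.
  have -> : flatten [seq [::] | _ <- iota 0 (d - ntop T)] = [::] :> seq (nat * nat).
    by elim: (iota _ _).
  by elim: (iota _ _) => [//|c s IH] /=; rewrite -IH.
have -> : (fun r c => if tgrid T r c == Some n.-1 then None else tgrid T r c) = toG (XT T).
  apply: functional_extensionality => r; apply: functional_extensionality => c.
  rewrite /toG; case: (ltnP r k) => rk; last first.
    by rewrite /tgrid insubF //=; lia.
  case: (ltnP c d) => cd /=; last first.
    by rewrite /tgrid; case: insub => // ?; rewrite insubF //=; lia.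
  rewrite g0E //.
  have [le _] := vs_top V rk cd.
  rewrite -[r]/(val (Ordinal rk)) -[c]/(val (Ordinal cd)) in le *.
  rewrite XTE tgridE in le *; rewrite ltn0Sn /= ltn_neqAle le andbT.
  by case: eqP.
rewrite gR /= /toG !ltn_ord /=.
case: (posnP (run (ntop T) (XT T) (d - ntop T) i j)) => [z|p].
  by rewrite insubdK // ?z // unfold_in.
by rewrite vlt /= prednK // insubdK.
Qed.

Lemma prom_ssyt (T : tab k n d) : 0 < d -> ssyt T -> ssyt (prom T).
Proof.
move=> d0 sT; have [nd V] := ssyt_vstate sT; have us := ssyt_unstuck d0 sT.
have [VR sR gR] := runP V (subnK nd) us.
apply/ssytP; split=> [i j j' le|i i' j lt].
  rewrite !prom_run //; exact: (vs_row VR).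
rewrite !prom_run //; exact: (vs_col VR).
Qed.

Lemma prom_inj (T1 T2 : tab k n d) : 0 < d -> ssyt T1 -> ssyt T2 -> prom T1 = prom T2 -> T1 = T2.
Proof.
move=> d0 s1 s2 eq.
have [nd1 V1] := ssyt_vstate s1; have us1 := ssyt_unstuck d0 s1.
have [nd2 V2] := ssyt_vstate s2; have us2 := ssyt_unstuck d0 s2.
have [W1 _ _] := runP V1 (subnK nd1) us1.
have [W2 _ _] := runP V2 (subnK nd2) us2.
have E : eqX (run (ntop T1) (XT T1) (d - ntop T1)) (run (ntop T2) (XT T2) (d - ntop T2)).
  move=> i c ik cd; rewrite -[i]/(val (Ordinal ik)) -[c]/(val (Ordinal cd)).
  by rewrite -!prom_run // eq.
(* The zeros in the first row of the result count the holes that were slid. *)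
have nn : ntop T1 = ntop T2.
  have H c : c < d -> (c < ntop T1) = (c < ntop T2).
    by move=> cd; have := vs_zero W1 k0 cd; have := vs_zero W2 k0 cd; rewrite E //= !add0n => <- <-.
  case: (ltngtP (ntop T1) (ntop T2)) => // lt.
    by have := H (ntop T1); rewrite lt ltnn; lia.
  by have := H (ntop T2); rewrite lt ltnn; lia.
rewrite -nn in E V2 us2.
have := run_inj V1 V2 (subnK nd1) us1 us2 E.
move=> EE; apply/ffunP => -[i j]; apply: val_inj.
by have := EE i j (ltn_ord i) (ltn_ord j); rewrite !XTE => -[].
Qed.

Definition tcnt (T : tab k n d) j x := colc k (XT T) j x.+1.
Definition tdcnt (T : tab k n d) j x := x - tcnt T j x.

Lemma prom_tcnt T u v : 0 < d -> ssyt T -> u <= v -> v < n ->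
  cmx (tcnt (prom T)) (iota 0 d) u.+1 v.+1 = cmx (tcnt T) (iota 0 d) u v /\
  cmx (tdcnt (prom T)) (rev (iota 0 d)) u.+1 v.+1 = cmx (tdcnt T) (rev (iota 0 d)) u v.
Proof.
move=> d0 sT uv vn; have [nd V] := ssyt_vstate sT; have us := ssyt_unstuck d0 sT.
have [VR sR gR] := runP V (subnK nd) us.
set R := run _ _ _ in VR sR gR.
have lip X j c0 : vstate X j c0 -> forall c x, c < d -> colc k X c x.+1 <= (colc k X c x).+1.
  move=> V' c x cd; apply: colc_lip => i1 i2 lt i2k _ _.
  by have := vs_col V' lt i2k cd; lia.
have [_ VP] := ssyt_vstate (prom_ssyt d0 sT).
(* The cells filled with 0 count for [prom T] but not in [colc k R]; the discrepancy is the same at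
   x and at y and cancels in differences. *)
have key c x y : c < d -> 1 <= x -> x <= y ->
   colc k (XT (prom T)) c y.+1 + colc k R c x = colc k R c y + colc k (XT (prom T)) c x.+1.
  move=> cd x1 xy; rewrite /colc -!big_split; apply: eq_bigr => i _ /=.
  have := XTE (prom T) i (Ordinal cd); rewrite prom_run //= -/R => ->.
  by lia.
have key2 c x y : c < d -> x <= y ->
    colc k (XT T) c y.+1 - colc k (XT T) c x.+1 <= y - x.
  move=> cd xy; rewrite -(subnK xy); elim: (y - x) => [|m IH]; first by rewrite add0n; lia.
  by have := lip _ _ _ V c (m.+1 + x) cd; move: IH; rewrite !addSn; lia.
have [E1 E2] := sR u.+1 v.+1 uv vn.
rewrite -!cmx_shift in E1 E2.
split.
  rewrite [RHS]E1 -cmx_shift; apply: eq_cmx => c x y; rewrite mem_iota => cd ux xy yv.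
  by have := @key c x.+1 y.+1; rewrite /tcnt; lia.
have -> : cmx (tdcnt T) (rev (iota 0 d)) u v =
          cmx (fun a x => coldc k (XT T) a x.+1) (rev (iota 0 d)) u v.
  apply: eq_cmx => c x y; rewrite mem_rev mem_iota => cd ux xy yv.
  have lb z : colc k (XT T) c z.+1 <= z.
    elim: z => [|z IH]; first by rewrite /colc big1 // => i _; lia.
    by have := lip _ _ _ V c z.+1; lia.
  by rewrite /tdcnt /tcnt /coldc; have := lb x; have := lb y; lia.
rewrite E2 -cmx_shift; apply: eq_cmx => c x y; rewrite mem_rev mem_iota => cd ux xy yv.
have lbP z : colc k (XT (prom T)) c z.+1 <= z.
  elim: z => [|z IH]; first by rewrite /colc big1 // => i _; lia.
  by have := lip _ _ _ VP c z.+1; lia.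
have lbR z : colc k R c z <= z by apply: colc_le => z'; apply: (lip _ _ _ VR); lia.
have := @key c x.+1 y.+1; rewrite /tdcnt /tcnt /coldc.
by have := lbP x.+1; have := lbP y.+1; have := lbR x.+1; have := lbR y.+1; lia.
Qed.

End Prom.

(** * The cyclic rank function of a tableau *)

Local Open Scope ring_scope.

Lemma absz_modz_lt (n : nat) (x : int) : (0 < n)%N -> (`|(x %% n%:Z)%Z| < n)%N.
Proof.
move=> n0; have := modz_ge0 x (_ : n%:Z != 0); have := ltz_pmod x (_ : 0 < n%:Z); lia.
Qed.
Lemma absz_modzS (n : nat) (x : int) : (0 < n)%N ->
  `|((x + 1) %% n%:Z)%Z|%N = if (`|(x %% n%:Z)%Z|.+1 == n)%N then 0%N else `|(x %% n%:Z)%Z|.+1%N.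
Proof.
move=> n0; have := absz_modz_lt x n0; have := modz_ge0 x (_ : n%:Z != 0).
rewrite -modzDml; move: (x %% n)%Z => y h1 h2.
have {h1} y0 : 0 <= y by apply: h1; lia.
case: eqP => e; last by rewrite modz_small; lia.
have -> : y + 1 = n%:Z by lia.
by rewrite modzz.
Qed.
Local Close Scope ring_scope.

Section Counts.
Variables k n : nat.
Implicit Types (a b : ksub k n) (s : seq (ksub k n)).

Definition cntS (A : {set 'I_n}) x := #|[set y in A | (y < x)%N]|.
Definition cntk a x := cntS (val a) x.
Definition dcntk a x := x - cntk a x.

Lemma cntk_mono a : {homo cntk a : x y / x <= y}.
Proof.
move=> x y xy; apply/subset_leq_card/subsetP => z; rewrite !inE => /andP[-> /=].
by move/leq_trans; apply.
Qed.

Lemma cntS_S (A : {set 'I_n}) x (xn : x < n) :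
  cntS A x.+1 = cntS A x + (Ordinal xn \in A).
Proof.
rewrite /cntS (cardD1 (Ordinal xn)) addnC inE ltnSn andbT; congr addn.
apply: eq_card => y; rewrite !inE ltnS -val_eqE /= ltn_neqAle.
by case: (y == x :> nat); rewrite ?andbF.
Qed.

Lemma cntS_big (A : {set 'I_n}) x : n <= x -> cntS A x = #|A|.
Proof.
move=> nx; apply: eq_card => y; rewrite !inE andb_idr // => _.
exact: leq_trans (ltn_ord y) nx.
Qed.

Lemma cntk_lip a x : cntk a x.+1 <= (cntk a x).+1.
Proof.
have [xn|nx] := ltnP x n; first by rewrite /cntk (cntS_S _ xn); case: (_ \in _); lia.
by rewrite /cntk !cntS_big //; lia.
Qed.

Lemma cntk0 a : cntk a 0 = 0.
Proof. by apply: eq_card0 => y; rewrite !inE andbF. Qed.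

Lemma cntkn a : cntk a n = k.
Proof. by rewrite /cntk cntS_big // (eqP (valP a)). Qed.

Lemma cntk_le a x : cntk a x <= x.
Proof. by elim: x => [|x IH]; [rewrite cntk0 | have := cntk_lip a x; lia]. Qed.

Lemma cntk_lek a x : cntk a x <= k.
Proof.
by rewrite -[X in _ <= X](eqP (valP a)); apply/subset_leq_card/subsetP => y; rewrite inE => /andP[].
Qed.

Lemma dcntk_mono a : {homo dcntk a : x y / x <= y}.
Proof.
move=> x y xy; rewrite -(subnK xy); elim: (y - x) => [//|m IH].
by apply: leq_trans IH _; rewrite addSn /dcntk; have := cntk_lip a (m + x); lia.
Qed.

Lemma dcntk_lip a x : dcntk a x.+1 <= (dcntk a x).+1.
Proof. by rewrite /dcntk; have := cntk_mono a (leqnSn x); lia. Qed.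

Lemma sorted_nth_count (l : seq nat) t x : sorted ltn l -> t < size l ->
  (nth 0 l t < x) = (t < count (fun y => y < x) l).
Proof.
elim: l t => [//|y l IH] t srt; case: t => [_|t tl].
  rewrite /=; case: ltnP => // xy; rewrite add0n; apply/esym/negbTE; rewrite -leqNgt leqn0.
  rewrite -[_ == 0]negbK -lt0n -has_count; apply/hasPn => z zl; rewrite -leqNgt.
  by have /allP/(_ z zl) := order_path_min ltn_trans srt; move=> /= /ltnW; apply: leq_trans.
have srt' := path_sorted srt.
rewrite /= IH //; case: (ltnP y x) => [yx|xy]; first by rewrite add1n ltnS.
rewrite add0n.
have -> : count (fun y => y < x) l = 0.
  apply/eqP; rewrite -[_ == 0]negbK -lt0n -has_count; apply/hasPn => z zl; rewrite -leqNgt.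
  by have /allP/(_ z zl) := order_path_min ltn_trans srt; move=> /= /ltnW; apply: leq_trans.
by [].
Qed.

Lemma enum_set_sorted (A : {set 'I_n}) : sorted ltn (map val (enum A)).
Proof.
have -> : enum A = [seq x <- enum 'I_n | x \in A] by rewrite enumT.
rewrite sorted_map; apply: sorted_filter; first by move=> y x z; apply: ltn_trans.
by rewrite -sorted_map val_enum_ord; exact: iota_ltn_sorted.
Qed.

Lemma kth_nth a (t : 'I_k) : kth a t = nth 0 (map val (enum (val a))) t :> nat.
Proof.
have sz : size (enum (val a)) = k by rewrite -cardE (eqP (valP a)).
have [y0 _] : exists y0 : 'I_n, y0 \in enum (val a).
  by case: (enum _) sz => [/= sz|y0 l sz]; [have := ltn_ord t; lia | exists y0; rewrite mem_head].
rewrite (nth_map y0) ?sz // /kth (enum_val_nth y0) /=.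
by [].
Qed.

Lemma cntk_count a x : cntk a x = count (fun y => y < x) (map val (enum (val a))).
Proof.
rewrite count_map -size_filter /cntk /cntS cardE.
have e1 : enum [set y in val a | y < x] = [seq y <- enum 'I_n | (y \in val a) && (y < x)].
  by rewrite enumT; apply: eq_filter => y; rewrite !inE.
have e2 : enum (val a) = [seq y <- enum 'I_n | y \in val a] by rewrite enumT.
rewrite e1 e2 -[in RHS]filter_predI; congr (size _); apply: eq_filter => y.
by rewrite /= andbC.
Qed.

Lemma kth_lt a (t : 'I_k) x : (kth a t < x) = (t < cntk a x).
Proof.
rewrite kth_nth cntk_count sorted_nth_count //; first exact: enum_set_sorted.
by rewrite size_map -cardE (eqP (valP a)).
Qed.

Lemma kth_mem a t : kth a t \in val a.
Proof. by rewrite /kth; apply: enum_valP. Qed.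

Lemma kth_inj a : injective (kth a).
Proof. by move=> t t'; rewrite /kth => /enum_val_inj/cast_ord_inj. Qed.

Lemma kth_surj a y : y \in val a -> exists t, kth a t = y.
Proof.
move=> ya; exists (cast_ord (eqP (valP a)) (enum_rank_in ya y)).
by rewrite /kth cast_ordK enum_rankK_in.
Qed.

Lemma pleqP a b : reflect (forall x, cntk b x <= cntk a x) (pleq a b).
Proof.
apply: (iffP forallP) => h.
  move=> x; rewrite leqNgt; apply/negP => lt.
  have ltk : cntk a x < k by apply: leq_trans (cntk_lek b x).
  have := h (Ordinal ltk); have := kth_lt b (Ordinal ltk) x; have := kth_lt a (Ordinal ltk) x.
  by rewrite /= ltnn lt; lia.
move=> t; rewrite -ltnS kth_lt; apply: leq_trans (h _).
by rewrite -kth_lt.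
Qed.

Definition cc s u v := cmx cntk s u v.
Definition dd s u v := cmx dcntk (rev s) u v.

Lemma cntk_cmono s : cmono cntk s. Proof. by move=> a _; exact: cntk_mono. Qed.
Lemma dcntk_cmono s : cmono dcntk s. Proof. by move=> a _; exact: dcntk_mono. Qed.
Lemma cntk_clip s : clip cntk s. Proof. by move=> a _; exact: cntk_lip. Qed.
Lemma dcntk_clip s : clip dcntk s. Proof. by move=> a _; exact: dcntk_lip. Qed.

Lemma cntk_sorted s v : sorted (@pleq k n) s ->
  sorted (fun b c => [forall x : 'I_v.+1, cntk c x <= cntk b x]) s.
Proof.
by apply: sub_sorted => a b /pleqP h; apply/forallP => x; apply: h.
Qed.

Lemma dcntk_sorted s v : sorted (@pleq k n) s ->
  sorted (fun b c => [forall x : 'I_v.+1, dcntk c x <= dcntk b x]) (rev s).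
Proof.
rewrite rev_sorted; apply: sub_sorted => a b /pleqP h; apply/forallP => x.
by rewrite /dcntk; have := h x; lia.
Qed.

Lemma rev_head a s : exists s'', rev (a :: s) = last a s :: s'' /\ last (last a s) s'' = a.
Proof.
case: (lastP s) => [|s' b]; first by exists [::].
exists (rcons (rev s') a); rewrite rev_cons rev_rcons last_rcons /= last_rcons.
by [].
Qed.

(** The telescoping bound is attained by giving the whole interval to the first column. Hence the
    ranks of initial windows recover that column, which is what later allows it to be cancelled. *)
Lemma cc0 a s v : sorted (@pleq k n) (a :: s) -> cc (a :: s) 0 v = cntk a v.
Proof.
move=> srt; apply/eqP; rewrite eqn_leq; apply/andP; split.
  have := cmx_bound (@cntk_cmono (a :: s)) (leq0n v) (cntk_sorted v srt).
  by rewrite cntk0 subn0.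
have := @cmx_mem _ cntk a (a :: s) 0 v (@cntk_cmono _); rewrite mem_head cntk0 subn0.
by apply.
Qed.

Lemma ccn a s u : u <= n -> sorted (@pleq k n) (a :: s) -> cc (a :: s) u n = k - cntk (last a s) u.
Proof.
move=> un srt; apply/eqP; rewrite eqn_leq; apply/andP; split.
  by have := cmx_bound (@cntk_cmono (a :: s)) un (cntk_sorted n srt); rewrite cntkn.
by have := cmx_last cntk a s un; rewrite cntkn.
Qed.

Lemma dd0 a s v : sorted (@pleq k n) (a :: s) -> dd (a :: s) 0 v = v - cntk (last a s) v.
Proof.
rewrite /dd => srt; have := dcntk_sorted v srt; have [s'' [-> _]] := rev_head a s => srt'.
apply/eqP; rewrite eqn_leq; apply/andP; split.
  have := cmx_bound (@dcntk_cmono _) (leq0n v) srt'.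
  by rewrite /dcntk sub0n subn0.
have := @cmx_mem _ dcntk (last a s) (last a s :: s'') 0 v (@dcntk_cmono _).
by rewrite mem_head /dcntk sub0n subn0; apply.
Qed.

Lemma ddn a s u : u <= n -> sorted (@pleq k n) (a :: s) ->
  dd (a :: s) u n = (n - k) - (u - cntk a u).
Proof.
rewrite /dd => un srt; have := dcntk_sorted n srt; have [s'' [-> lE]] := rev_head a s => srt'.
apply/eqP; rewrite eqn_leq; apply/andP; split.
  by have := cmx_bound (@dcntk_cmono _) un srt'; rewrite lE /dcntk cntkn.
by have := cmx_last dcntk (last a s) s'' un; rewrite lE /dcntk cntkn.
Qed.

(** Consistency of the two branches of [Rr] on intervals ending at n; [cc_dd2] does the same for
    intervals starting at 0. Together they let [rho] pass through the wrap. *)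
Lemma cc_dd1 s u : s != [::] -> u <= n -> sorted (@pleq k n) s -> cc s u n + u = k + dd s 0 u.
Proof.
case: s => [//|a s] _ un srt; rewrite ccn // dd0 //.
by have := cntk_le (last a s) u; have := cntk_lek (last a s) u; lia.
Qed.

Lemma cc_dd2 s v : s != [::] -> v <= n -> sorted (@pleq k n) s ->
  cc s 0 v + (n - v) = k + dd s v n.
Proof.
case: s => [//|a s] _ un srt; rewrite cc0 // ddn //.
have := cntk_le a v; have := cntk_lek a v; have := dcntk_mono a un.
by have := cntk_le a n; rewrite /dcntk cntkn; lia.
Qed.

Local Open Scope ring_scope.

(** The second branch is the rank formula of the dual matroid: the complement of the wrapped window
    is the ordinary interval [u + m - n, u), of size n - m. *)
Definition Rr s (u m : nat) : int :=
  if (u + m <= n)%N then (cc s u (u + m))%:Z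
  else k%:Z - n%:Z + m%:Z + (dd s (u + m - n) u)%:Z.

(* The cyclic rank function attached to a tableau: the bound imposed on the rank of
   the m consecutive columns starting at x. *)
Definition rho s (x : int) (m : nat) : int := Rr s `|(x %% n%:Z)%Z|%N m.

Section RhoProps.
Variable s : seq (ksub k n).
Hypotheses (s0 : s != [::]) (srt : sorted (@pleq k n) s) (n0 : (0 < n)%N).

Lemma Rr_dd u m : (u <= n)%N -> (m <= n)%N -> (n <= u + m)%N ->
  Rr s u m = k%:Z - n%:Z + m%:Z + (dd s (u + m - n) u)%:Z.
Proof.
move=> un mn nm; rewrite /Rr; case: leqP => // le.
have e : (u + m = n)%N by lia.
by rewrite e subnn; have := cc_dd1 s0 un srt; lia.
Qed.

Lemma Rr_n m : (m <= n)%N -> Rr s n m = Rr s 0 m.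
Proof.
move=> mn; rewrite Rr_dd //; last by lia.
rewrite /Rr add0n mn addKn.
by have := cc_dd2 s0 mn srt; lia.
Qed.

Lemma rhoS (x : int) m : (m <= n)%N -> rho s (x + 1) m = Rr s `|(x %% n%:Z)%Z|.+1 m.
Proof.
move=> mn; rewrite /rho absz_modzS //; case: eqP => // ->.
by rewrite Rr_n.
Qed.

Lemma rhoE (x : int) : exists2 u, (u < n)%N & forall m, (m <= n)%N ->
  rho s x m = Rr s u m /\ rho s (x + 1) m = Rr s u.+1 m.
Proof.
exists `|(x %% n%:Z)%Z|%N; first exact: absz_modz_lt.
by move=> m mn; rewrite rhoS.
Qed.

Lemma rho0 x : rho s x 0 = 0.
Proof.
have [u un /(_ 0%N isT) [-> _]] := rhoE x.
by rewrite /Rr addn0 (ltnW un) /cc cmxnn.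
Qed.

Lemma rhon x : rho s x n = k%:Z.
Proof.
have [u un /(_ n (leqnn n)) [-> _]] := rhoE x.
rewrite Rr_dd //; [|lia|lia].
by rewrite addnK /dd cmxnn; lia.
Qed.

Lemma rho_step x m : (m < n)%N -> 0 <= rho s x m.+1 - rho s (x + 1) m <= 1.
Proof.
move=> mn; have [u un h] := rhoE x; have [-> _] := h _ mn; have [_ ->] := h _ (ltnW mn).
have [le|gt] := leqP (u + m.+1)%N n.
  rewrite /Rr le addSn -addnS le.
  have := @cmx_monol _ cntk s u (u + m.+1) (@cntk_cmono _).
  have := @cmx_lipl _ cntk s u (u + m.+1) (@cntk_cmono _) (@cntk_clip _).
  by rewrite /cc; lia.
rewrite !Rr_dd; try lia.
have -> : (u.+1 + m - n = u + m.+1 - n)%N by lia.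
have := @cmx_monor _ dcntk (rev s) (u + m.+1 - n) u (@dcntk_cmono _).
have := @cmx_lipr _ dcntk (rev s) (u + m.+1 - n) u (@dcntk_cmono _) (@dcntk_clip _).
by rewrite /dd; lia.
Qed.

(** Submodularity of the chain maxima, applied to the complementary intervals when the window wraps;
    matroid duality preserves submodularity. *)
Lemma rho_sub x m : (m.+2 <= n)%N ->
  rho s x m.+2 - rho s (x + 1) m.+1 <= rho s x m.+1 - rho s (x + 1) m.
Proof.
move=> mn; have [u un h] := rhoE x.
have [-> _] := h m.+2 mn; have [-> ->] := h m.+1 (ltnW mn).
have [_ ->] := h m (ltnW (ltnW mn)).
have [le|gt] := leqP (u + m.+2)%N n.
  rewrite /Rr le.
  have -> : (u.+1 + m.+1 = u + m.+2)%N by lia.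
  have -> : (u.+1 + m = u + m.+1)%N by lia.
  have -> : (u + m.+1 <= n)%N by lia.
  rewrite le.
  have := @cmx_submod _ cntk s u u.+1 (u + m.+1) (u + m.+2) (@cntk_cmono _).
  by rewrite /cc; lia.
rewrite !Rr_dd; try lia.
have -> : (u.+1 + m.+1 - n = u + m.+2 - n)%N by lia.
have -> : (u.+1 + m - n = u + m.+1 - n)%N by lia.
have := @cmx_submod _ dcntk (rev s) (u + m.+1 - n) (u + m.+2 - n) u u.+1 (@dcntk_cmono _).
by rewrite /dd; lia.
Qed.
End RhoProps.

(* The rank of the m columns starting at x, for any point whose bounded affine
   permutation is f (see [rank_rf]). *)
Definition rf (f : int -> int) (x : int) (m : nat) : nat :=
  \sum_(i < m) nat_of_bool (x + m%:Z <= f (x + i%:Z))%R.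

Definition fits s f := forall x m, (m <= n)%N -> rho s x m <= (rf f x m)%:Z.

Lemma rfS f x m : rf f x m.+1 = (nat_of_bool (x + m.+1%:Z <= f x)%R + rf f (x + 1)%R m)%N.
Proof.
rewrite /rf big_ord_recl /= addr0; congr addn; apply: eq_bigr => i _.
rewrite /bump /= add1n.
have -> : x + 1 + m%:Z = x + m.+1%:Z by lia.
by have -> : x + 1 + i%:Z = x + i.+1%:Z by lia.
Qed.

Lemma rf_chi f x m : rf (chi f) (x + 1) m = rf f x m.
Proof.
apply: eq_bigr => i _; rewrite /chi.
have -> : x + 1 + i%:Z - 1 = x + i%:Z by lia.
by rewrite addrAC lerD2r.
Qed.
End Counts.

(** * The columns of a tableau, and rotation of rho under promotion *)

Section Cols.
Variables k n d : nat.
Hypotheses (k0 : 0 < k) (kn : k < n) (d0 : 0 < d).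

(** [insub] would discard a column with repeated labels; semistandardness guarantees that none is
    lost. *)
Definition cols (T : tab k n d) : seq (ksub k n) :=
  pmap insub [seq colset T j | j <- enum 'I_d].

Lemma ssyt_colinj (T : tab k n d) j : ssyt T -> injective (fun i => T (i, j)).
Proof.
move=> /ssytP[_ hc] i i' e; case: (ltngtP i i') => [lt|lt|]; last exact: ord_inj.
  by have := hc _ _ j lt; rewrite e ltnn.
by have := hc _ _ j lt; rewrite e ltnn.
Qed.

Lemma colset_card (T : tab k n d) j : ssyt T -> #|colset T j| == k.
Proof. by move=> sT; rewrite /colset card_imset ?card_ord //; apply: ssyt_colinj. Qed.

Lemma cols_val (T : tab k n d) : ssyt T -> map val (cols T) = [seq colset T j | j <- enum 'I_d].
Proof.
move=> sT; rewrite /cols; elim: (enum _) => [//|j e IH] /=.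
by rewrite insubT ?colset_card //= => h; rewrite IH.
Qed.

Lemma cntS_colset (T : tab k n d) (j : 'I_d) x : ssyt T -> cntS (colset T j) x = tcnt T j x.
Proof.
move=> sT; rewrite /cntS /tcnt /colc.
have -> : [set y in colset T j | y < x] = [set T (i, j) | i : 'I_k & T (i, j) < x].
  apply/setP => y; rewrite !inE; apply/andP/imsetP => [[/imsetP[i _ ->] lt]|[i]].
    by exists i; rewrite ?inE.
  by rewrite inE => lt ->; split=> //; apply/imsetP; exists i.
rewrite card_imset; last exact: ssyt_colinj.
rewrite -sum1_card big_mkcond; apply: eq_bigr => i _.
by rewrite inE XTE; case: ifP; lia.
Qed.

Lemma cc_cols (T : tab k n d) u v : ssyt T -> cc (cols T) u v = cmx (tcnt T) (iota 0 d) u v.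
Proof.
move=> sT; rewrite /cc -[cmx _ (cols T) u v](cmx_map val (fun A => cntS A)) cols_val //.
rewrite -val_enum_ord !cmx_map; apply: eq_cmx => j x y _ _ _ _.
by rewrite !cntS_colset.
Qed.

Lemma dd_cols (T : tab k n d) u v : ssyt T -> dd (cols T) u v = cmx (tdcnt T) (rev (iota 0 d)) u v.
Proof.
move=> sT; rewrite /dd -[cmx _ (rev (cols T)) u v](cmx_map val (fun A x => x - cntS A x)).
rewrite map_rev cols_val //.
rewrite -val_enum_ord -!map_rev !cmx_map; apply: eq_cmx => j x y _ _ _ _.
by rewrite !cntS_colset.
Qed.

Lemma cols_sorted (T : tab k n d) : ssyt T -> sorted (@pleq k n) (cols T).
Proof.
move=> sT; have /ssytP[hr _] := sT.
have sub : sorted (fun A B : {set 'I_n} => [forall x : 'I_n.+1, cntS B x <= cntS A x]) (map val (cols T)).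
  rewrite cols_val // sorted_map.
  apply: (@sub_sorted _ (fun i j : 'I_d => i < j)); last first.
    by have := iota_ltn_sorted 0 d; rewrite -val_enum_ord sorted_map.
  move=> i j ij; apply/forallP => x; rewrite /= !cntS_colset // /tcnt /colc.
  apply: leq_sum => t _; have := hr t i j (ltnW ij); rewrite !XTE.
  by move: (T (t, i)) (T (t, j)) => p q; lia.
move: sub; rewrite sorted_map; apply: sub_sorted => a b /forallP h; apply/pleqP => x.
have [xn|nx] := ltnP x n.+1; first exact: (h (Ordinal xn)).
by rewrite /cntk !cntS_big ?(eqP (valP a)) ?(eqP (valP b)) //; lia.
Qed.

Lemma size_cols (T : tab k n d) : ssyt T -> size (cols T) = d.
Proof. by move=> sT; rewrite -(size_map val) cols_val // size_map size_enum_ord. Qed.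

Lemma cols_n0 (T : tab k n d) : ssyt T -> cols T != [::].
Proof. by move=> sT; rewrite -size_eq0 size_cols //; lia. Qed.

Lemma rho_prom (T : tab k n d) x m : ssyt T -> m <= n ->
  rho (cols (prom T)) (x + 1)%R m = rho (cols T) x m.
Proof.
move=> sT mn; have sP := prom_ssyt k0 kn d0 sT.
have n0 : 0 < n by lia.
rewrite (rhoS (cols_n0 sP) (cols_sorted sP) n0) // /rho.
move: `|(x %% n%:Z)%Z|%N (absz_modz_lt x n0) => u un.
(* Strict, because after rotation the interval ends at u + m + 1, which must not exceed n. The case
   u + m = n is read off the complementary statistic instead. *)
have [lt|ge] := ltnP (u + m) n.
  rewrite /Rr addSn lt ltnW // !cc_cols //.
  by have [-> _] := prom_tcnt k0 kn d0 sT (leq_addr m u) lt.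
rewrite !Rr_dd ?cols_n0 ?cols_sorted //; try lia.
congr (_ + Posz _)%R; rewrite !dd_cols //.
have -> : u.+1 + m - n = (u + m - n).+1 by lia.
by have [|_ ->] := prom_tcnt k0 kn d0 sT (_ : u + m - n <= u) un; lia.
Qed.

Lemma fits_prom (T : tab k n d) f : ssyt T -> fits (cols T) f <-> fits (cols (prom T)) (chi f).
Proof.
move=> sT; split=> h x m mn.
  by rewrite -[x](subrK 1%R) rho_prom // rf_chi; apply: h.
by rewrite -rho_prom // -rf_chi; apply: h.
Qed.
End Cols.

(** * Degenerating a bounded affine permutation *)

Local Open Scope ring_scope.

Section Descend.
Variables k n : nat.
Hypothesis n0 : (0 < n)%N.
Implicit Types (f g : int -> int).

(** [good_full] is the condition on the total displacement of f in pointwise form: every full turn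
    has rank k. In this form it can be compared with [rho] and checked after an exchange. *)
Record good f : Prop := Good {
  good_per : forall i, f (i + n%:Z) = f i + n%:Z;
  good_bnd : forall i, i <= f i <= i + n%:Z;
  good_full : forall x, rf f x n = k }.

Lemma per_mul f : (forall i, f (i + n%:Z) = f i + n%:Z) ->
  forall i t, f (i + t * n%:Z) = f i + t * n%:Z.
Proof.
move=> per i; have pos (t : nat) j : f (j + t%:Z * n%:Z) = f j + t%:Z * n%:Z.
  elim: t => [|t IH]; first by rewrite !mul0r !addr0.
  have -> : j + t.+1%:Z * n%:Z = j + t%:Z * n%:Z + n%:Z by rewrite -addn1 PoszD mulrDl mul1r addrA.
  by rewrite per IH -addn1 PoszD mulrDl mul1r addrA.
case=> t; first exact: pos.
have := pos t.+1 (i + Negz t * n%:Z); rewrite NegzE mulNr subrK => ->.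
by rewrite addrK.
Qed.

Lemma rf_per f x m t : (forall i, f (i + n%:Z) = f i + n%:Z) ->
  rf f (x + t * n%:Z) m = rf f x m.
Proof.
move=> per; apply: eq_bigr => i _.
by rewrite !(addrAC x (t * n%:Z)) per_mul // lerD2r.
Qed.

Lemma modn_dec (x : int) : exists u : nat, exists t : int, (u < n)%N /\ x = u%:Z + t * n%:Z.
Proof.
exists `|(x %% n%:Z)%Z|%N; exists (x %/ n%:Z)%Z; split; first exact: absz_modz_lt.
rewrite gez0_abs ?modz_ge0 //; last by lia.
by rewrite addrC -divz_eq.
Qed.

Lemma per_sum (g : int -> nat) (s : nat) : (forall i, g (i + n%:Z) = g i) ->
  (\sum_(x < n) g (x%:Z + s%:Z)%R = \sum_(x < n) g x%:Z)%N.
Proof.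
move=> per; elim: s => [|s IH]; first by apply: eq_bigr => i _; rewrite addr0.
rewrite -{}IH; have [m em] : exists m, n = m.+1 by exists n.-1; lia.
rewrite em big_ord_recr big_ord_recl /= addnC; congr addn.
  by rewrite -(per (0 + s%:Z)) em; congr g; lia.
by apply: eq_bigr => i _; rewrite /bump /= add1n; congr g; lia.
Qed.

Lemma sum_leq_add (N m : nat) : (\sum_(s < N) nat_of_bool (N <= m + s) = minn m N)%N.
Proof.
elim: N => [|N IH]; first by rewrite big_ord0 minn0.
rewrite big_ord_recl /= addn0 (eq_bigr (fun s : 'I_N => nat_of_bool (N <= m + s)%N)) ?IH; last first.
  by move=> s _; rewrite /bump /= add1n addnS ltnS.
by lia.
Qed.

(** Double counting: after summation over a period, x contributes the number of s < n with n - s <=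
    f x - x, and that number is f x - x. *)
Lemma bound_sum_rf f : is_bound k n f -> (\sum_(x < n) rf f x%:Z n = n * k)%N.
Proof.
move=> [_ per sm bnd]; rewrite /rf exchange_big /=.
rewrite (eq_bigr (fun s : 'I_n => \sum_(x < n) nat_of_bool (n%:Z - s%:Z <= f x%:Z - x%:Z)%R)%N); last first.
  move=> s _; rewrite -(@per_sum (fun i => nat_of_bool (n%:Z - s%:Z <= f i - i)%R) s); last first.
    by move=> i; rewrite per; congr (nat_of_bool (_ <= _)); lia.
  by apply: eq_bigr => x _; congr nat_of_bool; lia.
rewrite exchange_big /=.
apply/eqP; rewrite -eqz_nat mulnC -sm; apply/eqP.
rewrite [LHS](big_morph Posz PoszD erefl); apply: eq_bigr => i _.
have [m em] : exists m : nat, f i%:Z - i%:Z = m%:Z.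
  by exists `|f i%:Z - i%:Z|%N; have := bnd i%:Z; lia.
rewrite em -[in RHS](minn_idPl (_ : (m <= n)%N)); last by have := bnd i%:Z; lia.
rewrite -sum_leq_add; congr Posz; apply: eq_bigr => s _; congr nat_of_bool; lia.
Qed.

(** The average of [rf f x n] over a period is k, so the lower bound k everywhere forces equality.
    That bound will come from [fits] at m = n, where [rho] equals k. *)
Lemma bound_good f : is_bound k n f -> (forall x, (k <= rf f x n)%N) -> good f.
Proof.
move=> B ge; have sm := bound_sum_rf B; have [_ per _ bnd] := B.
constructor=> // x; have [u [t [un ->]]] := modn_dec x; rewrite rf_per //.
apply/eqP; rewrite eqn_leq ge andbT.
move: sm; rewrite (bigD1 (Ordinal un)) //= => sm.
have : (n.-1 * k <= \sum_(i < n | i != Ordinal un) rf f i n)%N.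
  apply: (@leq_trans (\sum_(i < n | i != Ordinal un) k)); last by apply: leq_sum => i _; exact: ge.
  by rewrite sum_nat_const cardC1 card_ord.
have : (n * k = n.-1 * k + k)%N by rewrite -{1}(prednK n0) mulSn addnC.
move: sm; move: (\sum_(_ < n | _) _)%N (n * k)%N (n.-1 * k)%N => S A1 A2.
by lia.
Qed.

Section OneStep.
Variables (f : int -> int) (rh : int -> nat -> int).
Hypotheses (gf : good f) (rh_per : forall x t m, rh (x + t * n%:Z) m = rh x m)
  (rh0 : forall x, rh x 0 = 0) (rhn : forall x, rh x n = k%:Z)
  (rh_step : forall x m, (m < n)%N -> 0 <= rh x m.+1 - rh (x + 1) m <= 1)
  (rh_sub : forall x m, (m.+2 <= n)%N -> rh x m.+2 - rh (x + 1) m.+1 <= rh x m.+1 - rh (x + 1) m)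
  (ft : forall x m, (m <= n)%N -> rh x m <= (rf f x m)%:Z).

Lemma rh_sub1 x m t : (m + t < n)%N ->
  rh x (m + t).+1 - rh (x + 1) (m + t) <= rh x m.+1 - rh (x + 1) m.
Proof.
elim: t => [|t IH] le; first by rewrite addn0.
apply: le_trans (IH _); last by lia.
by rewrite addnS; apply: rh_sub; lia.
Qed.

Lemma rh_sub2 x i m t : (i + m + t <= n)%N ->
  rh x (i + m + t) - rh (x + i%:Z) (m + t) <= rh x (i + m) - rh (x + i%:Z) m.
Proof.
elim: i x => [|i IH] x le; first by rewrite addr0 !subrr.
have := IH (x + 1); have := @rh_sub1 x (i + m) t.
have -> : x + 1 + i%:Z = x + i.+1%:Z by lia.
by rewrite !addSn; lia.
Qed.

Lemma descent_step : (exists x m, (m <= n)%N /\ rh x m != (rf f x m)%:Z) ->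
  exists p q, [/\ p < q, q <= f p, f p < f q, f q <= p + n%:Z &
    forall a m, p < a <= q -> f p < a + m%:Z <= f q -> (m <= n)%N -> rh a m < (rf f a m)%:Z].
Proof.
move=> [x0 [m0 [m0n ne0]]].
pose P m := [exists u : 'I_n, (m <= n)%N && (rh u m != (rf f u m)%:Z)].
have exP : exists m, P m.
  exists m0; have [u [t [un ex]]] := modn_dec x0; apply/existsP; exists (Ordinal un).
  by rewrite m0n /=; move: ne0; rewrite ex rh_per rf_per //; exact: good_per gf.
case: (ex_minnP exP) => m /existsP[u /andP[mn neq]] minP.
have eqlt x m' : (m' < m)%N -> rh x m' = (rf f x m')%:Z.
  move=> lt; apply/eqP; apply: contraTT isT => ne.
  have [v [t [vn ex]]] := modn_dec x.
  have : P m'.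
    apply/existsP; exists (Ordinal vn); rewrite (leq_trans (ltnW lt) mn) /=.
    by move: ne; rewrite ex rh_per rf_per //; exact: good_per gf.
  by move/minP; lia.
case: m mn neq minP eqlt => [|m'] mn neq minP eqlt.
  by move: neq; rewrite rh0 /rf big_ord0 eqxx.
set m := m'.+1 in mn neq minP eqlt.
pose q : int := u%:Z.
have gt : rh q m < (rf f q m)%:Z by rewrite lt_neqAle neq ft.
have e1 := eqlt q m' (ltnSn _); have e2 := eqlt (q + 1) m' (ltnSn _).
have stp := rh_step q mn.
have [fq rq] : q + m%:Z <= f q /\ rh q m = rh (q + 1) m'.
  by move: gt stp; rewrite /m rfS; case: (leP (q + m'.+1%:Z) (f q)) => h; lia.
pose Q i := (0 < i)%N && (q + m'%:Z <= f (q - i%:Z) < f q).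
have rfd i L : rf f (q - i%:Z) (i + L) = (rf f q L + \sum_(1 <= j < i.+1) nat_of_bool (q + L%:Z <= f (q - j%:Z))%R)%N.
  elim: i => [|i IH]; first by rewrite subr0 big_geq // addn0.
  rewrite big_nat_recr //= addSn rfS.
  have -> : q - i.+1%:Z + 1 = q - i%:Z by lia.
  have -> : q - i.+1%:Z + (i + L).+1%:Z = q + L%:Z by lia.
  by rewrite IH; lia.
(* Extending the window to the left by i, rh gains at most what it gains on the shorter window of
   length [m'], by submodularity. [rf] gains exactly as much on both, because no value f (q - j)
   falls between the two right ends. *)
have claim i t : (forall j, (j <= i)%N -> ~~ Q j) -> q + m%:Z + t%:Z <= f q -> (i + m + t <= n)%N ->
   rh (q - i%:Z) (i + m + t) < (rf f (q - i%:Z) (i + m + t))%:Z.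
  move=> nQ fqt le.
  have h1 := @rh_sub2 (q - i%:Z) i m' t.+1; rewrite subrK in h1.
  have h1' : rh (q - i%:Z) (i + m + t) - rh q (m + t) <= rh (q - i%:Z) (i + m') - rh q m'.
    have -> : (i + m + t = i + m' + t.+1)%N by lia.
    have -> : (m + t = m' + t.+1)%N by lia.
    by apply: h1; lia.
  have h2 : rh q (m + t) - rh (q + 1) (m' + t) <= 0.
    have := @rh_sub1 q m' t; rewrite -/m rq subrr.
    by have -> : ((m' + t).+1 = m + t)%N by []; apply; lia.
  have h3 : rf f q (m + t) = (rf f (q + 1) (m' + t)).+1.
    rewrite -[(m + t)%N]/((m' + t).+1) rfS.
    by have -> : (q + (m' + t).+1%:Z <= f q) by lia.
  have h4 := ft (q + 1) (_ : (m' + t <= n)%N).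
  have h5 := ft (q - i%:Z) (_ : (i + m' <= n)%N).
  have h6 : (rf f (q - i%:Z) (i + m + t) + rf f q m' = rf f (q - i%:Z) (i + m') + rf f q (m + t))%N.
    rewrite -addnA !rfd.
    rewrite (@eq_big_nat _ _ _ 1 i.+1 _ (fun j => nat_of_bool (q + m'%:Z <= f (q - j%:Z))%R)); first by lia.
    move=> j /andP[j1 ji]; congr nat_of_bool.
    by have := nQ j; rewrite ltnS in ji; rewrite ji /Q j1 /= => /(_ isT); lia.
  by move: e1; lia.
(* Without such an index strictness would reach a window of length n, where both functions equal
   k. *)
have exQ : exists i, Q i && (i + m <= n)%N.
  have [/existsP[i h]|] := boolP [exists i : 'I_n.+1, Q i && (i + m <= n)%N]; first by exists i.
  rewrite negb_exists => /forallP nex.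
  have := @claim (n - m)%N 0%N; rewrite addn0 addr0 subnK // rhn (good_full gf) ltxx.
  move=> h; suff : false by []; apply: h => // j jn.
  have jn' : (j < n.+1)%N by lia.
  by have := nex (Ordinal jn'); rewrite /= negb_and; lia.
case: (ex_minnP exQ) => i /andP[Qi in_] mini.
have nQ j : (j < i)%N -> ~~ Q j.
  move=> ji; apply/negP => Qj; have := mini j; rewrite Qj /=.
  by move=> /(_ _); lia.
have /andP[i0 /andP[fp1 fp2]] := Qi.
exists (q - i%:Z), q; split=> //; first by lia.
- by lia.
- rewrite leNgt; apply/negP => h.
  have := @claim i.-1 (n - i.-1 - m)%N.
  have -> : (i.-1 + m + (n - i.-1 - m) = n)%N by lia.
  rewrite rhn (good_full gf) ltxx => c; suff : false by [].
  by apply: c; [move=> j ji; apply: nQ; lia | lia | lia].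
- move=> a m2 pa ya m2n.
  have [j ej] : exists j : nat, a = q - j%:Z by exists `|q - a|%N; lia.
  have [t et] : exists t : nat, m2 = (j + m + t)%N by exists (m2 - (j + m))%N; lia.
  by rewrite ej et; apply: claim; [move=> j' jj; apply: nQ; lia | lia | lia].
Qed.
End OneStep.

(** Conjugation by a translation. It moves p to -1, so that the exchange affects the residues n - 1
    and q with no case distinction on p. *)
Definition sh f (c : int) : int -> int := fun l => f (l + c) - c.

Lemma rf_sh f c x m : rf (sh f c) x m = rf f (x + c) m.
Proof.
apply: eq_bigr => i _; rewrite /sh.
by rewrite lerBrDr !(addrAC x c).
Qed.

Lemma good_sh f c : good f -> good (sh f c).
Proof.
move=> [per bnd full]; constructor.
- by move=> i; rewrite /sh addrAC per addrAC.
- by move=> i; rewrite /sh; have := bnd (i + c); lia.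
- by move=> x; rewrite rf_sh.
Qed.

(* Exchanges the values of f at -1 and q, periodically. *)
Definition swap0 f (q : nat) : int -> int := fun l =>
  if `|(l %% n%:Z)%Z|%N == n.-1 then f q%:Z + (l + 1)
  else if `|(l %% n%:Z)%Z|%N == q then f (-1) + (l - q%:Z) else f l.

Lemma swap0E f q u t : (u < n)%N ->
  swap0 f q (u%:Z + t * n%:Z) =
  if u == n.-1 then f q%:Z + (u%:Z + t * n%:Z + 1)
  else if u == q then f (-1) + (u%:Z + t * n%:Z - q%:Z) else f (u%:Z + t * n%:Z).
Proof.
move=> un; rewrite /swap0.
have -> : ((u%:Z + t * n%:Z) %% n%:Z)%Z = u%:Z by rewrite addrC modzMDl modz_small //; lia.
by rewrite absz_nat.
Qed.

(** A window with u < n and m <= n meets the two altered residue classes only at n - 1, q and q + n.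
    The identity [pt] puts corrections on both sides, which avoids truncated subtraction. *)
Lemma rf_swap0 f q u m : (forall i, f (i + n%:Z) = f i + n%:Z) -> (u < n)%N -> (m <= n)%N ->
  q%:Z <= f (-1) -> f (-1) < f q%:Z -> f q%:Z <= n%:Z - 1 ->
  rf f u%:Z m = (rf (swap0 f q) u%:Z m + nat_of_bool ((u <= q)%N && (f (-1) < u%:Z + m%:Z <= f q%:Z)%R))%N.
Proof.
move=> per un mn h1 h2 h3.
have qn : (q < n.-1)%N by lia.
pose Y := u%:Z + m%:Z.
pose inn (z : nat) := (u <= z < u + m)%N.
have pt (i : 'I_m) :
  (nat_of_bool (Y <= f (u%:Z + i%:Z))%R + ((u + i == n.-1) && (Y <= f q%:Z + n%:Z)%R)
  + ((u + i == q) && (Y <= f (-1))%R) + ((u + i == q + n) && (Y <= f (-1) + n%:Z)%R) =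
  nat_of_bool (Y <= swap0 f q (u%:Z + i%:Z))%R + ((u + i == n.-1) && (Y <= f (-1) + n%:Z)%R)
  + ((u + i == q) && (Y <= f q%:Z)%R) + ((u + i == q + n) && (Y <= f q%:Z + n%:Z)%R))%N.
  have im := ltn_ord i.
  have [lt|ge] := ltnP (u + i) n.
    have -> : u%:Z + i%:Z = (u + i)%N%:Z + 0 * n%:Z by lia.
    rewrite swap0E // mul0r addr0.
    have -> : (u + i == q + n)%N = false by lia.
    case: (eqVneq (u + i)%N n.-1) => [e|ne].
      have -> : (u + i == q)%N = false by lia.
      rewrite !e.
      have -> : f (n.-1)%:Z = f (-1) + n%:Z by rewrite -per; congr f; lia.
      have -> : f q%:Z + ((n.-1)%:Z + 1) = f q%:Z + n%:Z by lia.
      by rewrite /=; lia.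
    rewrite /=; case: (eqVneq (u + i)%N q) => [->|ne'].
      have -> : f (-1) + (q%:Z - q%:Z) = f (-1) by lia.
      by rewrite /=; lia.
    by rewrite /=; lia.
  have -> : u%:Z + i%:Z = (u + i - n)%N%:Z + 1 * n%:Z by lia.
  rewrite swap0E ?mul1r //; last by lia.
  have -> : (u + i == n.-1)%N = false by lia.
  have -> : (u + i == q)%N = false by lia.
  have -> : (u + i - n == n.-1)%N = false by lia.
  case: (eqVneq (u + i)%N (q + n)%N) => [e|ne].
    have -> : (u + i - n = q)%N by lia.
    rewrite ?eqxx /= per.
    have -> : f (-1) + (q%:Z + n%:Z - q%:Z) = f (-1) + n%:Z by lia.
    by lia.
  have -> : (u + i - n == q)%N = false by lia.
  by rewrite /=; lia.
have cnt (z : nat) (b : bool) : (\sum_(i < m) nat_of_bool ((u + i == z) && b) = (inn z) && b)%N.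
  rewrite /inn; case: (boolP (u <= z < u + m)%N) => h.
    have zm : (z - u < m)%N by lia.
    rewrite (bigD1 (Ordinal zm)) //= big1 => [|i]; last by rewrite -val_eqE /=; lia.
    by rewrite addn0 subnKC ?eqxx //; lia.
  by rewrite big1 // => i _; have := ltn_ord i; lia.
have E : (\sum_(i < m) (nat_of_bool (Y <= f (u%:Z + i%:Z))%R + ((u + i == n.-1) && (Y <= f q%:Z + n%:Z)%R)
  + ((u + i == q) && (Y <= f (-1))%R) + ((u + i == q + n) && (Y <= f (-1) + n%:Z)%R)) =
  \sum_(i < m) (nat_of_bool (Y <= swap0 f q (u%:Z + i%:Z))%R + ((u + i == n.-1) && (Y <= f (-1) + n%:Z)%R)
  + ((u + i == q) && (Y <= f q%:Z)%R) + ((u + i == q + n) && (Y <= f q%:Z + n%:Z)%R)))%N.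
  by apply: eq_bigr => i _; exact: pt.
move: E; rewrite !big_split /= !cnt -/(rf f u m) -/(rf (swap0 f q) u m).
by rewrite /inn /Y; lia.
Qed.

Lemma good_swap0 f q : good f -> q%:Z <= f (-1) -> f (-1) < f q%:Z -> f q%:Z <= n%:Z - 1 ->
  (forall x, rf (swap0 f q) x n = k) -> good (swap0 f q).
Proof.
move=> [per bnd full] h1 h2 h3 full'; constructor=> //.
  move=> i; have [u [t [un ->]]] := modn_dec i.
  have -> : u%:Z + t * n%:Z + n%:Z = u%:Z + (t + 1) * n%:Z by rewrite mulrDl mul1r addrA.
  rewrite !swap0E //; case: ifP => _; first by rewrite mulrDl mul1r; lia.
  case: ifP => _; first by rewrite mulrDl mul1r; lia.
  by rewrite mulrDl mul1r addrA per.
move=> i; rewrite /swap0; case: ifP => _; first by lia.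
by case: ifP => _; [lia | exact: bnd].
Qed.

Lemma swap0_per f q : (forall i, f (i + n%:Z) = f i + n%:Z) ->
  forall i, swap0 f q (i + n%:Z) = swap0 f q i + n%:Z.
Proof.
move=> per i; have [u [t [un ->]]] := modn_dec i.
have -> : u%:Z + t * n%:Z + n%:Z = u%:Z + (t + 1) * n%:Z by rewrite mulrDl mul1r addrA.
rewrite !swap0E //; case: ifP => _; first by rewrite mulrDl mul1r; lia.
case: ifP => _; first by rewrite mulrDl mul1r; lia.
by rewrite mulrDl mul1r addrA per.
Qed.

(** Induction on the sum of [rf] over all windows starting in one period, which every exchange
    decreases. [Q] is any property carried along exchanges; it will be the inclusion of vanishing
    ideals. *)
Lemma descend (Q : (int -> int) -> Prop) (rh : int -> nat -> int) f :
  (forall x t m, rh (x + t * n%:Z) m = rh x m) ->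
  (forall x, rh x 0 = 0) -> (forall x, rh x n = k%:Z) ->
  (forall x m, (m < n)%N -> 0 <= rh x m.+1 - rh (x + 1) m <= 1) ->
  (forall x m, (m.+2 <= n)%N -> rh x m.+2 - rh (x + 1) m.+1 <= rh x m.+1 - rh (x + 1) m) ->
  (forall g c q, good g -> q%:Z <= sh g c (-1) -> sh g c (-1) < sh g c q%:Z ->
     sh g c q%:Z <= n%:Z - 1 -> Q g -> Q (sh (swap0 (sh g c) q) (- c))) ->
  good f -> (forall x m, (m <= n)%N -> rh x m <= (rf f x m)%:Z) -> Q f ->
  exists g, [/\ good g, Q g & forall x m, (m <= n)%N -> rh x m = (rf g x m)%:Z].
Proof.
move=> rper r0 rn rstep rsub Qstep.
pose mu g := (\sum_(x < n) \sum_(m < n.+1) rf g x%:Z m)%N.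
move: {2}(mu f) (leqnn (mu f)) => N; elim/ltn_ind: N f => N IH f muN gf ft Qf.
have [/forallP eqs|] := boolP [forall u : 'I_n, forall m : 'I_n.+1, rh u%:Z m == (rf f u%:Z m)%:Z].
  exists f; split=> // x m mn; have [u [t [un ->]]] := modn_dec x.
  rewrite rper rf_per; last exact: good_per gf.
  by have /forallP/(_ (Ordinal (mn : m < n.+1)%N))/eqP := eqs (Ordinal un).
rewrite negb_forall => /existsP[u0]; rewrite negb_forall => /existsP[m0 ne].
have [|p [q0 [pq qfp fpq fqn reg]]] := descent_step gf rper r0 rn rstep rsub ft.
  by exists u0%:Z, m0; split=> //; rewrite -ltnS.
pose c := p + 1.
have [q eq] : exists q : nat, q0 - c = q%:Z by exists `|q0 - c|%N; lia.
have s1 : sh f c (-1) = f p - c by rewrite /sh; congr (f _ - _); lia.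
have s2 : sh f c q%:Z = f q0 - c by rewrite /sh -eq subrK.
have h1 : q%:Z <= sh f c (-1) by lia.
have h2 : sh f c (-1) < sh f c q%:Z by lia.
have h3 : sh f c q%:Z <= n%:Z - 1 by lia.
have gs := good_sh c gf.
pose f' := sh (swap0 (sh f c) q) (- c).
have rE (u m : nat) t : (u < n)%N -> (m <= n)%N ->
  rf f (u%:Z + c + t * n%:Z) m = (rf f' (u%:Z + c + t * n%:Z) m +
   nat_of_bool ((u <= q)%N && (f p - c < u%:Z + m%:Z <= f q0 - c)%R))%N.
  move=> un mn; rewrite rf_per; last exact: good_per gf.
  rewrite rf_sh addrAC addrK rf_per; last by apply: swap0_per; exact: good_per gs.
  by rewrite -rf_sh (rf_swap0 (good_per gs) un mn h1 h2 h3) s1 s2.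
have dec x : exists u t, (u < n)%N /\ x = u%:Z + c + t * n%:Z.
  have [u [t [un ex]]] := modn_dec (x - c); exists u, t; split=> //.
  by rewrite addrAC -ex subrK.
have ft' x m : (m <= n)%N -> rh x m <= (rf f' x m)%:Z.
  move=> mn; have [u [t [un ->]]] := dec x; have := rE u m t un mn.
  have := ft (u%:Z + c + t * n%:Z) m mn.
  case: (boolP ((u <= q)%N && _)) => [/andP[uq /andP[a b]]|_]; last by lia.
  have := reg (u%:Z + c) m; rewrite rper.
  have e : rf f (u%:Z + c + t * n%:Z) m = rf f (u%:Z + c) m by apply: rf_per; exact: good_per gf.
  by rewrite e; lia.
have full' x : rf f' x n = k.
  have := ft' x n (leqnn n); rewrite rn; have [u [t [un ->]]] := dec x.
  by have := rE u n t un (leqnn n); rewrite (good_full gf); lia.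
have gf' : good f'.
  apply: good_sh; apply: good_swap0 => // x.
  by have := full' (x + c); rewrite rf_sh addrK.
have Qf' : Q f' by apply: Qstep.
apply: (IH (mu f') _ f') => //.
apply: leq_trans muN; rewrite /mu.
have le (x : 'I_n) (m : 'I_n.+1) : (rf f' x m <= rf f x m)%N.
  have [u [t [un ->]]] := dec x%:Z; rewrite (rE u m t un) ?leq_addr //.
  by rewrite -ltnS.
have [v [t [vn ev]]] := modn_dec q0.
have mlt : (`|f q0 - q0|%N < n.+1)%N by have := good_bnd gf q0; lia.
(* The window from q0 up to f q0 is among those that lose one. *)
have lt : (rf f' (Ordinal vn) (Ordinal mlt) < rf f (Ordinal vn) (Ordinal mlt))%N.
  have -> : (Ordinal vn)%:Z = q%:Z + c + (- t) * n%:Z by rewrite -eq subrK ev /= mulNr addrK.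
  rewrite (rE q (Ordinal mlt) (- t)); [|lia|by rewrite -ltnS].
  suff -> : (q <= q)%N && (f p - c < q%:Z + (Ordinal mlt)%:Z <= f q0 - c) by rewrite addn1.
  by rewrite leqnn /=; have := good_bnd gf q0; lia.
rewrite (bigD1 (Ordinal vn)) //= [X in (_ < X)%N](bigD1 (Ordinal vn)) //= -addSn leq_add //; last first.
  by apply: leq_sum => x _; apply: leq_sum => m _; apply: le.
rewrite (bigD1 (Ordinal mlt)) //= [X in (_ < X)%N](bigD1 (Ordinal mlt)) //= -addSn leq_add //.
by apply: leq_sum => m _; apply: (le (Ordinal vn)).
Qed.

End Descend.

(** * Interval ranks and closures of positroid strata *)

Section LinAlg.
Variable K : fieldType.

Lemma mxrank_adds_row (k m : nat) (v : 'rV[K]_k) (B : 'M_(m, k)) :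
  \rank (v + B)%MS = (~~ (v <= B)%MS + \rank B)%N.
Proof.
have [vB|nvB] := boolP (v <= B)%MS.
  by rewrite add0n; apply/eqP; rewrite eqn_leq mxrankS ?addsmx_sub ?vB ?submx_refl ?mxrankS ?addsmxSr.
have v1 : \rank v = 1%N.
  apply/eqP; rewrite eqn_leq rank_leq_row lt0n mxrank_eq0.
  by apply: contraNneq nvB => ->; rewrite sub0mx.
have := mxrank_sum_cap v B; rewrite v1.
suff -> : \rank (v :&: B)%MS = 0%N by rewrite addn0.
apply/eqP; apply: contraNT nvB => r0.
have cv : (v :&: B <= v)%MS by exact: capmxSl.
have : (v <= v :&: B)%MS.
  have := mxrank_leqif_sup cv; rewrite v1 => -[le <-].
  by move: le r0; lia.
by move/submx_trans; apply; exact: capmxSr.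
Qed.

Lemma poly_det_lin (r : nat) (A B : 'M[K]_r) :
  exists P : {poly K}, forall t, P.[t] = \det (A + t *: B).
Proof.
exists (\det (map_mx polyC A + 'X *: map_mx polyC B)) => t.
have -> : (\det (map_mx polyC A + 'X *: map_mx polyC B)).[t] =
   horner_eval t (\det (map_mx polyC A + 'X *: map_mx polyC B)) by [].
rewrite -det_map_mx; congr (\det _); apply/matrixP => i j; rewrite !mxE /=.
by rewrite /horner_eval !hornerE.
Qed.

(** Semicontinuity of the rank: factors with L A R = 1 single out a nonzero minor, and det (L (A + t
    B) R) is a polynomial in t with value 1 at t = 0. *)
Lemma rank_generic (m k : nat) (A B : 'M[K]_(m, k)) :
  exists2 w : {poly K}, w != 0 & forall t, w.[t] != 0 -> (\rank A <= \rank (A + t *: B)%R)%N.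
Proof.
have /row_fullP[L LE] := col_base_full A.
have /row_freeP[R RE] := row_base_free A.
have LAR : L *m A *m R = 1%:M.
  transitivity (L *m (col_base A *m row_base A) *m R); first by rewrite mulmx_base.
  by rewrite (mulmxA L) LE mul1mx RE.
have [w wE] := poly_det_lin (1%:M : 'M_(\rank A)) (L *m B *m R).
exists w.
  apply/eqP => w0; have := wE 0; rewrite w0 horner0 scale0r addr0 det1 => /eqP.
  by rewrite eq_sym oner_eq0.
move=> t; rewrite wE => dn0.
have u : (1%:M + t *: (L *m B *m R)) \in unitmx by rewrite unitmxE unitfE.
have E : 1%:M + t *: (L *m B *m R) = L *m (A + t *: B) *m R.
  by rewrite mulmxDr mulmxDl LAR -scalemxAr -scalemxAl.
have e := mxrank_unit u; rewrite E in e.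
apply: (@leq_trans (\rank (L *m (A + t *: B)%R))); last exact: mxrankM_maxr.
by rewrite -[X in (X <= _)%N]e; exact: mxrankM_maxl.
Qed.

Section Cols.
Variables k n : nat.
Hypothesis n0 : (0 < n)%N.
Implicit Types (M : 'M[K]_(k, n)).

Definition rw M (l : int) : 'rV[K]_k := (vcol M l)^T.
Definition blk M (x : int) (m : nat) : 'M[K]_(m, k) := \matrix_(s < m) rw M (x + s%:Z).

Lemma in_spanE M x t : in_span_next M x t = (rw M x <= blk M (x + 1) t)%MS.
Proof. by []. Qed.

Lemma vcol_per M l t : vcol M (l + t * n%:Z) = vcol M l.
Proof. by rewrite /vcol addrC modzMDl. Qed.

Lemma vcol_ord M (j : 'I_n) : vcol M j%:Z = col j M.
Proof.
rewrite /vcol modz_small ?absz_nat; last by have := ltn_ord j; lia.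
by rewrite (nth_map j) ?size_enum_ord // nth_ord_enum.
Qed.

Lemma blk_per M x m t : blk M (x + t * n%:Z) m = blk M x m.
Proof. by apply/row_matrixP => i; rewrite !rowK addrAC /rw vcol_per. Qed.

Lemma row_blk M x m (s : 'I_m) : row s (blk M x m) = rw M (x + s%:Z).
Proof. by rewrite rowK. Qed.

Lemma rw_blk M x m l : x <= l < x + m%:Z -> (rw M l <= blk M x m)%MS.
Proof.
move=> h; have lt : (`|l - x|%N < m)%N by lia.
have := row_sub (Ordinal lt) (blk M x m); rewrite row_blk.
by have -> : x + (Ordinal lt)%:Z = l by rewrite /=; lia.
Qed.

Lemma blk_subP M x m p (A : 'M_(p, k)) :
  reflect (forall l, x <= l < x + m%:Z -> (rw M l <= A)%MS) (blk M x m <= A)%MS.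
Proof.
apply: (iffP row_subP) => h.
  move=> l hl; have lt : (`|l - x|%N < m)%N by lia.
  have := h (Ordinal lt); rewrite row_blk.
  by have -> : x + (Ordinal lt)%:Z = l by rewrite /=; lia.
by move=> s; rewrite row_blk; apply: h; have := ltn_ord s; lia.
Qed.

Lemma rank_cons M x m :
  \rank (blk M x m.+1) = (~~ in_span_next M x m + \rank (blk M (x + 1) m))%N.
Proof.
rewrite in_spanE -mxrank_adds_row; apply/eqP; rewrite eqn_leq !mxrankS //.
  rewrite addsmx_sub rw_blk /=; last by lia.
  by apply/blk_subP => l hl; apply: rw_blk; lia.
apply/blk_subP => l hl; have [->|ne] := eqVneq l x; first exact: addsmxSl.
by apply: submx_trans (addsmxSr _ _); apply: rw_blk; lia.
Qed.

Lemma in_span_mono M x t t' : (t <= t')%N -> in_span_next M x t -> in_span_next M x t'.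
Proof.
rewrite !in_spanE => le h; apply: submx_trans h _.
by apply/blk_subP => l hl; apply: rw_blk; lia.
Qed.

Lemma fV_leE M x t : (t <= n)%N -> (fV M x <= x + t%:Z) = in_span_next M x t.
Proof.
move=> tn; rewrite /fV lerD2l lez_nat.
apply/idP/idP => h.
  apply: (in_span_mono h).
  have lt : (find (in_span_next M x) (iota 0 n.+1) < size (iota 0 n.+1))%N.
    by rewrite size_iota; apply: leq_ltn_trans h _; rewrite ltnS.
  have := nth_find 0%N (_ : has (in_span_next M x) (iota 0 n.+1)).
  by rewrite has_find nth_iota ?add0n; [apply | move: lt; rewrite size_iota].
rewrite leqNgt; apply/negP => lt; have := before_find 0%N lt.
by rewrite nth_iota ?add0n ?h.
Qed.

Lemma rank_rf M f x m : (forall i, fV M i = f i) -> (m <= n)%N ->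
  \rank (blk M x m) = rf f x m.
Proof.
move=> fM; elim: m x => [|m IH] x mn.
  by rewrite [blk _ _ _]flatmx0 mxrank0 /rf big_ord0.
rewrite rank_cons rfS IH ?(ltnW mn) // -fV_leE ?(ltnW mn) // fM.
by congr (nat_of_bool _ + _)%N; lia.
Qed.

Lemma in_span_n M x : in_span_next M x n.
Proof.
rewrite in_spanE; have -> : rw M x = rw M (x + n%:Z) by rewrite /rw -[n%:Z]mul1r vcol_per.
by apply: rw_blk; lia.
Qed.

Lemma fV_rf M f : (forall i, i <= f i <= i + n%:Z) ->
  (forall x m, (m <= n)%N -> \rank (blk M x m) = rf f x m) -> forall i, fV M i = f i.
Proof.
move=> bnd rk i.
have E t : (t <= n)%N -> (fV M i <= i + t%:Z) = (f i <= i + t%:Z).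
  rewrite leq_eqVlt => /predU1P[->|tn].
    by rewrite fV_leE // in_span_n; have := bnd i; lia.
  rewrite fV_leE ?(ltnW tn) //.
  have := rank_cons M i t; rewrite !rk ?(ltnW tn) // rfS => /eqP.
  by rewrite eqn_add2r; case: in_span_next; lia.
have b1 := bnd i.
have b2 : i <= fV M i by rewrite /fV; lia.
have := E `|f i - i|%N; have := E `|fV M i - i|%N.
have b3 : fV M i <= i + n%:Z by rewrite fV_leE // in_span_n.
by lia.
Qed.

Lemma rank_blk_full M : \rank (blk M 0 n) = \rank M.
Proof.
rewrite -mxrank_tr; congr (\rank _); apply/matrixP => i j.
by rewrite !mxE add0r vcol_ord !mxE.
Qed.

Definition mk (a : nat -> 'rV[K]_k) : 'M[K]_(k, n) := \matrix_(i, j) a j 0 i.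

Lemma rw_mk a (u : nat) : (u < n)%N -> rw (mk a) u%:Z = a u.
Proof.
move=> un; apply/rowP => i.
by rewrite /rw (vcol_ord _ (Ordinal un)) !mxE.
Qed.

Lemma mk_rw M : M = mk (fun u => rw M u%:Z).
Proof. by apply/matrixP => i j; rewrite !mxE vcol_ord !mxE. Qed.

Lemma spanP M x m v : (v <= blk M x m)%MS ->
  exists y : nat -> K, v = \sum_(i < m) y i *: rw M (x + i%:Z).
Proof.
move=> /submxP[y ->]; exists (fun i => if insub i is Some j then y 0 j else 0).
rewrite mulmx_sum_row; apply: eq_bigr => i _.
by rewrite valK row_blk.
Qed.

End Cols.
End LinAlg.

Lemma sum_tail (V : zmodType) (F : nat -> V) (u m s : nat) :
  \sum_(i < m | (s < i)%N) F (u + i)%N = \sum_((u + s.+1)%N <= i < (u + m)%N) F i.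
Proof.
rewrite [(u + s.+1)%N]addnC big_addn addKn big_geq_mkord /=.
by apply: eq_big => i //; rewrite addnC.
Qed.

Lemma sum_window (V : zmodType) (F : nat -> V) (n u m : nat) : (u + m <= n)%N ->
  (forall i, ~~ (u <= i < u + m)%N -> F i = 0) -> \sum_(i < n) F i = \sum_(j < m) F (u + j)%N.
Proof.
move=> le F0; rewrite -(big_mkord xpredT F) (@big_cat_nat _ _ _ u) //=; last by lia.
rewrite big_nat big1 ?add0r; last by move=> i hi; apply: F0; lia.
rewrite (@big_cat_nat _ _ _ (u + m)) //=; last by lia.
rewrite [X in _ + X]big_nat [X in _ + X]big1 ?addr0; last by move=> i hi; apply: F0; lia.
by rewrite -{1}[u]add0n big_addn addKn big_mkord; apply: eq_bigr => j _; rewrite addnC.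
Qed.

Section Window.
Variables (K : fieldType) (u m : nat).

Definition wext (w : 'rV[K]_m) (i : nat) : K :=
  if (u <= i)%N then (if insub (i - u)%N is Some j then w 0 j else 0) else 0.

Lemma wextE w (j : 'I_m) : wext w (u + j)%N = w 0 j.
Proof. by rewrite /wext leq_addr addKn valK. Qed.

Lemma wext0 w i : ~~ (u <= i < u + m)%N -> wext w i = 0.
Proof. by move=> h; rewrite /wext; case: ifP => // ui; rewrite insubF //; lia. Qed.

Lemma wext_row (r : nat -> K) i : (forall i, ~~ (u <= i < u + m)%N -> r i = 0) ->
  wext (\row_(j < m) r (u + j)%N) i = r i.
Proof.
move=> r0; have [h|h] := boolP (u <= i < u + m)%N; last by rewrite wext0 // r0.
have jm : (i - u < m)%N by lia.
have -> : i = (u + Ordinal jm)%N by rewrite /=; lia.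
by rewrite wextE mxE.
Qed.

Lemma wext_blk (k n : nat) (M : 'M[K]_(k, n)) w : (u + m <= n)%N ->
  w *m blk M u%:Z m = \sum_(i < n) wext w i *: rw M i%:Z.
Proof.
move=> le; rewrite mulmx_sum_row (@sum_window _ (fun i => wext w i *: rw M i%:Z) _ _ _ le); last by move=> i /wext0->; rewrite scale0r.
by apply: eq_bigr => j _; rewrite wextE row_blk PoszD.
Qed.

Lemma wext_col (n : nat) (eta : nat -> K) w : (u + m <= n)%N ->
  w *m (\col_(s < m) eta (u + s)%N) = (\sum_(i < n) wext w i * eta i)%:M.
Proof.
move=> le; apply/matrixP => i j; rewrite !ord1 !mxE eqxx mulr1n (@sum_window _ (fun i => wext w i * eta i) _ _ _ le).
  by apply: eq_bigr => l _; rewrite wextE mxE.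
by move=> l /wext0->; rewrite mul0r.
Qed.
End Window.

Lemma cyc_window (n u m : nat) (l : int) : (0 < n)%N -> (u < n)%N -> (m <= n)%N ->
  u%:Z <= l < u%:Z + m%:Z ->
  exists2 v, (v < n)%N & (l = v%:Z /\ (u <= v)%N) \/ (l = v%:Z + 1 * n%:Z /\ (v < u + m - n)%N).
Proof.
move=> n0 un mn hl; have [lt|ge] := ltP l n%:Z.
  by exists `|l|%N; [lia | left; lia].
by exists `|l - n%:Z|%N; [lia | right; lia].
Qed.

(** * A line through a point that changes each ordinary window by rank one *)

Section Perturb.
Variables (K : fieldType) (k n : nat).
Hypothesis n0 : (0 < n)%N.
Variables (a : nat -> 'rV[K]_k) (x eta : nat -> K).

Definition sg y : K := \sum_(0 <= l < y) x l * eta l.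
(** The direction of the line. The off-diagonal part is the upper triangle of the rank-one matrix
    eta x^T acting on the columns. The partial sums on the diagonal are chosen so that, in every
    ordinary window, the triangular factor [G] below has eta as an eigenvector, with eigenvalue 1 +
    t * sg (u + m). *)
Definition dl j : 'rV[K]_k :=
  sg j.+1 *: a j + eta j *: \sum_(j.+1 <= i < n) x i *: a i.
Let M := mk n a.
Let M' := mk n dl.

Lemma rw_pert t (u : nat) : (u < n)%N -> rw (M + t *: M') u%:Z = a u + t *: dl u.
Proof.
move=> un; rewrite -[in RHS](rw_mk n0 a un) -[in RHS](rw_mk n0 dl un) -/M -/M'.
by apply/rowP => i; rewrite /rw !(vcol_ord n0 _ (Ordinal un)) !mxE.
Qed.

(** [G] collects the terms that stay inside the window; what leaves it is t times eta times the tail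
    z. As eta is an eigenvector of [G], this remainder can be pulled through [G], which produces the
    denominator of the coefficient. [G] is triangular with diagonal entries 1 + t * sg, so it does
    not affect ranks. *)
Lemma pert_factor t (u m : nat) : (u + m <= n)%N -> (forall y, (y <= n)%N -> 1 + t * sg y != 0) ->
  exists2 G : 'M[K]_m, G \in unitmx &
  blk (M + t *: M') u%:Z m = G *m (blk M u%:Z m +
    (t / (1 + t * sg (u + m))) *: ((\col_s eta (u + s)%N) *m (\sum_((u + m)%N <= i < n) x i *: a i))).
Proof.
move=> umn nz; set z := \sum_(_ <= i < n) _; set tau := t / _.
have tauE : tau * (1 + t * sg (u + m)) = t by rewrite /tau divfK ?nz.
pose G : 'M[K]_m := \matrix_(s, s') ((s' == s)%:R * (1 + t * sg (u + s).+1)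
   + (s < s')%N%:R * (t * eta (u + s)%N * x (u + s')%N)).
exists G.
  rewrite -unitmx_tr unitmxE det_trig.
    rewrite unitfE; apply/prodf_neq0 => s _; rewrite !mxE eqxx ltnn mul1r mul0r addr0.
    by apply: nz; have := ltn_ord s; lia.
  apply/is_trig_mxP => i j ij; rewrite !mxE.
  have -> : (i == j) = false by rewrite -val_eqE /=; lia.
  have -> : (j < i)%N = false by lia.
  by rewrite !mul0r addr0.
apply/row_matrixP => s; rewrite row_blk row_mul.
have sm := ltn_ord s.
have -> : u%:Z + s%:Z = (u + s)%N%:Z by lia.
rewrite rw_pert; last by lia.
rewrite mulmx_sum_row.
have rowX (s' : 'I_m) : row s' (blk M u%:Z m + tau *: ((\col_s0 eta (u + s0)%N) *m z)) =
   a (u + s')%N + (tau * eta (u + s')%N) *: z.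
  rewrite linearD /= row_blk; congr (_ + _).
    have -> : u%:Z + s'%:Z = (u + s')%N%:Z by lia.
    by rewrite rw_mk //; have := ltn_ord s'; lia.
  rewrite linearZ /= row_mul -scalerA; congr (_ *: _); apply/rowP => i.
  by rewrite !mxE big_ord1 !mxE.
under eq_bigr do rewrite rowX !mxE scalerDl.
rewrite big_split /=.
rewrite (bigD1 s) //= eqxx mul1r big1 ?addr0; last first.
  by move=> i /negPf ->; rewrite mul0r scale0r.
have -> : \sum_(i < m) ((s < i)%N%:R * (t * eta (u + s)%N * x (u + i)%N)) *: (a (u + i)%N + (tau * eta (u + i)%N) *: z)
  = (t * eta (u + s)%N) *: (\sum_((u + s.+1)%N <= i < (u + m)%N) x i *: a i
     + (tau * \sum_((u + s.+1)%N <= i < (u + m)%N) x i * eta i) *: z).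
  rewrite mulr_sumr scaler_suml -big_split /= scaler_sumr -sum_tail big_mkcond /=.
  rewrite [in RHS]big_mkcond; apply: eq_bigr => i _; case: ifP => _; last by rewrite mul0r scale0r.
  by rewrite mul1r !scalerDr !scalerA; congr (_ *: _ + _ *: _); ring.
rewrite /dl.
have -> : \sum_((u + s).+1 <= i < n) x i *: a i =
   \sum_((u + s.+1)%N <= i < (u + m)%N) x i *: a i + z.
  by rewrite -addnS (@big_cat_nat _ _ _ (u + m)%N) //=; lia.
have sgE : sg (u + m) = sg (u + s).+1 + \sum_((u + s.+1)%N <= i < (u + m)%N) x i * eta i.
  by rewrite /sg (@big_cat_nat _ _ _ (u + s).+1) //= ?addnS //; lia.
move: tauE; rewrite sgE; clearbody z tau.
move: (\sum_(_ <= i < _) x i * eta i) (\sum_(_ <= i < _) x i *: a i) => sx S1 tauE.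
apply/rowP => i; rewrite !mxE.
move: (a _ 0 i) (S1 0 i) (z 0 i) (sg _) (eta _) tauE => av Si zi s1 e tauE.
transitivity (av + t * (s1 * av) + t * e * Si + e * zi * t); first by ring.
by rewrite -{3}tauE; ring.
Qed.
(** A wrapped window contains column n - 1 together with an initial segment. The tail sum in [dl v]
    either stays in the final segment or equals column n - 1 minus a combination of the initial one,
    so no new direction appears. *)
Lemma pert_wrap t (u m : nat) : (u < n)%N -> (m <= n)%N -> (n < u + m)%N ->
  a n.-1 = \sum_(0 <= i < n) x i *: a i ->
  (blk (M + t *: M')%R u%:Z m <= blk M u%:Z m)%MS.
Proof.
move=> un mn gt xE; apply/(blk_subP n0) => l /(cyc_window n0 un mn)[v vn].
have ra i : (i < n)%N -> rw M i%:Z = a i by move=> h; exact: rw_mk.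
have an : (a n.-1 <= blk M u%:Z m)%MS.
  by rewrite -ra; [apply: rw_blk => //; clear -un gt; lia | clear -un; lia].
have fin : (forall i, (i < n)%N -> (i == v) || (v < i)%N -> (a i <= blk M u%:Z m)%MS) \/
           (forall i, (i <= v)%N -> (a i <= blk M u%:Z m)%MS) ->
  (rw (M + t *: M')%R v%:Z <= blk M u%:Z m)%MS.
  move=> H.
  have av : (a v <= blk M u%:Z m)%MS by case: H => h; apply: h; rewrite ?eqxx.
  rewrite rw_pert // addmx_sub //; apply: scalemx_sub; rewrite /dl addmx_sub //; apply: scalemx_sub => //.
  case: H => H.
    by rewrite big_nat; apply: summx_sub => i /andP[vi in_]; apply: scalemx_sub; apply: H; rewrite ?vi ?orbT.
  have -> : \sum_(v.+1 <= i < n) x i *: a i = a n.-1 - \sum_(0 <= i < v.+1) x i *: a i.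
    by rewrite xE [X in _ = X - _](@big_cat_nat _ _ _ v.+1) //= [X in _ = X - _]addrC addrK.
  rewrite addmx_sub // eqmx_opp big_nat; apply: summx_sub => i /andP[_ hi]; apply: scalemx_sub.
  exact: H.
case=> -[-> hv]; last first.
  rewrite /rw vcol_per; apply: fin; right=> i iv.
  rewrite -ra; last exact: leq_ltn_trans iv vn.
  have -> : rw M i%:Z = rw M (i%:Z + 1 * n%:Z) by rewrite /rw vcol_per.
  by apply: rw_blk => //; clear -iv hv gt vn un; lia.
apply: fin; left=> i in_ iv; rewrite -ra //; apply: rw_blk => //.
by clear -in_ iv hv gt un; lia.
Qed.
End Perturb.

Section RankUpdate.
Variables (K : fieldType) (m k : nat) (B : 'M[K]_(m, k)) (e : 'cV[K]_m) (z : 'rV[K]_k).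

Lemma rank_update_ker : (forall w : 'rV_m, w *m B = 0 -> w *m e = 0) ->
  forall tau, (\rank (B + tau *: (e *m z))%R <= \rank B)%N.
Proof.
move=> h tau.
have : (kermx B <= kermx (B + tau *: (e *m z))%R)%MS.
  apply/row_subP => i; apply/sub_kermxP; rewrite mulmxDr -scalemxAr mulmxA h.
    by rewrite mul0mx scaler0 addr0; apply/sub_kermxP; exact: row_sub.
  by apply/sub_kermxP; exact: row_sub.
move/mxrankS; rewrite !mxrank_ker.
by have := rank_leq_row B; have := rank_leq_row (B + tau *: (e *m z))%R; lia.
Qed.

Lemma rank_update_up tau (w0 : 'rV_m) : tau != 0 -> ~~ (z <= B)%MS -> w0 *m B = 0 ->
  w0 *m e = 1%:M -> \rank (B + tau *: (e *m z))%R = (\rank B).+1.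
Proof.
move=> t0 nz w0B w0e; apply/eqP; rewrite eqn_leq; apply/andP; split.
  apply: leq_trans (mxrank_add _ _) _; rewrite -[(\rank B).+1]addn1 leq_add2l.
  apply: leq_trans (mxrank_scale _ _) _; apply: leq_trans (mxrankM_maxr _ _) _.
  exact: rank_leq_row.
have le : (kermx (B + tau *: (e *m z))%R <= kermx B)%MS.
  apply/row_subP => i; set w := row i _.
  have : w *m (B + tau *: (e *m z)) = 0 by apply/sub_kermxP; exact: row_sub.
  rewrite mulmxDr -scalemxAr mulmxA [w *m e]mx11_scalar mul_scalar_mx => E.
  apply/sub_kermxP; have [e0|ne0] := eqVneq ((w *m e) 0 0) 0.
    by move: E; rewrite e0 scale0r scaler0 addr0.
  case/negP: nz; have : z = (- (tau * (w *m e) 0 0)^-1) *: (w *m B).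
    move/eqP: E; rewrite addr_eq0 => /eqP->; rewrite scalerN scaleNr opprK !scalerA.
    by rewrite mulVf ?scale1r // mulf_neq0.
  by move=> ->; rewrite scalemx_sub // submxMl.
have lt : (kermx (B + tau *: (e *m z))%R < kermx B)%MS.
  rewrite ltmxE le /=; apply/negP => h.
  have : (w0 <= kermx (B + tau *: (e *m z))%R)%MS.
    by apply: submx_trans h; apply/sub_kermxP.
  move/sub_kermxP; rewrite mulmxDr w0B add0r -scalemxAr mulmxA w0e mul1mx => /eqP.
  rewrite scaler_eq0 (negPf t0) /= => /eqP z0.
  by case/negP: nz; rewrite z0 sub0mx.
move/rank_ltmx: lt; rewrite !mxrank_ker.
by have := rank_leq_row B; have := rank_leq_row (B + tau *: (e *m z))%R; lia.
Qed.
End RankUpdate.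

(** * Strata of exchanged permutations lie in the closure *)

Section Closure0.
Variables (K : fieldType) (k n : nat).
Hypothesis n0 : (0 < n)%N.
Variables (f : int -> int) (q : nat) (M : 'M[K]_(k, n)).
Hypotheses (gf : good k n f) (h1 : q%:Z <= f (-1)) (h2 : f (-1) < f q%:Z)
  (h3 : f q%:Z <= n%:Z - 1) (fM : forall i, fV M i = swap0 n f q i).

Let a (u : nat) := rw M u%:Z.
(** M lies in the exchanged stratum, so b = f q is its value at -1 and c = f (-1) its value at q. *)
Let b := `|f q%:Z|%N.
Let c := `|f (-1)|%N.

Let qc : (q <= c)%N. Proof. by rewrite /c; lia. Qed.
Let cb : (c < b)%N. Proof. by rewrite /c /b; lia. Qed.
Let bn : (b < n)%N. Proof. by rewrite /b; lia. Qed.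

Let fVm1 : fV M (-1) = b%:Z.
Proof.
have -> : (-1)%R = (n.-1%:Z + (-1) * n%:Z)%R by lia.
rewrite fM swap0E; last by lia.
by rewrite eqxx /b; lia.
Qed.

Let fVq : fV M q%:Z = c%:Z.
Proof.
have {1}-> : q%:Z = (q%:Z + 0 * n%:Z)%R by lia.
rewrite fM swap0E; last by lia.
have -> : (q == n.-1)%N = false by lia.
by rewrite eqxx /c; lia.
Qed.

Let last_span : (a n.-1 <= blk M 0 b.+1)%MS /\ ~~ (a n.-1 <= blk M 0 b)%MS.
Proof.
have e : rw M (-1) = a n.-1.
  have -> : (-1)%R = (n.-1%:Z + (-1) * n%:Z)%R by lia.
  by rewrite /rw vcol_per.
have E t : in_span_next M (-1) t = (a n.-1 <= blk M 0 t)%MS by rewrite in_spanE addNr e.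
by rewrite -!E -!fV_leE ?fVm1; lia.
Qed.

Let q_span : (a q <= blk M (q%:Z + 1) (c - q))%MS /\
  ((q < c)%N -> ~~ (a q <= blk M (q%:Z + 1) (c - q).-1)%MS).
Proof.
have E t : in_span_next M q%:Z t = (a q <= blk M (q%:Z + 1) t)%MS by [].
by rewrite -!E -!fV_leE ?fVq; lia.
Qed.

Let ex_x : exists2 x : nat -> K, (forall i, (b < i)%N -> x i = 0) &
  a n.-1 = \sum_(0 <= i < n) x i *: a i.
Proof.
have [/spanP[y ->] _] := last_span.
exists (fun i => if (i <= b)%N then y i else 0).
  by move=> i bi; rewrite leqNgt bi.
rewrite (@big_cat_nat _ _ _ b.+1) //= [X in _ = _ + X]big_nat [X in _ = _ + X]big1 ?addr0.
  rewrite big_mkord; apply: eq_bigr => i _; have -> : (i <= b)%N by rewrite -ltnS.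
  by rewrite add0r.
by move=> i hi; have -> : (i <= b)%N = false by [lia]; rewrite scale0r.
Qed.

Let ex_rho : exists r : nat -> K, [/\ forall i, ~~ (q <= i <= c)%N -> r i = 0, r c != 0 &
  \sum_(i < n) r i *: a i = 0].
Proof.
have [/spanP[y ay] nq] := q_span.
exists (fun i => if i == q then 1 else if (q < i <= c)%N then - y (i - q.+1)%N else 0); split.
- by move=> i h; rewrite !ifF //; lia.
- rewrite /=; have [e|ne] := eqVneq c q; first by rewrite oner_neq0.
  have qc' : (q < c)%N by lia.
  rewrite qc' leqnn /= oppr_eq0; apply/negP => /eqP y0.
  case/negP: (nq qc'); rewrite ay.
  have [l el] : exists l, (c - q = l.+1)%N by exists (c - q.+1)%N; lia.
  rewrite el big_ord_recr /=.
  have -> : l = (c - q.+1)%N by lia.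
  rewrite y0 scale0r addr0; apply: summx_sub => i _; apply: scalemx_sub; apply: rw_blk => //.
  by have := ltn_ord i; lia.
rewrite -(big_mkord xpredT (fun i => (if i == q then 1 else if (q < i <= c)%N then - y (i - q.+1)%N else 0) *: a i)).
rewrite (@big_cat_nat _ _ _ q) //=; last by lia.
rewrite big_nat big1 ?add0r; last by move=> i hi; rewrite !ifF ?scale0r //; lia.
rewrite big_ltn; last by lia.
rewrite eqxx scale1r (@big_cat_nat _ _ _ c.+1) //=; last by lia.
rewrite [X in _ + (_ + X)]big_nat [X in _ + (_ + X)]big1 ?addr0; last first.
  by move=> i hi; rewrite !ifF ?scale0r //; lia.
rewrite ay -[q.+1]add0n big_addn subSS big_mkord -big_split /= big1 // => i _.
have := ltn_ord i => ic.
rewrite ifF; last by lia.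
rewrite ifT; last by lia.
rewrite addnK scaleNr /a.
have -> : (i + q.+1)%N%:Z = q%:Z + 1 + i%:Z by lia.
by rewrite subrr.
Qed.

(** Such an eta exists because r is not in the span of the relations supported strictly between q
    and b and of the unit vectors below c. Otherwise some such relation would agree with r from c
    on, hence end at c with a nonzero coefficient, which is absurd at once if q = c. Column c would
    then depend on the columns strictly between q and c, against the minimality of c for column
    q. *)
Let ex_eta : exists eta : nat -> K, exists r : nat -> K,
  [/\ forall i, (i < c)%N -> eta i = 0,
      forall i, ~~ (q <= i <= c)%N -> r i = 0,
      \sum_(i < n) r i *: a i = 0, \sum_(i < n) r i * eta i = 1 &
      forall w : nat -> K, (forall i, ~~ (q < i < b)%N -> w i = 0) ->
        \sum_(i < n) w i *: a i = 0 -> \sum_(i < n) w i * eta i = 0].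
Proof.
have [r [rs rc rk0]] := ex_rho.
pose A0 : 'M[K]_(n, k) := \matrix_(i < n) a i.
pose D0 : 'M[K]_n := diag_mx (\row_i (~~ (q < i < b)%N)%:R).
pose Ec : 'M[K]_n := diag_mx (\row_i (i < c)%N%:R).
pose S := (kermx (row_mx A0 D0) + Ec)%MS.
pose rv : 'rV[K]_n := \row_i r i.
have linE (w : 'rV[K]_n) : w *m A0 = \sum_(i < n) w 0 i *: a i.
  by rewrite mulmx_sum_row; apply: eq_bigr => i _; rewrite rowK.
have nS : ~~ (rv <= S)%MS.
  apply/negP => /sub_addsmxP[[u1 u2]] /=; set w := u1 *m _ => rE.
  have : w *m row_mx A0 D0 = 0 by rewrite -mulmxA mulmx_ker mulmx0.
  rewrite mul_mx_row => /eqP; rewrite row_mx_eq0 => /andP[/eqP wA /eqP wD].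
  have w0 (i : 'I_n) : ~~ (q < i < b)%N -> w 0 i = 0.
    by move=> h; have /rowP/(_ i) := wD; rewrite mul_mx_diag !mxE h mulr1.
  have wr (i : 'I_n) : (c <= i)%N -> w 0 i = r i.
    move=> h; have /rowP/(_ i) := rE; rewrite [rv 0 i]mxE => ->.
    by rewrite [RHS]mxE mul_mx_diag !mxE ltnNge h mulr0 addr0.
  have cn : (c < n)%N by lia.
  have wc : w 0 (Ordinal cn) != 0 by rewrite wr.
  have qc' : (q < c)%N.
    by have := w0 (Ordinal cn); case: (ltnP q c) => // le h; rewrite h ?eqxx in wc => //=; lia.
  have [aq nq] := q_span; case/negP: (nq qc').
  apply: submx_trans aq _; apply/blk_subP => // l hl.
  have [lc|ne] := eqVneq l c%:Z; last by apply: rw_blk => //; lia.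
  have E : a c = (- (w 0 (Ordinal cn))^-1) *: \sum_(i < n | i != Ordinal cn) w 0 i *: a i.
    move: wA; rewrite linE (bigD1 (Ordinal cn)) //= => /eqP; rewrite addr_eq0 => /eqP e.
    by rewrite scaleNr -scalerN -e scalerA mulVf // scale1r.
  rewrite lc -/(a c) E; apply: scalemx_sub; apply: summx_sub => i ic.
  have [hi|nhi] := boolP (q < i < c)%N.
    by apply: scalemx_sub; apply: rw_blk => //; lia.
  suff -> : w 0 i = 0 by rewrite scale0r sub0mx.
  have ic' : (i != c :> nat) by rewrite -[c]/(val (Ordinal cn)) val_eqE.
  have [le|lt] := leqP c i; first by rewrite wr // rs //; lia.
  by apply: w0; lia.
move: nS; rewrite submxE => /eqP/rowP/eqfunP.
rewrite negb_forall => /existsP[j]; rewrite [(0 : 'rV_n) 0 j]mxE => nz.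
set N := (rv *m cokermx S) 0 j in nz.
exists (fun i => if insub i is Some i' then N^-1 * cokermx S i' j else 0), r.
have etaE (i : 'I_n) : (if insub (i : nat) is Some i' then N^-1 * cokermx S i' j else 0) = N^-1 * cokermx S i j.
  by rewrite valK.
have sumE (w : nat -> K) : \sum_(i < n) w i * (if insub (i : nat) is Some i' then N^-1 * cokermx S i' j else 0)
    = N^-1 * ((\row_(i < n) w i) *m cokermx S) 0 j.
  rewrite mxE mulr_sumr; apply: eq_bigr => i _; rewrite etaE !mxE; ring.
split=> //.
- move=> i ic; have in_ : (i < n)%N by lia.
  rewrite -[i]/(val (Ordinal in_)) etaE.
  have : (row (Ordinal in_) Ec *m cokermx S == 0).
    rewrite -submxE; apply: submx_trans (row_sub _ _) _; exact: addsmxSr.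
  rewrite row_diag_mx mxE /= ic scale1r -rowE => /eqP/rowP/(_ j); rewrite !mxE => ->.
  by rewrite mulr0.
- by rewrite sumE -/rv -/N mulVf.
- move=> w ws wa; rewrite sumE.
  suff : ((\row_(i < n) w i) *m cokermx S == 0) by move/eqP->; rewrite mxE mulr0.
  rewrite -submxE; apply: submx_trans (addsmxSl _ _); apply/sub_kermxP.
  rewrite mul_mx_row linE; apply/eqP; rewrite row_mx_eq0; apply/andP; split; apply/eqP.
    by rewrite -[RHS]wa; apply: eq_bigr => i _; rewrite mxE.
  apply/rowP => i; rewrite mul_mx_diag !mxE; case: (boolP (q < i < b)%N) => h; first by rewrite mulr0.
  by rewrite ws // mul0r.
Qed.

(* A point of the stratum of [swap0 n f q] is a limit of points of the stratum of f. *)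
Lemma closure0 : exists (D : 'M[K]_(k, n)) (w : {poly K}), w != 0 /\
  forall t, w.[t] != 0 -> \rank (M + t *: D)%R = k /\ forall i, fV (M + t *: D) i = f i.
Proof.
have [x xb xE] := ex_x.
have [eta [r [eta0 rs ra reta etaker]]] := ex_eta.
pose D := mk n (dl n a x eta).
have MA : M = mk n a by rewrite {1}(mk_rw n0 M).
have pw (p : 'I_n * 'I_n.+1) : exists w : {poly K}, w != 0 /\
    forall t, w.[t] != 0 -> (\rank (blk M p.1%:Z p.2) <= \rank (blk (M + t *: D)%R p.1%:Z p.2))%N.
  case: p => u m /=.
  have [w w0 wt] := rank_generic (blk M u%:Z m) (blk D u%:Z m).
  exists w; split=> // t /wt; congr (_ <= \rank _)%N; apply/row_matrixP => i.
  rewrite linearD linearZ /= !row_blk; apply/rowP => j.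
  have [v [s [vn ->]]] := modn_dec n0 (u%:Z + i%:Z).
  by rewrite /rw !vcol_per !(vcol_ord n0 _ (Ordinal vn)) !mxE.
have [W WE] := fin_all_exists pw.
(* Excluded are t = 0, where the rank-one update vanishes, the zeros of the factors 1 + t * sg y,
   and the parameters at which some window could lose rank. *)
exists D, ('X * (\prod_(y < n.+1) (1 + (sg x eta y) *: 'X)) * \prod_p W p); split.
  rewrite !mulf_neq0 ?polyX_eq0 //.
    apply/prodf_neq0 => y _; apply/eqP => /(congr1 (fun p : {poly K} => p.[0])).
    by rewrite !hornerE => /eqP; rewrite oner_eq0.
  by apply/prodf_neq0 => p _; have [] := WE p.
move=> t; rewrite !hornerM !mulf_eq0 !negb_or hornerX !horner_prod => /andP[/andP[t0 sgn] wn].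
have sg0 y : (y <= n)%N -> 1 + t * sg x eta y != 0.
  move=> yn; move/prodf_neq0: sgn => /(_ (Ordinal (yn : y < n.+1)%N) isT).
  by rewrite !hornerE mulrC.
have lower (u m : nat) : (u < n)%N -> (m <= n)%N ->
  (\rank (blk M u%:Z m) <= \rank (blk (M + t *: D)%R u%:Z m))%N.
  move=> un mn; have [_] := WE (Ordinal un, Ordinal (mn : m < n.+1)%N); apply.
  by move/prodf_neq0: wn; apply.
have ranks (u m : nat) : (u < n)%N -> (m <= n)%N -> \rank (blk (M + t *: D)%R u%:Z m) = rf f u%:Z m.
  move=> un mn.
  rewrite (rf_swap0 n0 (good_per gf) un mn h1 h2 h3) -(rank_rf n0 _ fM mn).
  have -> : (u <= q)%N && (f (-1) < u%:Z + m%:Z <= f q%:Z) = [&& (u <= q)%N, (c < u + m)%N & (u + m <= b)%N].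
    by rewrite /b /c; lia.
  have [le|gt] := leqP (u + m)%N n; last first.
    have -> : [&& (u <= q)%N, (c < u + m)%N & (u + m <= b)%N] = false.
      by move: bn gt; clear; lia.
    rewrite addn0; apply/eqP; rewrite eqn_leq lower // andbT; apply: mxrankS.
    by rewrite [in (M + _)]MA [in X in (_ <= X)%MS]MA; apply: pert_wrap.
  have [G uG GE] := @pert_factor _ _ _ n0 a x eta _ _ _ le sg0.
  have {}GE : blk (M + t *: D) u%:Z m = G *m (blk M u%:Z m +
    (t / (1 + t * sg x eta (u + m))) *: ((\col_(s < m) eta (u + s)%N) *m (\sum_((u + m)%N <= i < n) x i *: a i))).
    by rewrite [in LHS]MA GE -MA.
  have rG A : \rank (G *m A) = \rank (A : 'M_(m, k)) by rewrite (eqmxMfull _ (_ : row_full G)) // row_full_unit.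
  have lw := lower u m un mn; rewrite GE rG in lw *.
  move: lw; set tau := t / _; set e := \col_s _; set z := \sum_(_ <= i < n) _ => lw.
  have tau0 : tau != 0 by rewrite /tau mulf_neq0 // invr_eq0 sg0.
  have zsub : (u + m <= b)%N -> ~~ (z <= blk M u%:Z m)%MS.
    move=> yb; have [_ nb] := last_span; apply: contra nb => zB.
    rewrite xE (@big_cat_nat _ _ _ (u + m)) //= addmx_sub //.
      rewrite big_nat; apply: summx_sub => i hi; apply: scalemx_sub; apply: rw_blk => //.
      by clear -hi yb; lia.
    apply: submx_trans zB _; apply/(blk_subP n0) => l hl; apply: rw_blk => //.
    by clear -hl yb; lia.
  have lin1 (w : 'rV[K]_m) : w *m blk M u%:Z m = \sum_(i < n) wext u w i *: a i by exact: wext_blk.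
  have lin2 (w : 'rV[K]_m) : w *m e = (\sum_(i < n) wext u w i * eta i)%:M by exact: wext_col.
  (* Only windows with u <= q and c < u + m <= b may gain a dimension. If u + m <= c then e = 0; if
     u + m > b then z = 0; if the window starts after q, all its relations are killed by eta. In the
     remaining case r is a relation on which eta takes the value 1. *)
  have [yc|cy] := leqP (u + m)%N c.
    rewrite andbF addn0; suff -> : e = 0 by rewrite mul0mx scaler0 addr0.
    by apply/matrixP => i j; rewrite !mxE eta0 //; have := ltn_ord i; clear -yc; lia.
  have [yb|yb] := leqP (u + m)%N b; last first.
    rewrite !andbF addn0; suff -> : z = 0 by rewrite mulmx0 scaler0 addr0.
    by rewrite /z big_nat big1 // => i hi; rewrite xb ?scale0r //; clear -hi yb; lia.
  have [uq|uq] := leqP u q; last first.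
    rewrite addn0; apply/eqP; rewrite eqn_leq lw andbT.
    apply: rank_update_ker => w wB; rewrite lin2 etaker.
    - by apply/matrixP => i j; rewrite !mxE mul0rn.
    - by move=> i hi; apply: wext0; move: hi; clear -uq yb; lia.
    - by rewrite -lin1.
  have rext i : wext u (\row_(j < m) r (u + j)%N) i = r i.
    by apply: wext_row => l hl; apply: rs; move: hl; clear -uq cy; lia.
  rewrite addn1; apply: (@rank_update_up _ _ _ _ _ _ _ (\row_(j < m) r (u + j)%N)) => //.
  - exact: zsub.
  - by rewrite lin1 -[RHS]ra; apply: eq_bigr => i _; rewrite rext.
  - by rewrite lin2 -reta; congr (_%:M); apply: eq_bigr => i _; rewrite rext.
split.
  rewrite -(rank_blk_full n0) ranks //; exact: good_full gf 0.
apply: (fV_rf n0); first exact: good_bnd gf.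
move=> y m mn; have [u [s [un ->]]] := modn_dec n0 y.
by rewrite blk_per rf_per ?ranks //; exact: good_per gf.
Qed.
End Closure0.

Section Rot.
Variables (K : fieldType) (k n : nat).
Hypothesis n0 : (0 < n)%N.
Implicit Types (M : 'M[K]_(k, n)).

Definition rotM (c : int) M : 'M[K]_(k, n) := \matrix_(i, j) vcol M (j%:Z + c) i 0.

Lemma vcol_rot c M l : vcol (rotM c M) l = vcol M (l + c).
Proof.
have [u [s [un ->]]] := modn_dec n0 l.
rewrite vcol_per addrAC vcol_per (vcol_ord n0 _ (Ordinal un)).
by apply/colP => i; rewrite !mxE.
Qed.

Lemma rotMK c M : rotM (- c) (rotM c M) = M.
Proof.
by apply/matrixP => i j; rewrite mxE vcol_rot subrK (vcol_ord n0) mxE.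
Qed.

Lemma rotMD c M D t : rotM c (M + t *: D) = rotM c M + t *: rotM c D.
Proof.
apply/matrixP => i j; rewrite !mxE.
have [u [s [un ->]]] := modn_dec n0 (j%:Z + c).
by rewrite !vcol_per !(vcol_ord n0 _ (Ordinal un)) !mxE.
Qed.

Lemma fV_rot c M x : fV (rotM c M) x = fV M (x + c) - c.
Proof.
rewrite /fV addrAC addrK; congr (_ + Posz _); apply: eq_find => t.
rewrite /in_span_next vcol_rot; congr (_ <= _)%MS.
by apply/row_matrixP => s; rewrite !rowK vcol_rot !(addrAC _ c).
Qed.

Lemma fV_scale s M x : s != 0 -> fV (s *: M) x = fV M x.
Proof.
move=> s0; rewrite /fV; congr (_ + Posz _); apply: eq_find => t.
have E l : vcol (s *: M) l = s *: vcol M l.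
  have [u [v [un ->]]] := modn_dec n0 l.
  by rewrite !vcol_per !(vcol_ord n0 _ (Ordinal un)); apply/colP => i; rewrite !mxE.
rewrite /in_span_next E linearZ /=.
have -> : \matrix_(i < t) (vcol (s *: M) (x + 1 + i%:Z))^T =
          s *: \matrix_(i < t) (vcol M (x + 1 + i%:Z))^T.
  by apply/row_matrixP => i; rewrite linearZ /= !rowK E linearZ.
by rewrite !eqmx_scale.
Qed.
End Rot.

(** * Limits, scaling and the vanishing ideals *)

Section Char0.
Variable K : fieldType.
Hypothesis charK0 : [pchar K] =i pred0.

Lemma poly_nonroot (p : {poly K}) : p != 0 -> exists t, p.[t] != 0.
Proof.
move=> p0; pose s := [seq i%:R : K | i <- iota 0 (size p)].
have us : uniq s.
  rewrite map_inj_in_uniq ?iota_uniq // => i j _ _.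
  wlog le : i j / (i <= j)%N => [H|].
    by case: (leqP i j) => [/H//|/ltnW/H h e]; apply/esym/h.
  move=> /eqP; rewrite eq_sym -subr_eq0 -natrB // ((pcharf0P K).1 charK0) => h.
  by apply/eqP; rewrite eqn_leq le -subn_eq0.
have [/allP al|/allPn[t _ nr]] := boolP (all (root p) s).
  have := max_poly_roots p0 (introT allP al) us.
  by rewrite size_map size_iota ltnn.
by exists t.
Qed.

Lemma poly_cofinite0 (w P : {poly K}) : w != 0 -> (forall t, w.[t] != 0 -> P.[t] = 0) -> P = 0.
Proof.
move=> w0 h; apply/eqP; apply: contraT => P0.
have [t] := poly_nonroot (mulf_neq0 w0 P0).
by rewrite hornerM mulf_eq0 negb_or => /andP[/h ->]; rewrite eqxx.
Qed.

Section Ideal.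
Variables (k n : nat).
Hypotheses (k0 : (0 < k)%N) (n0 : (0 < n)%N).
Implicit Types (M D : 'M[K]_(k, n)) (p : Rkn K k n).

Lemma meval_line p M D : exists P : {poly K}, forall t, P.[t] = p.@[plvec (M + t *: D)].
Proof.
have ex (i : 'I_(nvars k n)) : exists P : {poly K}, forall t, P.[t] = plvec (M + t *: D) i.
  have [P PE] := poly_det_lin (\matrix_(i0 < k, j < k) M i0 (kth (pvar i) j))
     (\matrix_(i0 < k, j < k) D i0 (kth (pvar i) j)).
  exists P => t; rewrite PE /plvec /pluck; congr (\det _).
  by apply/matrixP => i0 j; rewrite !mxE.
have [Q QE] := fin_all_exists ex.
exists (\sum_(m <- msupp p) (p@_m)%:P * \prod_i Q i ^+ m i) => t.
rewrite mevalE horner_sum; apply: eq_bigr => m _.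
rewrite hornerM hornerC horner_prod; congr (_ * _); apply: eq_bigr => i _.
by rewrite horner_exp QE.
Qed.

(** On the line through a point of the exchanged stratum the polynomial vanishes at all but finitely
    many parameters, since those points lie in the stratum of g; so it vanishes at the point itself.
    Rotation carries the normalised exchange to an arbitrary position. *)
Lemma Jf_step g c q p : good k n g -> q%:Z <= sh g c (-1) -> sh g c (-1) < sh g c q%:Z ->
  sh g c q%:Z <= n%:Z - 1 -> Jf g p -> @Jf K k n (sh (swap0 n (sh g c) q) (- c)) p.
Proof.
move=> gg h1 h2 h3 Jp M rM fM.
have fM1 i : fV (rotM c M) i = swap0 n (sh g c) q i.
  by rewrite fV_rot // fM /sh !opprK addrK addrK.
have [D [w [w0 wE]]] := closure0 n0 (good_sh n0 c gg) h1 h2 h3 fM1.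
have [P PE] := meval_line p M (rotM (- c) D).
suff P0 : P = 0 by have := PE 0; rewrite P0 horner0 scale0r addr0.
apply: (poly_cofinite0 w0) => t /wE[_ ft]; rewrite PE.
have E : M + t *: rotM (- c) D = rotM (- c) (rotM c M + t *: D) by rewrite rotMD // rotMK.
have fE i : fV (M + t *: rotM (- c) D) i = g i.
  by rewrite E fV_rot // ft /sh subrK opprK subrK.
apply: Jp => //.
by rewrite -(rank_blk_full n0) (rank_rf n0 _ fE) // (good_full gg).
Qed.

Lemma Jf_mul f (r p : Rkn K k n) : Jf f p -> Jf f (r * p).
Proof. by move=> Jp M rM fM; rewrite mevalM Jp ?mulr0. Qed.

Definition hcomp d p : Rkn K k n := \sum_(m <- msupp p | mdeg m == d) p@_m *: 'X_[m].

(** Scaling the matrix by s keeps f_V and multiplies each Pluecker coordinate by s^k. The value of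
    the degree d component is thus the coefficient of s^(k d) in a polynomial that vanishes for
    every nonzero s. *)
Lemma Jf_hcomp f d p : Jf f p -> Jf f (hcomp d p).
Proof.
move=> Jp M rM fM; set v := plvec M.
pose ev (m : 'X_{1..nvars k n}) := \prod_i v i ^+ m i.
pose Q : {poly K} := \sum_(m <- msupp p) (p@_m * ev m) *: 'X^(k * mdeg m).
have QE s : s != 0 -> Q.[s] = 0.
  move=> s0; have := Jp (s *: M); rewrite mxrank_scale_nz // => /(_ rM) H.
  rewrite -[RHS]H; last by move=> i; rewrite fV_scale.
  rewrite mevalE horner_sum; apply: eq_bigr => m _.
  rewrite hornerZ hornerXn -mulrA; congr (_ * _).
  rewrite /ev exprM mdegE -prodrXr -big_split.
  apply: eq_bigr => i _ /=; rewrite -exprMn; congr (_ ^+ _).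
  rewrite mulrC /v /plvec /pluck -detZ; congr (\det _).
  by apply/matrixP => i0 j; rewrite !mxE.
have Q0 : Q = 0.
  apply: (@poly_cofinite0 'X); first by rewrite polyX_eq0.
  by move=> t; rewrite hornerX; apply: QE.
have := congr1 (fun P : {poly K} => P`_(k * d)%N) Q0; rewrite /= coef0 coef_sum => E.
rewrite -[RHS]E /hcomp raddf_sum /= big_mkcond /=; apply: eq_bigr => m _.
rewrite coefZ coefXn eqn_pmul2l // eq_sym.
by case: eqP => _; rewrite ?mulr0 // mulr1 mevalZ mevalX.
Qed.
End Ideal.
End Char0.

(** * Tableaux bounded by f are standard *)

Section Lead.
Variables (K : fieldType) (N : nat) (rk : 'I_N -> nat).
Implicit Types (m : 'X_{1..N}) (p q : {mpoly K[N]}).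

Lemma grevlex_addl m m1 m2 : grevlex_lt rk m1 m2 -> grevlex_lt rk (m + m1)%MM (m + m2)%MM.
Proof.
rewrite /grevlex_lt !mdegD => -[lt|[e [i [lt h]]]]; first by left; rewrite ltn_add2l.
right; split; first by rewrite e.
exists i; split; first by rewrite !mnmDE ltn_add2l.
by move=> j ji; rewrite !mnmDE h.
Qed.

(** A monomial of a sum occurs in one of its terms, so some leading monomial divides it; multiplying
    that element of the ideal by the quotient makes the given monomial lead. *)
Lemma init_lead (J : {mpoly K[N]} -> Prop) m :
  (forall r p, J p -> J (r * p)) ->
  initial_ideal rk J 'X_[m] <-> exists2 q, J q & is_lead rk q m.
Proof.
move=> Jm; split=> [[s [sJ e]]|[q Jq lq]]; last first.
  by exists [:: (1, (q, m))]; split=> [t|]; rewrite ?inE ?big_seq1 ?mul1r // => /eqP->.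
have : m \in msupp ('X_[m] : {mpoly K[N]}) by rewrite msuppX inE.
rewrite e => /msupp_sum_le/flatten_mapP[t]; rewrite filter_predT => ts.
rewrite (perm_mem (msuppMX _ _)) => /mapP[m' _ em]; have [Jt lt] := sJ t ts.
exists ('X_[m'] * t.2.1); first exact: Jm.
have {lt}[l1 l2] := lt; rewrite em addmC mulrC; split.
  by rewrite (perm_mem (msuppMX _ _)) map_f.
move=> m1; rewrite (perm_mem (msuppMX _ _)) => /mapP[m2 /l2[->|lt] ->]; first by left.
by right; apply: grevlex_addl.
Qed.
End Lead.

Lemma cmx_rcons (A : eqType) (F : A -> nat -> nat) s a u v : (u <= v)%N ->
  (cmx F s u v <= cmx F (rcons s a) u v)%N.
Proof.
elim: s v => [//|b s IH] v uv; rewrite rcons_cons; apply: cmx_le => w hw.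
have := @cmx_ge _ F b (rcons s a) u v w hw; have := IH w; lia.
Qed.

Section RhoTail.
Variables (k n : nat).
Implicit Types (a b : ksub k n) (s : seq (ksub k n)).

Lemma rho_tail a s x m : (0 < n)%N -> (m <= n)%N -> rho s x m <= rho (a :: s) x m.
Proof.
move=> n0 mn; rewrite /rho; move: `|_|%N (absz_modz_lt x n0) => u un.
rewrite /Rr; case: leqP => h.
  rewrite lez_nat /cc; have := @cmx_ge _ (@cntk k n) a s u (u + m) (u + m)%N.
  by rewrite leq_addr leqnn subnn => /(_ isT).
rewrite lerD2l lez_nat /dd rev_cons; apply: cmx_rcons; lia.
Qed.

Lemma cmx1 (A : eqType) (F : A -> nat -> nat) (a : A) (u v : nat) : {homo F a : x y / (x <= y)%N} ->
  (u <= v)%N -> cmx F [:: a] u v = (F a v - F a u)%N.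
Proof.
move=> mF uv; apply/eqP; rewrite eqn_leq; apply/andP; split.
  by apply: cmx_le => w hw; rewrite /=; have := mF u w; lia.
by have := @cmx_ge _ F a [::] u v u; rewrite /=; lia.
Qed.

Lemma rho1S a (u m : nat) t (un : (u < n)%N) : (m < n)%N ->
  rho [:: a] (u%:Z + t * n%:Z) m.+1 = (Ordinal un \in val a)%:Z + rho [:: a] (u%:Z + t * n%:Z + 1) m.
Proof.
move=> mn; have n0 : (0 < n)%N by lia.
rewrite rhoS //; last by lia.
rewrite /rho.
have -> : ((u%:Z + t * n%:Z) %% n%:Z)%Z = u%:Z by rewrite addrC modzMDl modz_small //; lia.
rewrite absz_nat; have cS := cntS_S (val a) un.
have [le|gt] := leqP (u + m.+1)%N n.
  rewrite /Rr le addSn -addnS le /cc !cmx1; try lia; try exact: cntk_mono.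
  have := cntk_mono a (_ : u.+1 <= u + m.+1)%N; have := cntk_mono a (_ : u <= u + m.+1)%N.
  by move: cS; rewrite -/(cntk a u) -/(cntk a u.+1); case: (_ \in _); lia.
rewrite !Rr_dd //; try lia.
have -> : (u.+1 + m - n = u + m.+1 - n)%N by lia.
rewrite /dd (_ : rev [:: a] = [:: a]) // !cmx1; try lia; try exact: dcntk_mono.
have := dcntk_mono a (_ : u + m.+1 - n <= u)%N; have := dcntk_mono a (leqnSn u).
have := cntk_le a u; have := cntk_le a u.+1.
by move: cS; rewrite /dcntk -/(cntk a u) -/(cntk a u.+1); case: (_ \in _); lia.
Qed.

End RhoTail.

Section Pt.
Variables (K : fieldType) (k n : nat).
Hypothesis n0 : (0 < n)%N.
Variable a : ksub k n.

(** The coordinate subspace of a: the point whose interval ranks realise [rho] of a single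
    column. *)
Definition ptM : 'M[K]_(k, n) := \matrix_(i, j) (kth a i == j)%:R.

Lemma rank_ptM x m : (m <= n)%N -> (\rank (blk ptM x m))%:Z = rho [:: a] x m.
Proof.
elim: m x => [|m IH] x mn.
  by rewrite [blk _ _ _]flatmx0 mxrank0 rho0.
have [u [t [un ->]]] := modn_dec n0 x.
rewrite rho1S // rank_cons // PoszD IH ?(ltnW mn) //; congr (Posz (nat_of_bool _) + _).
rewrite in_spanE.
have rwE l (v : nat) s (vn : (v < n)%N) : l = v%:Z + s * n%:Z ->
    rw ptM l = \row_i (kth a i == Ordinal vn)%:R.
  by move=> ->; rewrite /rw vcol_per (vcol_ord n0 _ (Ordinal vn)); apply/rowP => i; rewrite !mxE.
rewrite (rwE _ _ _ un erefl).
case: (boolP (Ordinal un \in val a)) => ua; last first.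
  apply/negbTE; rewrite negbK; suff -> : \row_i (kth a i == Ordinal un)%:R = 0 :> 'rV[K]_k by rewrite sub0mx.
  apply/rowP => i; rewrite !mxE; case: eqP => // e.
  by move: ua; rewrite -e kth_mem.
have [i ei] := kth_surj ua.
apply/negP => /submxP[y /rowP/(_ i)]; rewrite !mxE ei eqxx big1; first by move/eqP; rewrite oner_eq0.
move=> s _; rewrite [X in _ * X]mxE.
have [v [s' [vn ev]]] := modn_dec n0 (u%:Z + t * n%:Z + 1 + s%:Z).
rewrite (rwE _ _ _ vn ev) mxE ei.
case: eqP => [[uv]|_]; last by rewrite mulr0.
subst v; have ms := ltn_ord s.
(* Column u recurs only after n steps, beyond the m < n columns that follow. *)
have e : (s' - t) * n%:Z = 1 + s%:Z by rewrite mulrBl; lia.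
have h : 0 < s' - t.
  rewrite ltNge; apply/negP => le.
  by have := ler_wpM2r (isT : 0 <= n%:Z) le; rewrite e mul0r; lia.
have h' : 1 <= s' - t by lia.
by have := ler_wpM2r (isT : 0 <= n%:Z) h'; rewrite e mul1r; lia.
Qed.
End Pt.

(** * Pluecker coordinates of a point with prescribed initial ranks *)

Section Flag.
Variables (K : fieldType) (k n : nat).
Hypothesis n0 : (0 < n)%N.
Variables (a : ksub k n) (M : 'M[K]_(k, n)).
Hypothesis rM : forall b, (b <= n)%N -> \rank (blk M 0 b) = cntk a b.

Definition subrows (b : ksub k n) : 'M[K]_k := \matrix_(j < k) rw M (kth b j)%:Z.

Lemma pluck_subrows b : pluck M b = \det (subrows b).
Proof.
rewrite /pluck -det_tr; congr (\det _); apply/matrixP => i j.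
by rewrite !mxE (vcol_ord n0) mxE.
Qed.

(** The rank of the first columns jumps exactly at the elements of a, so the columns indexed by a
    already span everything. *)
Lemma pluck_flag_n0 : pluck M a != 0.
Proof.
have P b : (b <= n)%N -> (blk M 0 b <= subrows a)%MS.
  elim: b => [|b IH] bn; first by rewrite [blk _ _ _]flatmx0 sub0mx.
  have IH' := IH (ltnW bn).
  apply/(blk_subP n0) => l hl; have [lb|ne] := eqVneq l b%:Z; last first.
    by apply: submx_trans IH'; apply: rw_blk => //; lia.
  rewrite lb; have := cntS_S (val a) bn; case: (boolP (_ \in _)) => [/kth_surj[j ej] _|_ e].
    have := row_sub j (subrows a); rewrite rowK ej; exact.
  apply: submx_trans IH'.
  have le : (blk M 0 b <= blk M 0 b.+1)%MS by apply/(blk_subP n0) => y hy; apply: rw_blk => //; lia.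
  have /leqifP := mxrank_leqif_sup le.
  rewrite !rM ?(ltnW bn) // /cntk e addn0 ltnn; case: ifP => // h _.
  by apply: submx_trans h; apply: rw_blk => //; lia.
rewrite pluck_subrows -unitfE -unitmxE -row_full_unit -col_leq_rank.
by apply: leq_trans (mxrankS (P n (leqnn n))); rewrite rM // cntkn.
Qed.

(** If b has more elements below some x than a has, the corresponding columns lie in a space too
    small for them to be independent. *)
Lemma pluck_flag0 b : ~~ pleq a b -> pluck M b = 0.
Proof.
move=> nle; apply/eqP; apply: contraNT nle; rewrite pluck_subrows -unitfE -unitmxE => ub.
apply/pleqP => x; rewrite leqNgt; apply/negP => lt.
have xn : (x <= n)%N.
  rewrite leqNgt; apply/negP => nx; move: lt; rewrite /cntk !cntS_big ?(ltnW nx) //.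
  by rewrite (eqP (valP a)) (eqP (valP b)) ltnn.
set c := cntk b x in lt; have ck : (c <= k)%N by exact: cntk_lek.
pose R2 : 'M[K]_(k - c, k) := \matrix_(j < k - c) rw M (if insub (c + j)%N is Some t then (kth b t)%:Z else 0).
have le : (subrows b <= blk M 0 x + R2)%MS.
  apply/row_subP => j; rewrite rowK; have [jc|cj] := ltnP j c.
    apply: submx_trans (addsmxSl _ _); apply: rw_blk => //.
    by move: jc; rewrite -kth_lt; lia.
  apply: submx_trans (addsmxSr _ _); have jl : (j - c < k - c)%N by have := ltn_ord j; lia.
  have := row_sub (Ordinal jl) R2; rewrite rowK /= subnKC // valK; exact.
have := mxrankS le; rewrite (mxrank_unit ub) => h.
have h2 := (mxrank_adds_leqif (blk M 0 x) R2).1.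
have h3 := rank_leq_row R2; have h4 := rM xn.
by lia.
Qed.
End Flag.

Section Lead2.
Variables (K : fieldType) (N : nat) (rk : 'I_N -> nat).
Implicit Types (m : 'X_{1..N}) (p q : {mpoly K[N]}).

Lemma grevlex_cancel m m1 m2 : grevlex_lt rk (m + m1)%MM (m + m2)%MM -> grevlex_lt rk m1 m2.
Proof.
rewrite /grevlex_lt !mdegD => -[h|[h [i [hi hj]]]]; first by left; lia.
right; split; first by lia.
exists i; split=> [|j /hj]; first by move: hi; rewrite !mnmDE; lia.
by rewrite !mnmDE; lia.
Qed.

(** Monomials without the variable are dropped; this is harmless at points where each of them
    vanishes, as [meval_divX] requires. *)
Definition divX (i0 : 'I_N) p : {mpoly K[N]} :=
  \sum_(m <- msupp p | (0 < m i0)%N) p@_m *: 'X_[m - U_(i0)].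

Lemma mnm_subUK (i0 : 'I_N) m : (0 < m i0)%N -> (U_(i0) + (m - U_(i0)))%MM = m.
Proof.
by move=> h; apply/mnmP => i; rewrite mnmDE mnmBE mnm1E; case: eqP => [<-|_]; lia.
Qed.

Lemma mnm_addUK (i0 : 'I_N) m : (U_(i0) + m - U_(i0))%MM = m.
Proof. by apply/mnmP => i; rewrite mnmBE mnmDE; lia. Qed.

Lemma mcoeff_divX i0 p m : (divX i0 p)@_m = p@_(U_(i0) + m).
Proof.
rewrite /divX raddf_sum /=.
under eq_bigr do rewrite mcoeffZ mcoeffX.
have [h|h] := boolP ((U_(i0) + m)%MM \in msupp p).
  have h0 : (0 < (U_(i0) + m)%MM i0)%N by rewrite mnmDE mnm1E eqxx.
  rewrite big_mkcond (bigD1_seq _ h) ?msupp_uniq //= h0 mnm_addUK eqxx mulr1.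
  rewrite big1 ?addr0 // => m' ne; case: ifP => // m'0.
  case: eqP => [e|]; last by rewrite mulr0.
  by move: ne; rewrite -e mnm_subUK ?eqxx.
rewrite (memN_msupp_eq0 h) big_seq_cond big1 // => m' /andP[hm' m'0].
case: eqP => [e|]; last by rewrite mulr0.
by move: h; rewrite -e mnm_subUK // hm'.
Qed.

Lemma meval_divX i0 p (v : 'I_N -> K) :
  (forall m, m \in msupp p -> m i0 = 0%N -> exists2 i, (0 < m i)%N & v i = 0) ->
  p.@[v] = v i0 * (divX i0 p).@[v].
Proof.
move=> h; rewrite mevalE /divX raddf_sum /= big_distrr /=.
rewrite (bigID (fun m : 'X_{1..N} => (0 < m i0)%N)) /= [X in _ + X]big_seq_cond [X in _ + X]big1 ?addr0.
  apply: eq_bigr => m m0; rewrite mevalZ mevalX mulrCA; congr (_ * _).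
  rewrite (bigD1 i0) //= [in RHS](bigD1 i0) //= mulrA -exprS; congr (_ ^+ _ * _).
    by rewrite mnmBE mnm1E eqxx; lia.
  by apply: eq_bigr => i ne; rewrite mnmBE mnm1E eq_sym (negbTE ne) subn0.
move=> m /andP[ms]; rewrite -leqNgt leqn0 => /eqP m0.
have [i mi vi] := h m ms m0.
by rewrite (bigD1 i) //= vi expr0n eqn0Ngt mi mul0r mulr0.
Qed.

Lemma lead_divX i0 p m : (forall m', m' \in msupp p -> mdeg m' = mdeg (U_(i0) + m)%MM) ->
  is_lead rk p (U_(i0) + m)%MM -> is_lead rk (divX i0 p) m.
Proof.
move=> hom [ms le]; split; first by rewrite mcoeff_msupp mcoeff_divX -mcoeff_msupp.
move=> m'; rewrite mcoeff_msupp mcoeff_divX -mcoeff_msupp => /le[/addmI|]; first by left.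
by move/grevlex_cancel; right.
Qed.
End Lead2.

Section Lower.
Variables (K : fieldType) (k n : nat).
Hypothesis charK0 : [pchar K] =i pred0.
Hypotheses (k0 : (0 < k)%N) (n0 : (0 < n)%N).
Variable rk : 'I_(nvars k n) -> nat.
Hypothesis hrk : lin_ext rk.

Definition tm (s : seq (ksub k n)) : 'X_{1..nvars k n} :=
  (\sum_(a <- s) U_(enum_rank a : 'I_(nvars k n)))%MM.

Lemma mcoeff_hcomp d (p : Rkn K k n) m : (hcomp d p)@_m = if mdeg m == d then p@_m else 0.
Proof.
rewrite /hcomp raddf_sum /=.
under eq_bigr do rewrite mcoeffZ mcoeffX.
have [h|h] := boolP (m \in msupp p).
  rewrite big_mkcond (bigD1_seq _ h) ?msupp_uniq //= eqxx mulr1.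
  rewrite big1 ?addr0 // => m' ne; case: ifP => // _.
  by rewrite (negbTE ne) mulr0.
rewrite (memN_msupp_eq0 h) if_same big_seq_cond big1 // => m' /andP[hm' _].
case: eqP => [e|]; last by rewrite mulr0.
by move: h; rewrite -e hm'.
Qed.

Lemma lead_hcomp (p : Rkn K k n) m : is_lead rk p m -> is_lead rk (hcomp (mdeg m) p) m.
Proof.
move=> [ms le]; split; first by rewrite mcoeff_msupp mcoeff_hcomp eqxx -mcoeff_msupp.
move=> m'; rewrite mcoeff_msupp mcoeff_hcomp; case: (mdeg m' =P mdeg m) => [_|_]; last by rewrite eqxx.
by rewrite -mcoeff_msupp; apply: le.
Qed.

Lemma fits_descend s f : s != [::] -> sorted (@pleq k n) s -> good k n f -> fits s f ->
  exists g, [/\ good k n g, forall p : Rkn K k n, Jf f p -> Jf g p &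
    forall x m, (m <= n)%N -> rho s x m = (rf g x m)%:Z].
Proof.
move=> s0 srt gf ft.
apply: (@descend k n n0 (fun g => forall p : Rkn K k n, Jf f p -> Jf g p) (rho s) f) => //.
- by move=> x t m; rewrite /rho addrC modzMDl.
- by move=> x; apply: rho0.
- by move=> x; apply: rhon.
- by move=> x m; apply: rho_step.
- by move=> x m; apply: rho_sub.
by move=> g c q gg h1 h2 h3 Q p Jp; apply: (Jf_step charK0 n0 gg h1 h2 h3); apply: Q.
Qed.

(** On the stratum of g the initial ranks are the counts of a. Hence the bracket of a is nonzero
    there, and in the homogeneous part led by the tableau every monomial lacking this bracket
    vanishes, so the bracket can be divided out. *)
Lemma lead_tail a s g (q : Rkn K k n) : sorted (@pleq k n) (a :: s) ->
  (forall x m, (m <= n)%N -> rho (a :: s) x m = (rf g x m)%:Z) ->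
  Jf g q -> is_lead rk q (tm (a :: s)) -> exists2 q' : Rkn K k n, Jf g q' & is_lead rk q' (tm s).
Proof.
have [rki rkm] := hrk.
move=> srt eg Jq ld; set i0 : 'I_(nvars k n) := enum_rank a.
have pi0 : pvar i0 = a by rewrite /pvar enum_rankK.
have tE : tm (a :: s) = (U_(i0) + tm s)%MM by rewrite /tm big_cons.
have Jh := Jf_hcomp charK0 k0 n0 (mdeg (tm (a :: s))) Jq; have lh := lead_hcomp ld.
set p := hcomp _ _ in Jh lh.
have hom m : m \in msupp p -> mdeg m = mdeg (tm (a :: s)).
  by rewrite mcoeff_msupp mcoeff_hcomp; case: (mdeg m =P _) => //; rewrite eqxx.
exists (divX i0 p); last by apply: lead_divX; rewrite -tE.
move=> M rM fM.
have rkM b : (b <= n)%N -> \rank (blk M 0 b) = cntk a b.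
  move=> bn; have := eg 0 b bn; rewrite -(rank_rf n0 0 fM bn) /rho mod0z /Rr /= add0n bn.
  by rewrite cc0 // => -[].
have pa := pluck_flag_n0 n0 rkM.
have := Jh M rM fM; rewrite (@meval_divX _ _ i0) => [|m ms m0].
  by move/eqP; rewrite mulf_eq0 /plvec pi0 (negbTE pa) => /eqP.
have [_ /(_ m ms)[e|]] := lh.
  by move: m0; rewrite e tE mnmDE mnm1E eqxx.
(* In reverse lexicographic order i is the smallest variable at which m differs from the leading
   monomial, and m has more of it. Were it above a in the poset, either i = i0 or i0 would rank
   below i, so m would contain the variable of a, against m i0 = 0. *)
move=> [|[_ [i [hi hj]]]]; first by rewrite hom // ltnn.
exists i; first by apply: leq_ltn_trans hi.
apply: (pluck_flag0 n0 rkM); apply/negP => le.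
have := rkm i0 i; rewrite pi0 => /(_ le); rewrite leq_eqVlt => /orP[/eqP/rki e|/hj].
  by move: hi; rewrite -e m0.
by rewrite m0 tE mnmDE mnm1E eqxx.
Qed.

(** The descent is repeated before each cancellation, because the remaining tableau has a smaller
    rho. After the last column a nonzero constant would lie in the ideal of a stratum containing the
    coordinate subspace of that column. *)
Lemma no_lead_fits a s f (q : Rkn K k n) : sorted (@pleq k n) (a :: s) -> good k n f ->
  fits (a :: s) f -> Jf f q -> ~ is_lead rk q (tm (a :: s)).
Proof.
elim: s a f q => [|b s IH] a f q srt gf ft Jq ld.
all: have [g [gg Qg eg]] := @fits_descend (a :: _) f isT srt gf ft.
all: have [q' Jq' ld'] := lead_tail srt eg (Qg _ Jq) ld.
  have rkP x m : (m <= n)%N -> \rank (blk (ptM K a) x m) = rf g x m.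
    by move=> mn; have := eg x m mn; rewrite -(rank_ptM K n0) // => -[].
  have fM := fV_rf n0 (good_bnd gg) rkP.
  have rM : \rank (ptM K a) = k by rewrite -(rank_blk_full n0) rkP // (good_full gg).
  have := Jq' _ rM fM; case: ld'; rewrite /tm big_nil => ms le.
  have e : q' = (q'@_0)%:MP.
    apply/mpolyP => m; rewrite mcoeffC; have [->|ne] := eqVneq m 0%MM; first by rewrite mulr1.
    rewrite mulr0; apply: memN_msupp_eq0; apply/negP => /le[|[]].
    - by move/eqP; rewrite (negbTE ne).
    - by rewrite mdeg0.
    by rewrite mdeg0 => -[/eqP]; rewrite mdeg_eq0 (negbTE ne).
  by rewrite e mevalC => /eqP; apply/negP; rewrite -mcoeff_msupp.
apply: (IH b g q') => //; first exact: path_sorted srt.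
by move=> x m mn; rewrite -eg //; apply: rho_tail.
Qed.
End Lower.

(** * Exchange relations *)

(** Past the common prefix, the smallest variable among the [ii j] ranks below [I j0], hence below
    every remaining [I j]. It therefore occurs on one side only, which makes that side smaller. *)
Lemma grevlex_first N (rk : 'I_N -> nat) d (ii I : 'I_d -> 'I_N) (j0 : 'I_d) :
  (forall i : 'I_d, (i < j0)%N -> ii i = I i) -> (rk (ii j0) < rk (I j0))%N ->
  (forall i j : 'I_d, (i <= j)%N -> (rk (I i) <= rk (I j))%N) ->
  grevlex_lt rk (\sum_j U_(ii j))%MM (\sum_j U_(I j))%MM.
Proof.
move=> eqI lt0 mono.
rewrite (bigID (fun j : 'I_d => (j < j0)%N)) /= [X in grevlex_lt _ _ X](bigID (fun j : 'I_d => (j < j0)%N)) /=.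
rewrite (eq_bigr (fun j => U_(I j)%MM)); last by move=> j /eqI ->.
apply: grevlex_addl; right; split.
  by rewrite !mdeg_sum; apply: eq_bigr => j _; rewrite !mdeg1.
have p0 : ~~ (j0 < j0)%N by rewrite ltnn.
case: (@arg_minnP _ j0 (fun j : 'I_d => ~~ (j < j0)%N) (fun j => rk (ii j)) p0) => j pj jmin.
have far x : (rk x <= rk (ii j))%N -> (\sum_(i < d | ~~ (i < j0)%N) U_(I i))%MM x = 0%N.
  move=> hx; rewrite mnm_sumE big1 // => i hi; rewrite mnm1E; case: eqP => // e.
  by have := jmin j0 p0; have := mono j0 i; rewrite e; lia.
exists (ii j); split; first by rewrite far // mnm_sumE (bigD1 j) //= mnm1E eqxx.
move=> x hx; rewrite far ?(ltnW hx) // mnm_sumE big1 // => i hi; rewrite mnm1E; case: eqP => // e.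
by have := jmin i hi; rewrite e; lia.
Qed.

Section Exch.
Variables (K : fieldType) (N r n d : nat).
Hypothesis charK0 : [pchar K] =i pred0.
Variables (e : 'I_N -> ksub r n) (ep : 'I_N -> K).
Hypotheses (einj : injective e) (esur : forall a, exists i, e i = a) (ep0 : forall i, ep i != 0).

Definition inc (l : 'I_r -> 'I_n) (i : 'I_N) : 'M[K]_r := \matrix_(s, t) (l s == kth (e i) t)%:R.

(* [ep i] times the signed variable i when l enumerates [e i], and zero when l repeats. *)
Definition bracket (l : 'I_r -> 'I_n) : {mpoly K[N]} := \sum_i (ep i * \det (inc l i)) *: 'X_i.

Lemma inc_inj l i : \det (inc l i) != 0 -> injective l.
Proof.
move=> h s s' ls; apply/eqP; apply: contraNT h => ne; apply/eqP.
by apply: (determinant_alternate ne) => t; rewrite !mxE ls.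
Qed.

Lemma card_image_inj (l : 'I_r -> 'I_n) : injective l -> #|[set l s | s : 'I_r]| = r.
Proof. by move=> li; rewrite card_imset // card_ord. Qed.

Lemma inc_image l i : \det (inc l i) != 0 -> val (e i) = [set l s | s : 'I_r].
Proof.
move=> h; apply/esym/eqP; rewrite eqEcard (card_image_inj (inc_inj h)) (eqP (valP (e i))) leqnn andbT.
apply/subsetP => _ /imsetP[s _ ->]; apply: contraNT h => ns; apply/eqP.
rewrite /determinant big1 // => g _; rewrite (bigD1 s) //= mxE.
case: eqP => [es|_]; last by rewrite mul0r mulr0.
by move: ns; rewrite es kth_mem.
Qed.

Lemma bracketP l : bracket l = 0 \/ exists i c,
  [/\ bracket l = c *: 'X_i, injective l & val (e i) = [set l s | s : 'I_r]].
Proof.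
have [/existsP[i hi]|] := boolP [exists i, \det (inc l i) != 0]; last first.
  rewrite negb_exists => /forallP h; left; apply: big1 => i _.
  by have := h i; rewrite negbK => /eqP->; rewrite mulr0 scale0r.
right; exists i, (ep i * \det (inc l i)); split; [|exact: inc_inj hi|exact: inc_image].
rewrite /bracket (bigD1 i) //= big1 ?addr0 // => i' ne.
have [->|h] := eqVneq (\det (inc l i')) 0; first by rewrite mulr0 scale0r.
by case/eqP: ne; apply/einj/val_inj; rewrite (inc_image hi) (inc_image h).
Qed.

(** A Cauchy-Binet expansion with at most one nonzero term: an incidence determinant is nonzero only
    when l enumerates the subset, and a repetition in l kills both sides. *)
Lemma det_bracket (A : 'M[K]_(r, n)) l :
  \det (\matrix_(s, t) A s (l t)) = \sum_i \det (inc l i) * pluck A (e i).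
Proof.
have [/injectiveP li|] := boolP (injectiveb l); last first.
  move/injectivePn => [s [s' ne ls]].
  rewrite -det_tr (determinant_alternate ne); last by move=> t; rewrite !mxE ls.
  rewrite big1 // => i _; rewrite (determinant_alternate ne) ?mul0r // => t.
  by rewrite !mxE ls.
have lc : #|[set l s | s : 'I_r]| == r by rewrite card_image_inj.
have [i ei] := esur (exist (fun X : {set 'I_n} => #|X| == r) _ lc).
rewrite (bigD1 i) //= big1 ?addr0 => [|i' ne].
  rewrite mulrC -(det_tr (inc l i)) -det_mulmx; congr (\det _); apply/matrixP => s t; rewrite !mxE.
  have : l t \in val (e i) by rewrite ei /=; apply: imset_f.
  move/kth_surj => [u eu]; rewrite (bigD1 u) //= !mxE eu eqxx mulr1 big1 ?addr0 // => u' ne.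
  rewrite !mxE -eu; case: eqP => [/kth_inj h|_]; last by rewrite mulr0.
  by rewrite h eqxx in ne.
have [->|h] := eqVneq (\det (inc l i')) 0; first by rewrite mul0r.
by case/eqP: ne; apply/einj/val_inj; rewrite ei /= (inc_image h).
Qed.

Lemma bracket_eval (A : 'M[K]_(r, n)) c (v : 'I_N -> K) l :
  (forall i, ep i * v i = c * pluck A (e i)) ->
  (bracket l).@[v] = c * \det (\matrix_(s, t) A s (l t)).
Proof.
move=> h; rewrite det_bracket /bracket raddf_sum /= mulr_sumr; apply: eq_bigr => i _.
by rewrite mevalZ mevalXU mulrAC h -mulrA; congr (_ * _); rewrite mulrC.
Qed.

Lemma eq_bracket l l' : l =1 l' -> bracket l = bracket l'.
Proof.
move=> h; apply: eq_bigr => i _; congr (_ *: _); congr (_ * \det _).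
by apply/matrixP => s t; rewrite !mxE h.
Qed.

Lemma bracket_tperm l t1 t2 : t1 != t2 -> bracket (l \o tperm t1 t2) = - bracket l.
Proof.
move=> ne; rewrite /bracket -sumrN; apply: eq_bigr => i _; rewrite -scaleNr -mulrN; congr (_ * _ *: _).
have -> : inc (l \o tperm t1 t2) i = row_perm (tperm t1 t2) (inc l i).
  by apply/matrixP => s t; rewrite !mxE.
by rewrite row_permE det_mulmx det_perm odd_tperm ne expr1 mulN1r.
Qed.

Lemma bracket_kth i : bracket (kth (e i)) = ep i *: 'X_i.
Proof.
have E : inc (kth (e i)) i = 1%:M.
  by apply/matrixP => s t; rewrite !mxE (inj_eq (@kth_inj _ _ _)).
rewrite /bracket (bigD1 i) //= E det1 mulr1 big1 ?addr0 // => i' ne.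
have [->|h] := eqVneq (\det (inc (kth (e i)) i')) 0; first by rewrite mulr0 scale0r.
have h' : \det (inc (kth (e i)) i) != 0 by rewrite E det1 oner_eq0.
by case/eqP: ne; apply/einj/val_inj; rewrite (inc_image h) (inc_image h').
Qed.

Variables (rk : 'I_N -> nat) (I : 'I_d -> 'I_N) (S : {set 'I_n}) (J : 'I_n -> 'I_d).
Hypothesis HS : forall s, s \in S -> s \in val (e (I (J s))).
Hypothesis rkI : forall i j : 'I_d, (i <= j)%N -> (rk (I i) <= rk (I j))%N.
Hypothesis rkH : forall j i,
  val (e (I j)) :\: [set s in S | J s == j] \subset val (e i) ->
  val (e i) \subset val (e (I j)) :|: [set s in S | (j < J s)%N] ->
  i != I j -> (rk i < rk (I j))%N.

(* Column j of the tableau is [e (I j)], and J sends an element of S to the column from which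
   it is permuted. The permutations that keep the blocks of J all contribute the leading
   monomial with the same sign; the first block that is not kept yields a smaller variable. *)
Definition slot j t := (kth (e (I j)) t \in S) && (J (kth (e (I j)) t) == j).
Definition perL (g : {perm 'I_n}) j t := if slot j t then g (kth (e (I j)) t) else kth (e (I j)) t.
Definition perT (g : {perm 'I_n}) : {mpoly K[N]} := (-1) ^+ g *: \prod_j bracket (perL g j).
Definition exch : {mpoly K[N]} := \sum_(g : {perm 'I_n} | perm_on S g) perT g.

Lemma slot_ex s : s \in S -> exists t, kth (e (I (J s))) t = s.
Proof. by move=> /HS/kth_surj. Qed.

(** Expand all the minors and fix the choice f of rows. Up to the factor [C] of the untouched
    entries, the signed sum over permutations of S is the determinant of [B], which consists of rows
    of A restricted to S, extended by the identity. The dependency w lies in its kernel. *)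
Lemma exch_vanish (A : 'M[K]_(r, n)) c (v : 'I_N -> K) (w : 'cV[K]_n) :
  (forall i, ep i * v i = c * pluck A (e i)) ->
  w != 0 -> (forall s, s \notin S -> w s 0 = 0) -> A *m w = 0 -> exch.@[v] = 0.
Proof.
move=> h w0 wS Aw; rewrite /exch raddf_sum /=.
pose L j t := kth (e (I j)) t.
have E1 g : (perT g).@[v] = c ^+ d *
   \sum_(f : {ffun 'I_d -> {perm 'I_r}}) ((\prod_j (-1) ^+ f j) *
     ((-1) ^+ g * \prod_(p : 'I_d * 'I_r) A (f p.1 p.2) (perL g p.1 p.2))).
  rewrite /perT mevalZ rmorph_prod /=.
  under eq_bigr do rewrite (bracket_eval _ h).
  rewrite big_split /= prodr_const card_ord mulrCA; congr (_ * _).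
  have -> : \prod_(i < d) \det (\matrix_(s, t) A s (perL g i t)) =
     \prod_(i < d) \sum_(f : {perm 'I_r}) (-1) ^+ f * \prod_t A (f t) (perL g i t).
    apply: eq_bigr => j _; rewrite -det_tr; apply: eq_bigr => f _; congr (_ * _).
    by apply: eq_bigr => t _; rewrite !mxE.
  rewrite bigA_distr_bigA /= mulr_sumr; apply: eq_bigr => f _.
  rewrite big_split /= mulrCA; congr (_ * (_ * _)).
  by rewrite pair_big.
rewrite (eq_bigr _ (fun g _ => E1 g)) -mulr_sumr exchange_big /=.
rewrite big1 ?mulr0 // => f _; rewrite -mulr_sumr.
have [t0 _|r0] := pickP (predT : pred 'I_r); last first.
  case/eqP: w0; apply/matrixP => s z; rewrite ord1 mxE wS //; apply/negP => /slot_ex[t _].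
  by have := r0 t.
pose T s := odflt t0 [pick t | L (J s) t == s].
have TE s : s \in S -> L (J s) (T s) = s.
  move=> /slot_ex[t et]; rewrite /T; case: pickP => [t' /eqP//|/(_ t)].
  by rewrite /L et eqxx.
pose B : 'M[K]_n := \matrix_(s, z) if s \in S then (if z \in S then A (f (J s) (T s)) z else 0) else (s == z)%:R.
have detB : \det B = 0.
  apply/eqP; rewrite -det_tr; apply/det0P; exists w^T; first by rewrite -(inj_eq (@trmx_inj _ _ _)) trmxK trmx0.
  rewrite -trmx_mul; apply/eqP; rewrite -(inj_eq (@trmx_inj _ _ _)) trmxK trmx0; apply/eqP.
  apply/matrixP => s z; rewrite ord1 [RHS]mxE mxE; have [sS|sS] := boolP (s \in S).
    have := congr1 (fun M : 'cV_r => M (f (J s) (T s)) 0) Aw; rewrite !mxE => {2}<-.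
    apply: eq_bigr => y _; rewrite mxE sS; case: ifP => // /negbT/wS->; by rewrite !mulr0.
  rewrite big1 // => y _; rewrite mxE (negbTE sS); case: eqP => [<-|_]; last by rewrite mul0r.
  by rewrite wS // mulr0.
pose C := \prod_(p : 'I_d * 'I_r | ~~ slot p.1 p.2) A (f p.1 p.2) (L p.1 p.2).
suff -> : \sum_(g : {perm 'I_n} | perm_on S g) (-1) ^+ g *
    \prod_(p : 'I_d * 'I_r) A (f p.1 p.2) (perL g p.1 p.2) = C * \det B by rewrite detB !mulr0.
rewrite /determinant mulr_sumr [RHS](bigID (perm_on S)) /= [X in _ = _ + X]big1 ?addr0; last first.
  move=> g /subsetPn[x gx xS]; rewrite (bigD1 x) //= !mxE (negbTE xS).
  by rewrite eq_sym (negbTE gx) mul0r !mulr0.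
apply: eq_bigr => g gS; rewrite [RHS]mulrCA; congr (_ * _).
rewrite (bigID (fun p : 'I_d * 'I_r => slot p.1 p.2)) /= mulrC; congr (_ * _).
  by apply: eq_bigr => p /negbTE np; rewrite /perL np.
rewrite [RHS](bigID (mem S)) /= [X in _ = _ * X]big1 ?mulr1; last first.
  by move=> s sS; rewrite mxE (negbTE sS) (out_perm gS) // eqxx.
rewrite (reindex_onto (fun s => (J s, T s)) (fun p => L p.1 p.2)) /=; last first.
  move=> [j t] /= /andP[ls /eqP jl]; have := TE _ ls; rewrite jl => /kth_inj ->.
  by rewrite -jl.
apply: eq_big => [s|s].
  apply/idP/idP => [/andP[/andP[+ _] /eqP es]|sS]; first by rewrite -/(L _ _) es.
  by rewrite /slot -/(L _ _) (TE _ sS) sS !eqxx.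
move=> /andP[sl /eqP es]; rewrite /perL sl -/(L _ _) es mxE.
have sS : s \in S by move: sl => /andP[+ _]; rewrite -/(L _ _) es.
by rewrite sS (perm_closed _ gS) sS.
Qed.

(** The sign of the transposition is compensated by the exchange of two arguments of the same
    alternating bracket. *)
Lemma perT_tperm g s s' : s \in S -> s' \in S -> J s = J s' -> s != s' ->
  perT (tperm s s' * g)%g = perT g.
Proof.
move=> sS s'S Js ne; rewrite /perT odd_mul_tperm ne /= signrN scaleNr -scalerN; congr (_ *: _).
have [t1 e1] := slot_ex sS; have [t2 e2] := slot_ex s'S; rewrite -Js in e2.
have nt : t1 != t2 by apply: contraNneq ne => et; rewrite -e1 -e2 et.
rewrite (bigD1 (J s)) //= [in RHS](bigD1 (J s)) //= -mulNr; congr (_ * _).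
  rewrite -(bracket_tperm _ nt); apply: eq_bracket => t; rewrite /perL /= /slot.
  case: (tpermP t1 t2 t) => [->|->|n1 n2].
  - by rewrite e1 e2 sS s'S -Js eqxx /= permM ?tpermL ?tpermR.
  - by rewrite e1 e2 sS s'S -Js eqxx /= permM ?tpermL ?tpermR.
  case: ifP => // _; rewrite permM tpermD //.
    by apply: contra_not_neq n1 => h; apply: (@kth_inj _ _ (e (I (J s)))); rewrite e1 -h.
  by apply: contra_not_neq n2 => h; apply: (@kth_inj _ _ (e (I (J s)))); rewrite e2 -h.
apply: eq_bigr => j nj; apply: eq_bracket => t; rewrite /perL.
case: ifP => // /andP[_ /eqP jt]; rewrite permM tpermD //; apply: contraNneq nj => es.
  by rewrite es jt.
by rewrite Js es jt.
Qed.

Definition keeps (g : {perm 'I_n}) := [forall (s | s \in S), J (g s) == J s].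

Lemma perT_keeps g : perm_on S g -> keeps g -> perT g = perT 1%g.
Proof.
move: {2}#|[set x | g x != x]| (leqnn #|[set x | g x != x]|) => m.
elim: m g => [|m IH] g.
  rewrite leqn0 cards_eq0 => /eqP h _ _; congr perT; apply/permP => x; rewrite perm1.
  by apply/eqP; apply/negPn; have := in_set0 x; rewrite -h inE => ->.
move=> le gS /forall_inP kg.
have [/eqP h|/set0Pn[x]] := boolP ([set x | g x != x] == set0).
  by apply: IH; rewrite ?h ?cards0 //; apply/forall_inP.
rewrite inE => gx; have xS : x \in S by apply: (subsetP gS); rewrite inE.
pose y := (g^-1)%g x; have gy : g y = x by rewrite permKV.
have yx : x != y by apply: contraNneq gx => e1; rewrite {1}e1 gy.
have yS : y \in S by rewrite -(perm_closed _ gS) gy.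
have Jxy : J x = J y by rewrite -{1}gy; apply/eqP/kg.
rewrite -(perT_tperm g xS yS Jxy yx); apply: IH.
- rewrite -ltnS; apply: leq_trans le; apply: proper_card; apply/properP; split.
    apply/subsetP => z; rewrite !inE permM; case: tpermP => [->|->|//]; first by rewrite gy eqxx.
    by move=> _; rewrite gy.
  by exists x; rewrite !inE ?permM ?tpermL ?gy ?eqxx.
- apply/subsetP => z; rewrite inE permM; case: tpermP => [->|->|_ _ gz] //.
  by apply: (subsetP gS); rewrite inE.
apply/forall_inP => z zS; rewrite permM; apply/eqP; rewrite (eqP (kg _ _)); last by case: tpermP.
by case: tpermP => [->|->|].
Qed.

Lemma perT1 : perT 1%g = (\prod_j ep (I j)) *: 'X_[\sum_j U_(I j)].
Proof.
rewrite /perT odd_perm1 scale1r -mprodXE -scaler_prod; apply: eq_bigr => j _.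
rewrite -bracket_kth; apply: eq_bracket => t.
by rewrite /perL perm1 if_same.
Qed.

Lemma perT_lower g m : perm_on S g -> ~~ keeps g -> m \in msupp (perT g) ->
  grevlex_lt rk m (\sum_j U_(I j))%MM.
Proof.
move=> gS nk.
have [/existsP[j0 /eqP h0]|] := boolP [exists j, bracket (perL g j) == 0].
  by rewrite /perT (bigD1 j0) //= h0 mul0r scaler0 msupp0.
rewrite negb_exists => /forallP h.
have /fin_all_exists[ii Hii] : forall j, exists i, exists c,
   [/\ bracket (perL g j) = c *: 'X_i, injective (perL g j) & val (e i) = [set perL g j s | s : 'I_r]].
  by move=> j; have [h0|] := bracketP (perL g j); first by have := h j; rewrite h0 eqxx.
have /fin_all_exists[c Hc] := Hii.
have -> : perT g = ((-1) ^+ g * \prod_j c j) *: 'X_[\sum_j U_(ii j)].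
  rewrite /perT -scalerA; congr (_ *: _); rewrite -mprodXE -scaler_prod; apply: eq_bigr => j _.
  by have [-> _ _] := Hc j.
move/msuppZ_le; rewrite msuppX inE => /eqP->{m}.
pose bad (j : 'I_d) := [exists s, [&& s \in S, J s == j & J (g s) != j]].
have [j1 b1] : exists j, bad j.
  move: nk; rewrite negb_forall_in => /exists_inP[s sS ns]; exists (J s).
  by apply/existsP; exists s; rewrite sS eqxx.
case: (@arg_minnP _ j1 bad (fun j => val j) b1) => j0 bj0 jmin.
have good_lt (i : 'I_d) s : (i < j0)%N -> s \in S -> J s = i -> J (g s) = i.
  move=> ij sS Js; apply/eqP; apply: contraLR ij => ng; rewrite -leqNgt; apply: jmin.
  by apply/existsP; exists s; rewrite sS Js eqxx.
(* The permutation maps each earlier block onto itself by finiteness, so nothing from block j0 can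
   land in one of them. *)
have ge s : s \in S -> J s = j0 -> (j0 <= J (g s))%N.
  move=> sS Js; rewrite leqNgt; apply/negP => lt; set i := J (g s) in lt.
  pose B := [set x in S | J x == i].
  have sub : g @: B \subset B.
    apply/subsetP => _ /imsetP[x + ->]; rewrite inE => /andP[xS /eqP Jx].
    by rewrite inE (perm_closed _ gS) xS (good_lt i x) // eqxx.
  have : g s \in B by rewrite inE (perm_closed _ gS) sS eqxx.
  have -> : B = g @: B.
    by apply/esym/eqP; rewrite eqEcard sub card_imset ?leqnn //; apply: perm_inj.
  move=> /imsetP[x]; rewrite inE => /andP[xS /eqP Jx] /perm_inj sx.
  by move: lt; rewrite -Jx -sx Js ltnn.
apply: (@grevlex_first _ _ _ _ _ j0) => //.
  move=> i ij; have [_ inj img] := Hc i; apply/einj/val_inj/eqP.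
  rewrite eqEcard (eqP (valP (e (ii i)))) (eqP (valP (e (I i)))) leqnn andbT img; apply/subsetP => _ /imsetP[t _ ->].
  rewrite /perL; case: ifP => [/andP[lS /eqP Jl]|_]; last exact: kth_mem.
  have := @HS (g (kth (e (I i)) t)); rewrite (perm_closed _ gS) lS (good_lt i _) //.
  exact.
have [_ inj img] := Hc j0; apply: rkH.
- rewrite img; apply/subsetP => s; rewrite inE => /andP[nB /kth_surj[t et]].
  apply/imsetP; exists t => //; rewrite /perL ifF ?et //; apply/negbTE.
  by move: nB; rewrite inE /slot et.
- rewrite img; apply/subsetP => _ /imsetP[t _ ->]; rewrite /perL; case: ifP => [/andP[lS /eqP Jl]|_]; last first.
    by rewrite inE kth_mem.
  have gl : g (kth (e (I j0)) t) \in S by rewrite (perm_closed _ gS).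
  have := ge _ lS Jl; rewrite leq_eqVlt => /orP[/eqP/val_inj E|lt].
    by rewrite inE [X in val (e (I X))]E HS.
  by rewrite !inE gl lt orbT.
apply/eqP => E; move: bj0 => /existsP[s /and3P[sS /eqP Js nJ]].
have [t et] := slot_ex sS; rewrite Js in et.
have sl : slot j0 t by rewrite /slot et sS Js eqxx.
have : g s \in val (e (I j0)).
  by rewrite -E img; apply/imsetP; exists t => //; rewrite /perL sl et.
move=> /kth_surj[t' et'].
have sl' : slot j0 t' = false by rewrite /slot et' (negbTE nJ) andbF.
have : perL g j0 t = perL g j0 t' by rewrite /perL sl sl' et et'.
by move/inj => tt'; rewrite tt' sl' in sl.
Qed.

Lemma exch_lead : is_lead rk exch (\sum_j U_(I j))%MM.
Proof.
set m := (\sum_j _)%MM; pose c := \prod_j ep (I j).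
have c0 : c != 0 by apply/prodf_neq0 => j _.
have lt_ne m' : grevlex_lt rk m' m -> m' != m.
  move=> h; apply/eqP => E; move: h; rewrite E => -[|[_ [i []]]]; by rewrite ltnn.
have E : exch = \sum_(g : {perm 'I_n} | perm_on S g && keeps g) c *: 'X_[m] +
                \sum_(g : {perm 'I_n} | perm_on S g && ~~ keeps g) perT g.
  rewrite /exch (bigID keeps) /=; congr (_ + _); apply: eq_bigr => g /andP[gS kg].
  by rewrite perT_keeps // perT1.
split.
  (* The leading coefficient is c times the number of block-preserving permutations, which is
     nonzero in characteristic 0. *)
  rewrite mcoeff_msupp E mcoeffD sumr_const mcoeffMn mcoeffZ mcoeffX eqxx mulr1.
  rewrite raddf_sum /= big1 ?addr0 => [|g /andP[gS kg]].
    rewrite -mulr_natr mulf_neq0 // (pcharf0P K).1 // -lt0n; apply/card_gt0P; exists 1%g.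
    rewrite unfold_in perm_on1; apply/forall_inP => s _; by rewrite perm1.
  apply: memN_msupp_eq0; apply/negP => /(perT_lower gS kg)/lt_ne; by rewrite eqxx.
move=> m'; rewrite E => /msuppD_le; rewrite mem_cat => /orP[].
  rewrite sumr_const -scaler_nat => /msuppZ_le/msuppZ_le; rewrite msuppX inE => /eqP; by left.
move=> /msupp_sum_le/flattenP[_ /mapP[g + ->] h]; rewrite mem_filter => /andP[/andP[gS kg] _].
by right; apply: perT_lower h.
Qed.
End Exch.

(** * Leading terms from violated rank bounds: ordinary intervals *)

Section Sets.
Variable n : nat.
Implicit Types (A B C : {set 'I_n}).

Lemma cntS_C A x : (x <= n)%N -> (cntS A x + cntS (~: A) x = x)%N.
Proof.
elim: x => [|x IH] xn.
  by rewrite /cntS; apply/eqP; rewrite addn_eq0 !cards_eq0; apply/andP; split;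
    apply/eqP/setP => y; rewrite !inE andbF.
have := IH (ltnW xn); rewrite !cntS_S inE; case: (_ \in _); lia.
Qed.

Lemma card_interval A p q : (p <= q)%N ->
  #|[set y in A | (p <= y < q)%N]| = (cntS A q - cntS A p)%N.
Proof.
move=> pq; rewrite /cntS -[in RHS](cardsID [set y : 'I_n | (y < p)%N] [set y in A | (y < q)%N]).
have -> : [set y in A | (y < q)%N] :&: [set y : 'I_n | (y < p)%N] = [set y in A | (y < p)%N].
  by apply/setP => y; rewrite !inE; case: (_ \in _) => //=; lia.
by rewrite addKn; congr #|pred_of_set _|; apply/setP => y; rewrite !inE; case: (_ \in _); rewrite ?andbF //=; lia.
Qed.

(** Passing from C to C' only trades elements from p on for elements below p, which can only raise
    the counts. *)
Lemma cntS_exch C C' p : #|C| = #|C'| ->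
  (forall y : 'I_n, y \in C -> (y < p)%N -> y \in C') ->
  (forall y : 'I_n, y \in C' -> (p <= y)%N -> y \in C) ->
  forall x, (cntS C x <= cntS C' x)%N.
Proof.
move=> eC h1 h2 x; have [le|lt] := leqP x p.
  apply: subset_leq_card; apply/subsetP => y; rewrite !inE => /andP[yC yx].
  by rewrite yx h1 //; lia.
have h A : (#|A| = cntS A x + #|[set y in A | (x <= y)%N]|)%N.
  rewrite /cntS -(cardsID [set y : 'I_n | (y < x)%N] A).
  by congr (_ + _)%N; apply: eq_card => y; rewrite !inE // -leqNgt andbC.
have : (#|[set y in C' | (x <= y)%N]| <= #|[set y in C | (x <= y)%N]|)%N.
  apply: subset_leq_card; apply/subsetP => y; rewrite !inE => /andP[yC yx].
  by rewrite yx h2 //; lia.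
have := h C; have := h C'; lia.
Qed.

(** Turns the thresholds of an optimal chain into exchange data: S is the set of counted entries, J
    names the column that counts a label. The column j0 is only a default for labels outside all
    intervals. *)
Lemma blocks_ex d (j0 : 'I_d) (lo hi : 'I_d -> nat) (C : 'I_d -> {set 'I_n}) :
  (forall j, (lo j <= hi j)%N) ->
  (forall y i j, (lo i <= y < hi i)%N -> (lo j <= y < hi j)%N -> i = j) ->
  exists (S : {set 'I_n}) (J : 'I_n -> 'I_d),
  [/\ forall y, (y \in S) = (y \in C (J y)) && (lo (J y) <= y < hi (J y))%N,
      forall (y : 'I_n) j, (lo j <= y < hi j)%N -> J y = j &
      #|S| = (\sum_j (cntS (C j) (hi j) - cntS (C j) (lo j)))%N].
Proof.
move=> lh dis; pose J (y : 'I_n) := odflt j0 [pick j | (lo j <= y < hi j)%N].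
have JE (y : 'I_n) j : (lo j <= y < hi j)%N -> J y = j.
  by move=> h; rewrite /J; case: pickP => [j' h'|/(_ j)]; [exact: dis h' h|rewrite h].
exists [set y | (y \in C (J y)) && (lo (J y) <= y < hi (J y))%N], J; split=> //.
  by move=> y; rewrite inE.
rewrite -sum1_card (partition_big J xpredT) //=; apply: eq_bigr => j _.
rewrite -card_interval // sum1dep_card; congr #|pred_of_set _|; apply/setP => y; rewrite !inE.
apply/idP/idP => [/andP[h /eqP<-]//|/andP[yC h]].
by rewrite (JE y j) // yC h eqxx.
Qed.
End Sets.

Section Kernels.
Variable K : fieldType.

Lemma kernel_vector m p (A : 'M[K]_(m, p)) : (\rank A < m)%N -> exists2 y : 'rV[K]_m, y != 0 & y *m A = 0.
Proof.
move=> h; have : kermx A != 0 by rewrite -mxrank_eq0 mxrank_ker subn_eq0 -ltnNge.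
by move/rowV0Pn => [y /sub_kermxP yA y0]; exists y.
Qed.

Lemma kernel_supported r n m (A : 'M[K]_(r, n)) (S : {set 'I_n}) (B : 'M[K]_(m, r)) :
  (forall y, y \in S -> (row y A^T <= B)%MS) -> (\rank B < #|S|)%N ->
  exists w : 'cV[K]_n, [/\ w != 0, forall s, s \notin S -> w s 0 = 0 & A *m w = 0].
Proof.
move=> sub rB; pose E : 'M[K]_(#|S|, n) := \matrix_i delta_mx 0 (enum_val i).
have EA : (E *m A^T <= B)%MS.
  apply/row_subP => i; rewrite row_mul rowK -rowE; apply: sub; exact: enum_valP.
have [y y0 yE] := kernel_vector (leq_ltn_trans (mxrankS EA) rB).
exists (y *m E)^T; split.
- apply: contraNneq y0 => h; apply/eqP/rowP => i.
  have := congr1 (fun M : 'cV_n => M (enum_val i) 0) h; rewrite !mxE (bigD1 i) //= !mxE !eqxx mulr1.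
  rewrite big1 ?addr0 // => i' ne; rewrite !mxE eqxx /= (inj_eq enum_val_inj) eq_sym (negbTE ne) mulr0 //.
- move=> s sS; rewrite !mxE big1 // => i _; rewrite !mxE eqxx /=.
  case: eqP => [e|_]; last by rewrite mulr0.
  by move: sS; rewrite e enum_valP.
by apply: trmx_inj; rewrite trmx_mul trmxK trmx0 -mulmxA.
Qed.
End Kernels.

Section Nonwrap.
Variables (K : fieldType) (k n : nat).
Hypothesis charK0 : [pchar K] =i pred0.
Hypothesis n0 : (0 < n)%N.
Variable rk : 'I_(nvars k n) -> nat.
Hypothesis hrk : lin_ext rk.

Lemma pleq_trans : transitive (@pleq k n).
Proof. by move=> b a c /pleqP h1 /pleqP h2; apply/pleqP => x; apply: leq_trans (h2 x) (h1 x). Qed.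

Lemma pleq_refl : reflexive (@pleq k n).
Proof. by move=> a; apply/pleqP. Qed.

Definition cvar (s : seq (ksub k n)) (j : 'I_(size s)) : 'I_(nvars k n) := enum_rank (tnth (in_tuple s) j).

Lemma pvar_cvar s (j : 'I_(size s)) : pvar (cvar j) = tnth (in_tuple s) j.
Proof. by rewrite /pvar enum_rankK. Qed.

Lemma tm_cvar s : tm s = (\sum_j U_(@cvar s j))%MM.
Proof. by rewrite /tm big_tnth. Qed.

Lemma rk_cvar s (i j : 'I_(size s)) : sorted (@pleq k n) s -> (i <= j)%N -> (rk (cvar i) <= rk (cvar j))%N.
Proof.
move=> srt ij; apply: hrk.2; rewrite !pvar_cvar.
have [a0 _] : exists a0 : ksub k n, true by exists (tnth (in_tuple s) i).
rewrite !(tnth_nth a0) /=.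
by apply: (sorted_leq_nth pleq_trans pleq_refl) => //; rewrite inE.
Qed.

Lemma pvar_inj : injective (@pvar k n).
Proof. exact: enum_val_inj. Qed.

Lemma rk_pleq_lt i j : pleq (pvar i) (pvar j) -> i != j -> (rk i < rk j)%N.
Proof. by move=> /hrk.2 le ne; rewrite ltn_neqAle le andbT (inj_eq hrk.1). Qed.

(** There are more counted entries than the rank of the window containing them, so the columns
    indexed by S are dependent and the exchange polynomial vanishes. Later columns own lower
    intervals of the chain, so an entry of block j is replaced by smaller labels and the bracket
    drops in the poset. *)
Lemma exch_cc s f (u v : nat) : sorted (@pleq k n) s -> (u <= v)%N -> (v <= n)%N ->
  (rf f u%:Z (v - u) < cc s u v)%N -> exists2 q : Rkn K k n, Jf f q & is_lead rk q (tm s).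
Proof.
move=> srt uv vn viol.
have [x [x0 xS xu xE]] := cmx_thresholds (@cntk k n) s uv.
have sz : (0 < size s)%N by move: viol; rewrite /cc; case: (s).
have xm i j : (i <= j)%N -> (x j <= x i)%N.
  by move=> ij; rewrite -(subnK ij); elim: (j - i)%N => // t IH; apply: leq_trans (xS _) IH.
have xv j : (x j <= v)%N by rewrite -x0; apply: xm.
pose hi (j : 'I_(size s)) := x j; pose lo (j : 'I_(size s)) := x j.+1.
pose C (j : 'I_(size s)) := val (tnth (in_tuple s) j).
have [||S [J [SE JE cS]]] := @blocks_ex n _ (Ordinal sz) lo hi C.
- by move=> j; apply: xS.
- move=> y i j hi' hj; apply: val_inj; rewrite /lo /hi in hi' hj.
  by case: (ltngtP i j) => // lt; have := xm _ _ lt; lia.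
have {}cS : #|S| = cc s u v by rewrite cS /cc xE.
have Jlo y : y \in S -> (lo (J y) <= y < hi (J y))%N by rewrite SE => /andP[].
have HS y : y \in S -> y \in val (pvar (@cvar s (J y))).
  by rewrite SE pvar_cvar => /andP[].
have rkH j i :
  val (pvar (@cvar s j)) :\: [set s in S | J s == j] \subset val (pvar i) ->
  val (pvar i) \subset val (pvar (@cvar s j)) :|: [set s in S | (j < J s)%N] ->
  i != @cvar s j -> (rk i < rk (@cvar s j))%N.
  move=> /subsetP h1 /subsetP h2; apply: rk_pleq_lt; apply/pleqP.
  apply: (@cntS_exch _ _ _ (lo j)); first by rewrite !(eqP (valP (pvar _))).
    move=> y yC lt; apply: h1; rewrite !inE yC andbT; apply/negP => /andP[/Jlo h /eqP Jy].
    by rewrite Jy in h; lia.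
  move=> y /h2; rewrite !inE => /orP[//|/andP[/Jlo h lt]] ge.
  by have := xm _ _ lt; rewrite /lo /hi in h ge; lia.
have esur (a : ksub k n) : exists i, pvar i = a by exists (enum_rank a); rewrite /pvar enum_rankK.
exists (@exch K _ _ _ _ (@pvar k n) (fun=> 1) (@cvar s) S J); last first.
  rewrite tm_cvar; apply: exch_lead => //; first exact: pvar_inj.
    by move=> i; apply: oner_neq0.
  by move=> i j; apply: rk_cvar.
move=> M rM fM.
have rB : (\rank (blk M u (v - u)) < #|S|)%N.
  by rewrite cS (rank_rf n0 _ fM) //; lia.
have [y /Jlo h|w [w0 wS Mw]] := @kernel_supported _ _ _ _ M S _ _ rB.
  have -> : row y M^T = rw M y%:Z by rewrite /rw (vcol_ord n0) tr_col.
  apply: rw_blk => //; have := xu (J y).+1; have := xv (J y); rewrite /lo /hi in h; lia.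
apply: (@exch_vanish K _ _ _ _ (@pvar k n) (fun=> 1) pvar_inj esur _ _ _ HS M 1 _ w) => //.
Qed.
End Nonwrap.

(** * Complementary minors, and violated bounds on wrapped intervals *)

Section Dual.
Variables (K : fieldType) (k l : nat).
Let n := (k + l)%N.

Lemma ksubC_card (a : ksub k n) : #|~: val a| == l.
Proof. by have := cardsC (val a); rewrite card_ord (eqP (valP a)) => /addnI/eqP. Qed.

Definition ksubC (a : ksub k n) : ksub l n := exist _ (~: val a) (ksubC_card a).

Lemma ksubC_inj : injective ksubC.
Proof. by move=> a b /(congr1 val)/= /(can_inj setCK)/val_inj. Qed.

Lemma ksubC_sur b : exists a, ksubC a = b.
Proof.
have h : #|~: val b| == k.
  by have := cardsC (val b); rewrite card_ord (eqP (valP b)) addnC => /addIn/eqP.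
by exists (exist _ (~: val b) h); apply: val_inj; rewrite /= setCK.
Qed.

Lemma mul_ptMT r (M : 'M[K]_(r, n)) m (a : ksub m n) :
  M *m (ptM K a)^T = \matrix_(i, j) M i (kth a j).
Proof.
apply/matrixP => i j; rewrite !mxE (bigD1 (kth a j)) //= !mxE eqxx mulr1 big1 ?addr0 // => y ne.
by rewrite !mxE eq_sym (negbTE ne) mulr0.
Qed.

Lemma ptM_self m (a : ksub m n) : ptM K a *m (ptM K a)^T = 1%:M.
Proof.
by rewrite mul_ptMT; apply/matrixP => i j; rewrite !mxE (inj_eq (@kth_inj _ _ _)).
Qed.

Lemma ptM_C (a : ksub k n) : ptM K (ksubC a) *m (ptM K a)^T = 0.
Proof.
rewrite mul_ptMT; apply/matrixP => i j; rewrite !mxE; case: eqP => // e.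
by have := kth_mem (ksubC a) i; rewrite e /= inE kth_mem.
Qed.

Definition Qmx (a : ksub k n) : 'M[K]_n := row_mx (ptM K a)^T (ptM K (ksubC a))^T.

Lemma det_Qmx a : \det (Qmx a) != 0.
Proof.
have : \det (col_mx (ptM K a) (ptM K (ksubC a)) *m Qmx a) = 1.
  rewrite /Qmx mul_col_row !ptM_self ptM_C.
  have -> : ptM K a *m (ptM K (ksubC a))^T = 0.
    by apply: trmx_inj; rewrite trmx_mul trmxK ptM_C trmx0.
  by rewrite -scalar_mx_block det1.
by rewrite det_mulmx => h; apply/eqP => h0; move: h; rewrite h0 mulr0 => /esym/eqP; rewrite oner_eq0.
Qed.

(* Jacobi's complementary minors: up to a common scalar and a sign, given here by
   [det (Qmx a)], the maximal minors of [M] are those of a basis of its kernel. *)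
Lemma dual_pluck (M : 'M[K]_(k, n)) : \rank M = k -> exists (A : 'M[K]_(l, n)) c,
  M *m A^T = 0 /\ forall a, (\det (Qmx a))^-1 * pluck M a = c * pluck A (ksubC a).
Proof.
move=> rM; pose W := invmx (row_ebase M); pose C := col_ebase M.
have uW : W \in unitmx by rewrite unitmx_inv row_ebase_unit.
have uC : C \in unitmx by apply: col_ebase_unit.
have MW : M *m W = row_mx C 0.
  rewrite -{1}(mulmx_ebase M) mulmxK ?row_ebase_unit // rM.
  have -> : pid_mx k = row_mx 1%:M 0 :> 'M[K]_(k, k + l) by rewrite pid_mx_row.
  by rewrite mul_mx_row mulmx1 mulmx0.
have : M *m row_mx (lsubmx W) (rsubmx W) = row_mx C 0 by rewrite hsubmxK.
rewrite mul_mx_row => /eq_row_mx[ML MT].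
pose H := row_mx (lsubmx W *m invmx C) (rsubmx W).
have dH : \det H != 0.
  have -> : H = W *m block_mx (invmx C) 0 0 1%:M.
    by rewrite -[W in RHS]hsubmxK mul_row_block !mulmx0 addr0 add0r mulmx1.
  by rewrite det_mulmx det_ublock det1 mulr1; apply: mulf_neq0; rewrite -unitfE -unitmxE ?unitmx_inv ?row_ebase_unit.
exists (rsubmx W)^T; exists ((\det H)^-1); split=> [|a]; first by rewrite trmxK.
set E := ptM K (ksubC a).
(* [Qmx a] and [H] multiply the same matrix, M stacked on [E]: one product exposes the minor of M on
   a, the other the minor of the kernel on the complement. *)
have e1 : \det (col_mx M E) * \det (Qmx a) = pluck M a.
  rewrite -det_mulmx /Qmx mul_col_row -/E ptM_self ptM_C det_ublock det1 mulr1.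
  by rewrite mul_ptMT.
have e2 : \det (col_mx M E) * \det H = pluck (rsubmx W)^T (ksubC a).
  rewrite -det_mulmx /H mul_col_row MT mulmxA ML mulmxV // det_lblock det1 mul1r.
  rewrite /pluck -det_tr; congr (\det _); rewrite -mul_ptMT trmx_mul //.
by rewrite -e1 -e2 mulrC mulfK ?det_Qmx // [RHS]mulrC mulfK.
Qed.
End Dual.

Section Wrap.
Variables (K : fieldType) (k l : nat).
Notation n := (k + l)%N.
Hypothesis charK0 : [pchar K] =i pred0.
Hypothesis n0 : (0 < n)%N.
Variable rk : 'I_(nvars k n) -> nat.
Hypothesis hrk : lin_ext rk.

Lemma dcntk_C (a : ksub k n) x : (x <= n)%N -> dcntk a x = cntS (val (ksubC a)) x.
Proof. by move=> xn; rewrite /dcntk -{1}(cntS_C (val a) xn) addKn. Qed.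

(** The exchange takes place among the complementary columns, evaluated on the kernel matrix A.
    Later columns of the tableau now own higher intervals; a complement that moves up means a
    bracket that moves down, so the leading term is still the tableau. *)
Lemma exch_dd s f (u v : nat) : sorted (@pleq k n) s -> (u <= v)%N -> (v <= n)%N -> s != [::] ->
  (rf f v%:Z (n - (v - u)) + (v - u) < k + dd s u v)%N ->
  exists2 q : Rkn K k n, Jf f q & is_lead rk q (tm s).
Proof.
move=> srt uv vn s0 viol.
have [x [x0 xS xu xE]] := cmx_thresholds (@dcntk k n) (rev s) uv.
have sz : (0 < size s)%N by case: (s) s0.
have xm i j : (i <= j)%N -> (x j <= x i)%N.
  by move=> ij; rewrite -(subnK ij); elim: (j - i)%N => // t IH; apply: leq_trans (xS _) IH.
have xv j : (x j <= v)%N by rewrite -x0; apply: xm.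
pose hi (j : 'I_(size s)) := x (size s - j.+1)%N; pose lo (j : 'I_(size s)) := x (size s - j)%N.
pose C (j : 'I_(size s)) := val (ksubC (tnth (in_tuple s) j)).
have [||S [J [SE JE cS]]] := @blocks_ex n _ (Ordinal sz) lo hi C.
- by move=> j; apply: xm; lia.
- move=> y i j hi' hj; apply: val_inj; rewrite /lo /hi in hi' hj.
  case: (ltngtP i j) => // lt.
    by have := xm (size s - j)%N (size s - i.+1)%N; lia.
  by have := xm (size s - i)%N (size s - j.+1)%N; lia.
have {}cS : #|S| = dd s u v.
  have [a0 _] : exists a0 : ksub k n, true by exists (tnth (in_tuple s) (Ordinal sz)).
  pose G j := (dcntk (nth a0 (rev s) j) (x j) - dcntk (nth a0 (rev s) j) (x j.+1))%N.
  have -> : dd s u v = (\sum_(j < size s) G j)%N.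
    rewrite /dd xE -[RHS](big_mkord xpredT G) -[in RHS]size_rev big_mkord.
    by apply: eq_bigr => j _; rewrite (tnth_nth a0).
  rewrite cS [RHS](reindex_inj rev_ord_inj); apply: eq_bigr => j _; rewrite /G /=.
  have jl := ltn_ord j.
  rewrite nth_rev; last by lia.
  have -> : (size s - (size s - j.+1).+1 = j)%N by lia.
  have -> : ((size s - j.+1).+1 = size s - j)%N by lia.
  by rewrite !dcntk_C ?(leq_trans (xv _)) // /C (tnth_nth a0).
have Jlo y : y \in S -> (lo (J y) <= y < hi (J y))%N by rewrite SE => /andP[].
pose e (i : 'I_(nvars k n)) := ksubC (pvar i).
have HS y : y \in S -> y \in val (e (@cvar _ _ s (J y))).
  by rewrite SE /e pvar_cvar => /andP[].
have rkH j i :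
  val (e (@cvar _ _ s j)) :\: [set s in S | J s == j] \subset val (e i) ->
  val (e i) \subset val (e (@cvar _ _ s j)) :|: [set s in S | (j < J s)%N] ->
  i != @cvar _ _ s j -> (rk i < rk (@cvar _ _ s j))%N.
  move=> /subsetP h1 /subsetP h2; apply: (rk_pleq_lt hrk).
  have H x' : (cntS (val (e i)) x' <= cntS (val (e (cvar j))) x')%N.
    apply: (@cntS_exch _ _ _ (hi j)); first by rewrite (eqP (valP (e i))) (eqP (valP (e _))).
      move=> y /h2; rewrite !inE => /orP[//|/andP[/Jlo h lt]] ge.
      by have := xm (size s - J y)%N (size s - j.+1)%N; rewrite /lo /hi in h ge; lia.
    move=> y yC lt; apply: h1; rewrite !inE in yC *; rewrite yC andbT; apply/negP => /andP[/Jlo h /eqP Jy].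
    by rewrite Jy in h; lia.
  apply/pleqP => y; have [yn|ny] := leqP y n.
    by have := H y; have := cntS_C (val (pvar i)) yn; have := cntS_C (val (pvar (cvar j))) yn; rewrite /cntk /e /=; lia.
  by rewrite /cntk !cntS_big ?(ltnW ny) // !(eqP (valP (pvar _))).
have einj : injective e by move=> i i' /ksubC_inj/pvar_inj.
have esur b : exists i, e i = b.
  by have [a <-] := ksubC_sur b; exists (enum_rank a); rewrite /e /pvar enum_rankK.
pose ep (i : 'I_(nvars k n)) := (\det (Qmx K (pvar i)))^-1.
exists (@exch K _ _ _ _ e ep (@cvar _ _ s) S J); last first.
  rewrite tm_cvar; apply: exch_lead => //; first by move=> i; rewrite invr_eq0 det_Qmx.
  by move=> i j; apply: rk_cvar.
move=> M rM fM; have [A [c [MA pA]]] := dual_pluck rM.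
(* A dependency of the columns of A is a row y M. Choosing y to annihilate the window outside [u, v)
   and the uncounted columns of [u, v) leaves it supported on S. These columns of M have rank at
   most the rank of the window plus (v - u) - [dd s u v], which is less than k. *)
pose S' := [set y : 'I_n | (u <= y < v)%N] :\: S.
have cS' : (#|S'| + #|S| = v - u)%N.
  have SI : S \subset [set y : 'I_n | (u <= y < v)%N].
    apply/subsetP => y /Jlo h; rewrite inE; have := xu (size s - J y)%N; have := xv (size s - (J y).+1)%N.
    by rewrite /lo /hi in h; lia.
  rewrite addnC -[in #|S|](setIidPr SI) cardsID.
  have -> : [set y : 'I_n | (u <= y < v)%N] = [set y in [set: 'I_n] | (u <= y < v)%N].
    by apply/setP => y; rewrite !inE.
  rewrite card_interval //.
  have cT z : (z <= n)%N -> cntS [set: 'I_n] z = z.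
    move=> zn; have := cntS_C [set: 'I_n] zn; rewrite setCT.
    suff -> : cntS (set0 : {set 'I_n}) z = 0%N by rewrite addn0.
    by apply/eqP; rewrite cards_eq0; apply/eqP/setP => y; rewrite !inE.
  by rewrite !cT //; lia.
pose B2 : 'M[K]_(#|S'|, k) := \matrix_i rw M (enum_val i : 'I_n)%:Z.
have rB : (\rank (blk M v%:Z (n - (v - u)) + B2)%MS < k)%N.
  have h1 := (mxrank_adds_leqif (blk M v%:Z (n - (v - u))) B2).1.
  have h2 := rank_leq_row B2.
  have := rank_rf n0 v%:Z fM (leq_subr (v - u) n); lia.
have [|y y0 yB] := @kernel_vector _ _ _ (blk M v%:Z (n - (v - u)) + B2)%MS^T.
  by rewrite mxrank_tr.
apply: (@exch_vanish K _ _ _ _ e ep einj esur _ _ _ HS A c _ (y *m M)^T).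
- by move=> i; apply: pA.
- have /row_freeP[R MR] : row_free M by apply/eqP.
  apply: contraNneq y0 => h; have {}h : y *m M = 0 by apply: trmx_inj; rewrite h trmx0.
  by rewrite -[y]mulmx1 -MR mulmxA h mul0mx.
- move=> z zS.
  have /submxP[D DE] : (rw M z%:Z <= blk M v%:Z (n - (v - u)) + B2)%MS.
    have zn := ltn_ord z; have [zv|vz] := leqP v z.
      by apply: submx_trans (addsmxSl _ _); apply: rw_blk => //; lia.
    have [uz|zu] := leqP u z.
      apply: submx_trans (addsmxSr _ _); have zS' : z \in S' by rewrite !inE zS uz vz.
      by have := row_sub (enum_rank_in zS' z) B2; rewrite rowK enum_rankK_in.
    apply: submx_trans (addsmxSl _ _).
    have -> : rw M z%:Z = rw M (z%:Z + 1 * n%:Z) by rewrite /rw vcol_per.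
    by apply: rw_blk => //; lia.
  have -> : (y *m M)^T z 0 = (y *m (rw M z%:Z)^T) 0 0.
    by rewrite !mxE; apply: eq_bigr => i _; rewrite !mxE (vcol_ord n0) mxE.
  by rewrite DE trmx_mul mulmxA yB mul0mx mxE.
by rewrite -[A]trmxK -trmx_mul -mulmxA MA mulmx0 trmx0.
Qed.
End Wrap.

(** * Standard monomials and promotion *)

Section Final.
Variables (K : fieldType) (k n d : nat).
Hypothesis charK0 : [pchar K] =i pred0.
Hypotheses (k0 : (0 < k)%N) (kn : (k < n)%N) (d0 : (0 < d)%N).
Variable rk : 'I_(nvars k n) -> nat.
Hypothesis hrk : lin_ext rk.

Let n0 : (0 < n)%N := leq_ltn_trans (leq0n k) kn.

Lemma fits_or_lead s f : s != [::] -> sorted (@pleq k n) s ->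
  (forall i, f (i + n%:Z) = f i + n%:Z) ->
  fits s f \/ exists2 q : Rkn K k n, Jf f q & is_lead rk q (tm s).
Proof.
move=> s0 srt per.
have [/'forall_'forall_idP ok|notfits] := boolP [forall u : 'I_n, forall m : 'I_n.+1, rho s u%:Z m <= (rf f u%:Z m)%:Z].
  left=> x m mn; have [u [t [un ->]]] := modn_dec n0 x.
  rewrite rf_per //; have -> : rho s (u%:Z + t * n%:Z) m = rho s u%:Z m by rewrite /rho addrC modzMDl.
  exact: (ok (Ordinal un) (Ordinal (mn : m < n.+1)%N)).
right; move: notfits; rewrite negb_forall => /existsP[u]; rewrite negb_forall => /existsP[m]; rewrite -ltNge.
have un := ltn_ord u; have mn := ltn_ord m.
rewrite /rho modz_small ?absz_nat; last by lia.
rewrite /Rr; case: leqP => h.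
  rewrite ltz_nat => lt; apply: (exch_cc charK0 n0 hrk srt (leq_addr m u) h).
  by rewrite addKn.
(* Writing n as k + l, with l the dimension of the kernel, gives complements and kernel matrices
   their types. *)
move=> lt; have E := subnKC (ltnW kn); move: (n - k)%N E => l E.
have viol : (rf f u%:Z (n - (u - (u + m - n))) + (u - (u + m - n)) < k + dd s (u + m - n) u)%N.
  have -> : (n - (u - (u + m - n)) = m)%N by lia.
  by lia.
have uv : (u + m - n <= u)%N by lia.
clear -charK0 n0 hrk srt s0 viol uv un E; move: (nat_of_ord u) (_ + m - n)%N viol uv un => v w viol wv vn.
subst n; exact: (exch_dd charK0 n0 hrk srt wv (ltnW vn) s0 viol).
Qed.

Lemma tmono_cols (T : tab k n d) : ssyt T -> Defs.tmono T = tm (cols T).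
Proof.
move=> sT; apply/mnmP => i; rewrite mnmE /tm mnm_sumE.
have E : forall s : seq (ksub k n), (\sum_(a <- s) U_(enum_rank a : 'I_(nvars k n))%MM i = count (pred1 (val (pvar i))) (map val s))%N.
  elim=> [|a s IH]; first by rewrite big_nil.
  rewrite big_cons IH /= mnm1E; congr (nat_of_bool _ + _)%N.
  by rewrite -(inj_eq enum_val_inj) enum_rankK -(inj_eq val_inj).
rewrite E cols_val // count_map enumT cardE /enum_mem size_filter; apply: eq_count => j /=.
by rewrite inE eq_sym.
Qed.

Lemma inBfP f (T : tab k n d) : is_bound k n f -> inBf K rk f T <-> ssyt T /\ fits (cols T) f.
Proof.
move=> B; have [_ per _ _] := B; have Jm := @Jf_mul K k n f.
split=> -[sT h]; split=> //; have c0 := cols_n0 k0 kn d0 sT.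
all: have srt := cols_sorted k0 kn d0 sT.
  have [//|[q Jq ld]] := fits_or_lead c0 srt per.
  by case: h; rewrite tmono_cols //; apply/(init_lead rk _ Jm); exists q.
rewrite tmono_cols // => /(init_lead rk _ Jm).
have gf : good k n f.
  apply: bound_good => // x; rewrite -lez_nat -(rhon c0 srt n0 x); exact: h.
move=> [q Jq ld]; move: c0 srt h ld; case: (cols T) => // a s _ srt h; exact: (no_lead_fits charK0 k0 n0 hrk srt gf h Jq).
Qed.

Lemma is_bound_chi f : is_bound k n f -> is_bound k n (chi f).
Proof.
move=> [[g fg gf] per sm bnd]; split.
- exists (fun i => g (i - 1) + 1) => i; rewrite /chi; first by rewrite addrK fg subrK.
  by rewrite addrK gf subrK.
- by move=> i; rewrite /chi -addrA [n%:Z - 1]addrC addrA per addrAC.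
- rewrite -sm; move: n0 per; rewrite /chi; case: (n) => // m _ per.
  rewrite big_ord_recl [RHS]big_ord_recr /= [RHS]addrC; congr (_ + _).
    have := per (-1); rewrite (_ : -1 + m.+1%:Z = m%:Z) //; last by lia.
    by move=> ->; rewrite -[f (0%Z - 1)]/(f (-1)); lia.
  apply: eq_bigr => i _; rewrite /bump /= add1n (_ : i.+1%:Z - 1 = i%:Z); lia.
by move=> i; rewrite /chi; have := bnd (i - 1); lia.
Qed.
End Final.

Theorem theorem6p1 (K : closedFieldType) (k n d : nat)
  (charK0 : [pchar K]%R =i pred0)
  (hk : (1 <= k)%N) (hkn : (k < n)%N) (hd : (1 <= d)%N)
  (rk : 'I_(nvars k n) -> nat) (hrk : lin_ext rk)
  (f : int -> int) (hf : is_bound k n f) :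
  (forall T : tab k n d, ssyt T ->
     (inBf K rk f T <-> inBf K rk (chi f) (prom T))) /\
  (forall T1 T2 : tab k n d, inBf K rk f T1 -> inBf K rk f T2 ->
     prom T1 = prom T2 -> T1 = T2) /\
  (forall T' : tab k n d, inBf K rk (chi f) T' ->
     exists2 T : tab k n d, inBf K rk f T & prom T = T').
Proof.
have hc := is_bound_chi hk hkn hd hf.
have P1 (T : tab k n d) : ssyt T -> (inBf K rk f T <-> inBf K rk (chi f) (prom T)).
  move=> sT; have b1 := inBfP charK0 hk hkn hd hrk T hf.
  have b2 := inBfP charK0 hk hkn hd hrk (prom T) hc.
  have sP := prom_ssyt hk hkn hd sT; have := fits_prom hk hkn hd f sT.
  by tauto.
split=> //; split=> [T1 T2 [s1 _] [s2 _]|T' BT']; first exact: prom_inj.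
have [sT' _] := BT'.
have : T' \in [set prom T | T in [set T : tab k n d | ssyt T]].
  have -> : [set prom T | T in [set T : tab k n d | ssyt T]] = [set T : tab k n d | ssyt T].
    apply/eqP; rewrite eqEcard card_in_imset ?leqnn ?andbT; last first.
      by move=> T1 T2; rewrite !inE; apply: prom_inj.
    by apply/subsetP => _ /imsetP[T + ->]; rewrite !inE; apply: prom_ssyt.
  by rewrite inE.
by move=> /imsetP[T + eT]; rewrite inE => sT; exists T => //; apply/(P1 T sT); rewrite -eT.
Qed.
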